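(* Let $E_0,F_0\in BV(\Omega,\{0,1\})$ be nonempty and bounded, and let $\beta_1,\beta_2\in L^\infty(\partial\Omega)$ be such that for some $\kappa\in(0,\frac12]$ one has $-1\le\beta_i\le 1-2\kappa$ $\mathcal H^n$-a.e. on $\partial\Omega$, $i=1,2$. Let $\lambda\ge1$. Suppose that $E_0\subseteq F_0$ and $\beta_1\le\beta_2$. Then: (a) there exists a minimizer $F_\lambda^*$ of $\mathcal A_{\beta_2}(\cdot,F_0,\lambda)$ containing any minimizer of $\mathcal A_{\beta_1}(\cdot,E_0,\lambda)$; (b) there exists a minimizer $E_{\lambda *}$ of $\mathcal A_{\beta_1}(\cdot,E_0,\lambda)$ contained in any minimizer of $\mathcal A_{\beta_2}(\cdot,F_0,\lambda)$. If in addition $\mathrm{dist}(\Omega\cap\partial E_0,\Omega\cap\partial F_0)>0$, then all minimizers $E_\lambda$ of $\mathcal A_{\beta_1}(\cdot,E_0,\lambda)$ and $F_\lambda$ of $\mathcal A_{\beta_2}(\cdot,F_0,\lambda)$ satisfy $E_\lambda\subseteq F_\lambda$. (Minimizers are over $BV(\Omega,\{0,1\})$ and may be empty.)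
   Context: Let $n\ge1$, $\Omega=\mathbb R^n\times(0,+\infty)\subset\mathbb R^{n+1}$, and identify $\partial\Omega=\mathbb R^n\times\{0\}$ with $\mathbb R^n$. $BV(\Omega,\{0,1\})$ is the collection of measurable $E\subseteq\Omega$ with $\chi_E\in BV(\Omega)$ (in particular $|E|<\infty$), and $P(E,\Omega)=\int_\Omega|D\chi_E|$. Each set is identified with its set of points of Lebesgue density one (so sets are considered up to null sets and inclusions are meant accordingly). On $\partial\Omega$, $\chi_E$ denotes the trace of $E$, which belongs to $L^1(\partial\Omega)$. For $\beta\in L^\infty(\partial\Omega)$, the capillary functional is $\mathcal C_\beta(E,\Omega)=P(E,\Omega)-\int_{\partial\Omega}\beta\chi_E\,d\mathcal H^n$. For $F\subseteq\Omega$, $d_F(x)=\mathrm{dist}(x,\Omega\cap\partial F)$ (the distance from the empty set is $+\infty$). For $\lambda\ge1$, $$\mathcal A_\beta(E,E_0,\lambda)=\mathcal C_\beta(E,\Omega)+\lambda\int_{E\Delta E_0}d_{E_0}\,dx,\qquad E\in BV(\Omega,\{0,1\}),$$ where the last integral is $0$ by convention if $|E\Delta E_0|=0$. *)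

(* Defs.v *)
From HB Require Import structures.
From mathcomp Require Import all_boot all_order all_algebra.
From mathcomp Require Import all_classical all_reals all_analysis.
Set Implicit Arguments.
Unset Strict Implicit.
Unset Printing Implicit Defensive.
Import Order.TTheory GRing.Theory Num.Theory.
Import numFieldNormedType.Exports.
Local Open Scope classical_set_scope.
Local Open Scope ring_scope.

(* ['rV[R]_n] stands for R^n. It carries the sigma-algebra generated by the
   coordinates, that is, the Borel sigma-algebra. *)
Section row_measurable.
Variables (R : realType) (n : nat).

Definition row_coord (i : 'I_n) (v : 'rV[R]_n) : measurableTypeR R := v ord0 i.

Let row_set0 : g_sigma_preimage row_coord set0.
Proof. exact: sigma_algebra0. Qed.

Let row_setC A : g_sigma_preimage row_coord A ->
  g_sigma_preimage row_coord (~` A).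
Proof. exact: sigma_algebraC. Qed.

Let row_bigcup (F : _^nat) : (forall i, g_sigma_preimage row_coord (F i)) ->
  g_sigma_preimage row_coord (\bigcup_i (F i)).
Proof. exact: sigma_algebra_bigcup. Qed.

HB.instance Definition _ := @isMeasurable.Build default_measure_display
  'rV[R]_n (g_sigma_preimage row_coord) row_set0 row_setC row_bigcup.

Lemma measurable_row_coord i : measurable_fun [set: 'rV[R]_n] (row_coord i).
Proof.
move=> _ Y mY; rewrite setTI; apply: sub_sigma_algebra => /=.
rewrite -bigcup_seq/=; exists i => /=; first by rewrite mem_index_enum.
by exists Y => //; rewrite setTI.
Qed.

Lemma measurable_rowP d (T : measurableType d) (f : T -> 'rV[R]_n) :
  (forall i, measurable_fun [set: T] (row_coord i \o f)) ->
  measurable_fun [set: T] f.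
Proof.
move=> mf; have prefS : g_sigma_preimage (fun i => row_coord i \o f) `<=`
    measurable.
  apply: smallest_sub; first exact: sigma_algebra_measurable.
  by rewrite -bigcup_seq/= => A [i _ [B mB <-]]; exact: mf.
by rewrite g_sigma_preimage_comp in prefS => _ A mA; apply: prefS; exists A.
Qed.

End row_measurable.

(* The library declares this instance, but one for finite measures hides it. *)
Lemma sigma_finite_product d1 d2 (T1 : measurableType d1)
    (T2 : measurableType d2) (R : realType)
    (m1 : {sigma_finite_measure set T1 -> \bar R})
    (m2 : {sigma_finite_measure set T2 -> \bar R}) :
  sigma_finite setT (m1 \x m2)%E.
Proof.
have /sigma_finiteP[F [TF ndF Foo]] := sigma_finiteT m1.
have /sigma_finiteP[G [TG ndG Goo]] := sigma_finiteT m2.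
exists (fun k => F k `*` G k).
  rewrite -setXTT TF TG predeqE => -[x y]; split.
    move=> [/= [i _ Fix] [k _ Gky]]; exists (maxn i k) => //; split.
    - by move: x Fix; exact/subsetPset/ndF/leq_maxl.
    - by move: y Gky; exact/subsetPset/ndG/leq_maxr.
  by move=> [i _ []/= ? ?]; split; exists i.
move=> k; have [? ?] := Foo k; have [? ?] := Goo k.
split; first exact: measurableX.
by rewrite product_measure1E// lte_mul_pinfty// ge0_fin_numE.
Qed.

(* [ambient R n] stands for R^(n+1) = R^n x R. *)
Definition ambient (R : realType) (n : nat) : Type :=
  ('rV[R]_n * measurableTypeR R)%type.

(* Lebesgue measure on R^n, by induction on n: R^(n+1) is identified with
   R^n x R. *)
Section lebesgue_row.
Variable R : realType.

Definition row_cons n (z : 'rV[R]_n * measurableTypeR R) : 'rV[R]_n.+1 :=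
  row_mx (const_mx z.2 : 'rV[R]_1) z.1.

Let row_uncons n (v : 'rV[R]_n.+1) : 'rV[R]_n * measurableTypeR R :=
  (rsubmx (v : 'rV[R]_(1 + n)), row_coord ord0 v).

Lemma row_cons0 n (z : 'rV[R]_n * measurableTypeR R) :
  row_coord ord0 (row_cons z) = z.2.
Proof.
have -> : (ord0 : 'I_n.+1) = lshift n (ord0 : 'I_1) by apply/val_inj.
by apply: etrans (row_mxEl _ _ _ _) _; rewrite mxE.
Qed.

Lemma row_consS n (z : 'rV[R]_n * measurableTypeR R) i :
  row_coord (lift ord0 i) (row_cons z) = row_coord i z.1.
Proof.
have -> : lift ord0 i = rshift 1 i by apply/val_inj.
exact: row_mxEr.
Qed.

Let row_consK n : cancel (@row_cons n) (@row_uncons n).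
Proof.
by move=> [v t]; rewrite /row_uncons row_cons0 /row_cons row_mxKr.
Qed.

Lemma measurable_row_cons n : measurable_fun setT (@row_cons n).
Proof.
apply: measurable_rowP => i; case: (unliftP ord0 i) => [j ->|->].
  rewrite (_ : _ \o _ = row_coord j \o fst).
    apply: measurableT_comp => //; exact: measurable_row_coord.
  by apply/funext => z; rewrite /= row_consS.
by rewrite (_ : _ \o _ = snd)//; apply/funext => z; rewrite /= row_cons0.
Qed.

Let measurable_row_uncons n : measurable_fun setT (@row_uncons n).
Proof.
apply/measurable_fun_pairP; split; last exact: measurable_row_coord.
apply: measurable_rowP => i.
rewrite (_ : _ \o _ = row_coord (rshift 1 i : 'I_n.+1)).
  exact: measurable_row_coord.
by apply/funext => v; rewrite /row_coord /= mxE.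
Qed.

Section succ.
Variables (n : nat) (m : {sigma_finite_measure set 'rV[R]_n -> \bar R}).

Definition leb_succ : set 'rV[R]_n.+1 -> \bar R :=
  pushforward (m \x lebesgue_measure)%E (@row_cons n).

Let leb_succ0 : (leb_succ set0 = 0)%E.
Proof. by rewrite /leb_succ /pushforward preimage_set0 measure0. Qed.

Let leb_succ_ge0 A : (0 <= leb_succ A)%E.
Proof. by rewrite /leb_succ /pushforward measure_ge0. Qed.

Let leb_succ_sigma_additive : semi_sigma_additive leb_succ.
Proof.
move=> F mF tF mUF; rewrite /leb_succ /pushforward preimage_bigcup.
have mP A : measurable A -> measurable (@row_cons n @^-1` A).
  by move=> mA; rewrite -[X in measurable X]setTI; exact: measurable_row_cons.
apply: measure_semi_sigma_additive => //.
- by move=> k; exact: mP.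
- apply/trivIsetP => /= i j _ _ ij; rewrite -preimage_setI.
  by move/trivIsetP : tF => /(_ _ _ _ _ ij) ->//; rewrite preimage_set0.
- by rewrite -preimage_bigcup; exact: mP.
Qed.

HB.instance Definition _ :=
  isMeasure.Build _ _ _ leb_succ leb_succ0 leb_succ_ge0 leb_succ_sigma_additive.

Let leb_succ_sigma_finite : sigma_finite setT leb_succ.
Proof.
have [F TF mF] := sigma_finite_product m (@lebesgue_measure R).
exists (fun k => @row_uncons n @^-1` F k).
  by rewrite -preimage_bigcup -TF preimage_setT.
move=> k; have [mFk Foo] := mF k; split.
  by rewrite -[X in measurable X]setTI; exact: measurable_row_uncons.
rewrite /leb_succ /pushforward -comp_preimage (_ : _ \o _ = id)//.
by apply/funext => z /=; rewrite row_consK.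
Qed.

HB.instance Definition _ :=
  Measure_isSigmaFinite.Build _ _ _ leb_succ leb_succ_sigma_finite.

End succ.

Fixpoint leb n : {sigma_finite_measure set 'rV[R]_n -> \bar R} :=
  if n is k.+1 then leb_succ (leb k) else dirac (0 : 'rV[R]_0).

Lemma leb_box n (A : 'I_n -> set (measurableTypeR R)) :
  (forall i, measurable (A i)) ->
  leb n [set v | forall i, A i (row_coord i v)] =
  (\prod_(i < n) lebesgue_measure (A i))%E.
Proof.
elim: n A => [A _|n IH A mA].
  rewrite big_ord0 /= diracE (_ : [set _ | _] = setT) ?in_setT//.
  by apply/seteqP; split => // v _ [].
rewrite big_ord_recl muleC -(IH (A \o lift ord0)); last by move=> i; exact: mA.
rewrite [LHS](_ : _ = (leb n \x lebesgue_measure)%E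
    ([set v | forall i, (A \o lift ord0) i (row_coord i v)] `*` A ord0)).
  rewrite product_measure1E//.
  rewrite (_ : mkset _ = \bigcap_(i in [set: 'I_n])
      (row_coord i @^-1` (A \o lift ord0) i)).
    apply: fin_bigcap_measurable => // i _.
    by rewrite -[X in measurable X]setTI;
      apply: measurable_row_coord => //; exact: mA.
  by apply/seteqP; split => [v vA i _|v vA i]; [exact: vA|exact: (vA i I)].
rewrite /= /leb_succ /pushforward; congr (product_measure1 _ _ _).
apply/seteqP; split => z /=.
  by move=> zA; split => [i|]; rewrite -?row_cons0 -?row_consS; exact: zA.
move=> [zA z0] i; case: (unliftP ord0 i) => [j ->|->].
  by rewrite row_consS; exact: zA.
by rewrite row_cons0.
Qed.

End lebesgue_row.

Definition volume (R : realType) (n : nat) : set (ambient R n) -> \bar R :=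
  (leb R n \x lebesgue_measure)%E.

HB.instance Definition _ (R : realType) (n : nat) :=
  Measure.on (@volume R n).
HB.instance Definition _ (R : realType) (n : nat) :=
  Measure_isSigmaFinite.Build _ _ _ (@volume R n)
    (sigma_finite_product (leb R n) lebesgue_measure).

Section capillary.
Variables (R : realType) (n : nat).
Local Notation V := (ambient R n).
Local Notation mu := (@volume R n).
Implicit Types (E F G : set V) (u : V -> R) (z : V) (beta : 'rV[R]_n -> R).

(* The norms of the library on row vectors and on products are sup norms. *)
Definition eucl_norm z : R :=
  Num.sqrt (\sum_(i < n) z.1 ord0 i ^+ 2 + (z.2 : R) ^+ 2).

Definition eucl_ball z (r : R) : set V := [set w | eucl_norm (w - z) < r].

Definition Omega : set V := [set z | 0 < (z.2 : R)].

Definition divergence (phi : V -> V) z : R :=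
  \sum_(i < n) 'D_((delta_mx ord0 i, 0) : V) (fun w => (phi w).1 ord0 i) z
  + 'D_((0, 1) : V) (fun w => (phi w).2 : R) z.

(* In finite dimension, C^1 means that all directional derivatives exist and
   are continuous. *)
Definition C1 (phi : V -> V) : Prop :=
  forall v, (forall z, derivable phi z v) /\ continuous (fun z => 'D_v phi z).

Definition compact_support_in (D : set V) (phi : V -> V) : Prop :=
  exists K, [/\ compact K, K `<=` D & forall z, ~ K z -> phi z = 0].

(* \int_Omega |Du| *)
Definition total_var u : \bar R :=
  ereal_sup [set (\int[mu]_(z in Omega) (u z * divergence phi z)%:E)%E |
    phi in [set phi | [/\ C1 phi, compact_support_in Omega phi &
                        forall z, eucl_norm (phi z) <= 1]]].

Definition BV u : Prop :=
  mu.-integrable Omega (EFin \o u) /\ (total_var u < +oo)%E.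

(* A set of BV(Omega, {0,1}) is given by any of its Borel representatives. *)
Definition BV_set E : Prop :=
  [/\ measurable E, E `<=` Omega & BV (\1_E : V -> R)].

Definition perimeter E : \bar R := total_var (\1_E : V -> R).

Definition density_one E : set V :=
  [set z | fine (mu (E `&` eucl_ball z r)) / fine (mu (eucl_ball z r))
             @[r --> 0^'+] --> (1 : R)].

(* Inclusion up to a null set. *)
Definition ae_subset E F : Prop := mu (E `\` F) = 0%E.

(* The trace at the boundary point (y, 0) is the real number c such that the
   mean of |u - c| over the half ball of radius r centred at (y, 0) tends to 0
   as r -> 0+. Such a c is unique; it exists for almost every y if u is BV, and
   the value at the other points is irrelevant. *)
Definition trace u (y : 'rV[R]_n) : R :=
  let half_ball r := Omega `&` eucl_ball ((y, 0) : V) r in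
  xget 0 [set c : R |
    (\int[mu]_(z in half_ball r) `|u z - c|) / fine (mu (half_ball r))
      @[r --> 0^'+] --> (0 : R)].

Definition capillary beta E : \bar R :=
  (perimeter E -
   \int[leb R n]_y (beta y * trace (\1_E : V -> R) y)%:E)%E.

(* Omega `&` boundary of F *)
Definition rel_boundary F : set V := Omega `&` (closure F `\` interior F).

(* The infimum of the empty set is +oo. *)
Definition boundary_dist F z : \bar R :=
  ereal_inf [set (eucl_norm (z - w))%:E | w in rel_boundary F].

Definition set_dist (A B : set V) : \bar R :=
  ereal_inf [set (eucl_norm (p.1 - p.2))%:E | p in A `*` B].

(* The last integral is 0 when its domain is null, even if the integrand
   is +oo. *)
Definition ATW beta E0 (lambda : R) E : \bar R :=
  (capillary beta E + lambda%:E *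
   \int[mu]_(z in (E `\` E0) `|` (E0 `\` E)) boundary_dist E0 z)%E.

Definition minimizer beta E0 (lambda : R) E : Prop :=
  BV_set E /\
  forall G, BV_set G -> (ATW beta E0 lambda E <= ATW beta E0 lambda G)%E.

End capillary.

(* Main.v *)
(* The energies A1 = A_beta1(., E0, lambda) and A2 = A_beta2(., F0, lambda)
   satisfy A1(E n F) + A2(E u F) <= A1(E) + A2(F). For the perimeter one tests
   with convex combinations of two fields against smooth approximations of the
   minimum and the maximum of mollified indicators; for the trace terms one uses
   that the trace is again an indicator; for the distance terms one uses that a
   segment from a point of E0 to the boundary of F0 meets the boundary of E0.
   Hence intersections and unions of minimizers are minimizers, and (a) and (b)
   hold for the minimizer of A2 of largest volume and the minimizer of A1 of
   smallest volume; if the boundaries are at positive distance, the distance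
   terms give strict inequality unless E \ F is null.

   No compactness in BV is needed: by submodularity, if A(E_k) exceeds the
   infimum by 2^-k, then limsup E_k minimizes A as soon as A is lower
   semicontinuous along monotone sequences. The trace term is controlled by
   testing the perimeter with phi -+ (0, chi_a - chi_b), where chi_a is a smooth
   cutoff of the layer {t < a}: as a -> 0 this gives
     int_E div phi <= P(E) +- (|tr E| - int_E d_t chi_b)
   for phi vanishing on {t < b}, and the right sign absorbs the change of the
   trace of a monotone sequence. The same argument applied to vertical fields on
   a thin layer bounds the measure of the points y whose vertical segment
   {y} x (0, b) meets both E and its complement in positive length, so that the
   trace of E is almost everywhere the indicator of the points y such that
   {y} x (0, b) is in E up to a null set for some b > 0. *)
Require Import Defs.
From mathcomp Require Import all_boot all_order all_algebra.
From mathcomp Require Import all_classical all_reals all_analysis.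
From mathcomp Require Import measurable_realfun.
From mathcomp Require Import ring lra.
Import Order.TTheory GRing.Theory Num.Theory.
Import numFieldNormedType.Exports.
Local Open Scope classical_set_scope.
Local Open Scope ring_scope.
Set Implicit Arguments.
Unset Strict Implicit.
Unset Printing Implicit Defensive.

(** The perimeter is a supremum over fields that vanish near the boundary of the half space, whereas
    the trace lives on that boundary. Everything about traces is therefore extracted by adding to a
    test field a vertical field on a thin layer below its support. Mollification must not push test
    fields out of the half space either: the kernel is centred at height [e / 2], so that only
    upward translates of a field occur. The almost everywhere statements rest on Lebesgue's density
    theorem, proved with cubes, whose volume is explicit. The bound -1 <= beta serves increasing
    sequences and beta <= 1 decreasing ones; kappa > 0 makes the capillary functional control the
    perimeter, which keeps monotone limits in BV; the boundedness of the initial sets together with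
    lambda >= 1 bounds the volume of sets of bounded energy. Topological boundaries depend on the
    representative: the normalization by density points turns the almost everywhere inclusion of the
    initial sets into an inclusion, as the segment argument requires. *)

(** * Translation invariance of Lebesgue measure *)

Section translation.
Variable R : realType.

Lemma measurable_shift_real (a : R) :
  measurable_fun [set: measurableTypeR R]
    ((fun x => x + a) : measurableTypeR R -> measurableTypeR R).
Proof. exact: measurable_realfun.measurable_funD. Qed.

Lemma lebesgue_measure_shift (a : R) (A : set (measurableTypeR R)) :
  measurable A ->
  lebesgue_measure ((fun x : R => x + a) @^-1` A) = lebesgue_measure A.
Proof.
move=> mA; apply/esym.
pose f := (fun x => x + a) : measurableTypeR R -> measurableTypeR R.
have mf : measurable_fun setT f by exact: measurable_shift_real.
apply: (@lebesgue_measure_unique _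
  (@pushforward _ _ _ _ _ lebesgue_measure f)) => //.
move=> _ [[x y] _ <-]; rewrite [RHS](_ : _ = lebesgue_measure `](x - a), (y - a)]%classic).
  rewrite !lebesgue_measure_itv/= !lte_fin ltrD2r.
  by case: ifPn => // _; rewrite -!EFinB opprB addrA subrK.
congr lebesgue_measure.
by apply/seteqP; split => t /=; rewrite !in_itv/= ltrBlDr lerBrDr.
Qed.

Lemma measurable_row_shift n (a : 'rV[R]_n) :
  measurable_fun setT (fun v : 'rV[R]_n => v + a).
Proof.
apply: measurable_rowP => i.
rewrite (_ : _ \o _ = (fun x : measurableTypeR R => (x + row_coord i a) : measurableTypeR R) \o row_coord i).
  apply: measurableT_comp; first exact: measurable_shift_real.
  exact: measurable_row_coord.
by apply/funext => v; rewrite /row_coord /= mxE.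
Qed.

Lemma measurable_prod_shift n (a : 'rV[R]_n * measurableTypeR R) :
  measurable_fun setT
    (fun z : 'rV[R]_n * measurableTypeR R => (z.1 + a.1, (z.2 : R) + a.2) : 'rV[R]_n * measurableTypeR R).
Proof.
apply/measurable_fun_pairP; split.
  rewrite (_ : _ \o _ = (fun v => v + a.1) \o fst)//.
  by apply: measurableT_comp => //; exact: measurable_row_shift.
rewrite (_ : _ \o _ = ((fun x : measurableTypeR R => ((x : R) + a.2) : measurableTypeR R)) \o snd)//.
by apply: measurableT_comp => //; exact: measurable_shift_real.
Qed.

(** Both sides are measures in [A] that agree on rectangles, so uniqueness of the product measure
    applies. *)
Lemma product_shift n (m : {sigma_finite_measure set 'rV[R]_n -> \bar R})
    (a : 'rV[R]_n * measurableTypeR R) (A : set ('rV[R]_n * measurableTypeR R)) :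
  (forall B : set 'rV[R]_n, measurable B ->
    m ((fun v => v + a.1) @^-1` B) = m B) ->
  measurable A ->
  (m \x lebesgue_measure)%E
    ((fun z => (z.1 + a.1, (z.2 : R) + a.2)) @^-1` A) =
  (m \x lebesgue_measure)%E A.
Proof.
move=> mS mA; apply/esym.
pose f := (fun z => (z.1 + a.1, (z.2 : R) + a.2)) : 'rV[R]_n * measurableTypeR R -> 'rV[R]_n * measurableTypeR R.
have mf : measurable_fun setT f by exact: measurable_prod_shift.
apply: (@product_measure_unique _ _ _ _ _ m lebesgue_measure
  (@pushforward _ _ _ _ _ (m \x lebesgue_measure)%E f)) => // B C mB mC.
have mB' : measurable ((fun v => v + a.1) @^-1` B).
  by rewrite -[X in measurable X]setTI; exact: measurable_row_shift.
have mC' : measurable ((fun x : measurableTypeR R => ((x : R) + a.2) : measurableTypeR R) @^-1` C).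
  by rewrite -[X in measurable X]setTI; exact: measurable_shift_real.
rewrite [LHS](_ : _ = (m \x lebesgue_measure)%E
  (((fun v => v + a.1) @^-1` B) `*` ((fun x : R => x + a.2) @^-1` C)))//.
rewrite product_measure1E//; congr (_ * _)%E; first exact: mS.
exact: lebesgue_measure_shift.
Qed.

(** Induction on the dimension: [row_cons] carries a translation of R^n x R to a translation of
    R^(n+1). *)
Lemma leb_shift n (a : 'rV[R]_n) (A : set 'rV[R]_n) : measurable A ->
  leb R n ((fun v => v + a) @^-1` A) = leb R n A.
Proof.
elim: n a A => [a A mA|n IH a A mA].
  congr (leb R 0 _); apply/seteqP; split => v /=; rewrite (_ : v + a = v)//;
    exact: thinmx0_eq || by apply/rowP => -[].
pose b : 'rV[R]_n * measurableTypeR R := (rsubmx (a : 'rV_(1 + n)), row_coord ord0 a).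
have mA' : measurable (@row_cons R n @^-1` A).
  by rewrite -[X in measurable X]setTI; exact: measurable_row_cons.
have key z : row_cons z + a = row_cons (z.1 + b.1, (z.2 : R) + b.2).
  apply/rowP => i; rewrite mxE.
  have E0 := @row_cons0 R n; have ES := @row_consS R n.
  rewrite /row_coord in E0 ES.
  by case: (unliftP ord0 i) => [j ->|->];
    rewrite ?ES ?E0 //= !mxE; congr (_ + a _ _); exact/val_inj.
have := @product_shift n (leb R n) b _ (IH b.1) mA'.
rewrite /= /leb_succ /pushforward => <-; congr (product_measure1 _ _ _).
by apply/funext => z; rewrite /preimage/= key.
Qed.

Lemma volume_shift n (a : ambient R n) (A : set (ambient R n)) :
  measurable A -> volume ((fun z => z + a) @^-1` A) = volume A.
Proof.
move=> mA; apply: (@product_shift n (leb R n) a A) => // B.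
exact: leb_shift.
Qed.

Lemma measurable_shift n (a : ambient R n) :
  measurable_fun setT (fun z : ambient R n => z + a).
Proof. exact: measurable_prod_shift. Qed.

End translation.

(** * Cubes; measurability of open sets and of continuous functions *)

Section cubes.
Variables (R : realType) (n : nat).
Local Notation V := (ambient R n).
Local Notation mu := (@volume R n).
Implicit Types (z w : V) (r : R) (A : set V).

Lemma ambient_ballP z r w : 0 < r ->
  ball z r w <-> (forall i, `|z.1 ord0 i - w.1 ord0 i| < r) /\
                  `|(z.2 : R) - w.2| < r.
Proof.
move=> r0; split=> [[[_ B1] B2]|[B1 B2]]; split=> //.
- by move=> i; exact: B1.
- by split => // i j; rewrite (ord1 i); exact: B1.
Qed.

Lemma ambient_ballE z r : 0 < r -> ball z r =
  [set v | forall i, (ball (row_coord i z.1) r : set (measurableTypeR R)) (row_coord i v)] `*`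
  (ball (z.2 : R) r : set (measurableTypeR R)).
Proof.
by move=> r0; apply/seteqP; split => w /(ambient_ballP _ _ r0).
Qed.

Lemma measurable_row_box (B : 'I_n -> set (measurableTypeR R)) :
  (forall i, measurable (B i)) ->
  measurable [set v : 'rV[R]_n | forall i, B i (row_coord i v)].
Proof.
move=> mB; rewrite (_ : mkset _ = \bigcap_(i in [set: 'I_n])
      (@row_coord R n i @^-1` B i)).
  apply: fin_bigcap_measurable => // i _.
  by rewrite -[X in measurable X]setTI; exact: measurable_row_coord.
by apply/seteqP; split => [v vA i _|v vA i]; [exact: vA|exact: (vA i I)].
Qed.

Lemma measurable_real_ball (x r : R) :
  measurable (ball x r : set (measurableTypeR R)).
Proof. by rewrite ball_itv; exact: measurable_itv. Qed.

(** This makes a ball of radius [0] the empty placeholder in the countable families of cubes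
    below. *)
Lemma ball_ambient0 z r : r <= 0 -> ball z r = set0 :> set V.
Proof.
by move=> r0; apply/seteqP; split => // w [[r0' _] _]; move: (lt_le_trans r0' r0); rewrite ltxx.
Qed.

Lemma measurable_ambient_ball z r : measurable (ball z r : set V).
Proof.
have [r0|r0] := ltP 0 r; last by rewrite ball_ambient0.
rewrite ambient_ballE//; apply: measurableX; last exact: measurable_real_ball.
by apply: (measurable_row_box (B := fun i => ball (row_coord i z.1) r)) => i; exact: measurable_real_ball.
Qed.

(** The balls of the sup norm are cubes, hence products of intervals. Euclidean balls are later
    compared with cubes instead of being measured. *)
Lemma volume_ball z r : 0 < r -> mu (ball z r) = ((r *+ 2) ^+ n.+1)%:E.
Proof.
move=> r0; rewrite ambient_ballE//.
have mB : measurable [set v : 'rV[R]_n | forall i, (ball (row_coord i z.1) r :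
    set (measurableTypeR R)) (row_coord i v)].
  by apply: (measurable_row_box (B := fun i => ball (row_coord i z.1) r)) => i; exact: measurable_real_ball.
have mC := measurable_real_ball z.2 r.
rewrite [LHS](product_measure1E _ _ mB mC).
have E1 : leb R n [set v : 'rV[R]_n | forall i, (ball (row_coord i z.1) r :
    set (measurableTypeR R)) (row_coord i v)] = ((r *+ 2) ^+ n)%:E.
  rewrite (leb_box (fun i => measurable_real_ball (row_coord i z.1) r)).
  rewrite (eq_bigr (fun=> (r *+ 2)%:E)); last first.
    by move=> i _; rewrite lebesgue_measure_ball// ltW.
  by rewrite prodEFin prodr_const card_ord.
transitivity (((r *+ 2) ^+ n)%:E * (r *+ 2)%:E)%E; last by rewrite -EFinM -exprSr.
congr (_ * _)%E; first exact: E1.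
by apply: lebesgue_measure_ball; exact: ltW.
Qed.

Definition rpt (q : 'rV[rat]_n * rat) : V := (map_mx ratr q.1, ratr q.2).

Lemma rational_point_near z (e : R) : 0 < e ->
  exists q : 'rV[rat]_n * rat, ball z e (rpt q).
Proof.
move=> e0.
have rat_near (x : R) : exists q : rat, `|x - ratr q| < e.
  have [|q] := @rat_in_itvoo R (x - e) (x + e).
    by rewrite ltrBlDr -addrA ltrDl addr_gt0.
  by rewrite in_itv/= => /andP[q1 q2]; exists q; rewrite ltr_distlC q1 q2.
pose f x := projT1 (cid (rat_near x)).
exists (\row_i f (z.1 ord0 i), f z.2); apply/ambient_ballP => //=; split.
  by move=> i; rewrite !mxE; exact: (projT2 (cid (rat_near _))).
exact: (projT2 (cid (rat_near _))).
Qed.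

(** The sigma-algebra is the one generated by the coordinates, so the measurability of open sets
    needs a countable base: cubes with rational centres and radii [k.+1%:R^-1], those not inside [A]
    being replaced by the empty placeholder. *)
Lemma open_ambient_bigcup A : open A -> exists F : nat -> V * R,
  (forall k, ball (F k).1 (F k).2 `<=` A) /\
  A = \bigcup_k ball (F k).1 (F k).2.
Proof.
move=> oA.
pose I := ('rV[rat]_n * rat * nat)%type.
pose G (i : I) : V * R := let r := i.2.+1%:R^-1 in
  if `[< ball (rpt i.1) r `<=` A >] then (rpt i.1, r) else (0, 0).
have GA i : ball (G i).1 (G i).2 `<=` A.
  by rewrite /G; case: asboolP => //= _; rewrite ball_ambient0.
exists (fun k => oapp G (0, 0) (unpickle k)); split.
  by move=> k; case: unpickle => //=; rewrite ball_ambient0.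
apply/seteqP; split => [z Az|z [k _]]; last first.
  by case: unpickle => [i /GA//|] /=; rewrite ball_ambient0.
have /nbhs_ballP[e/= e0 eA] : nbhs z A by exact: open_nbhs_nbhs.
have [k] := @ltr_add_invr R 0 (e / 2) (divr_gt0 e0 (ltr0n _ 2)).
rewrite add0r => ke.
have [q zq] := @rational_point_near z k.+1%:R^-1 (ltac:(by [])).
exists (pickle ((q, k) : I)) => //; rewrite pickleK/= /G/=; case: asboolP => /=.
  by move=> _; exact/ball_sym.
move=> /(_ _)/wrap[]//; apply: subset_trans eA => w qw.
have -> : e = e / 2 + e / 2 by rewrite -splitr.
by apply: (@ball_triangle _ _ (rpt q)); apply: le_ball (ltW ke) _ _.
Qed.

Lemma open_measurable_ambient A : open A -> measurable A.
Proof.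
move=> /open_ambient_bigcup[F [_ ->]]; apply: bigcup_measurable => k _.
exact: measurable_ambient_ball.
Qed.

Lemma closed_measurable_ambient A : closed A -> measurable A.
Proof.
move=> cA; rewrite -(setCK A); apply: measurableC.
by apply: open_measurable_ambient; exact: closed_openC.
Qed.

Lemma continuous_measurable_ambient (f : V -> R) : continuous f ->
  measurable_fun setT f.
Proof.
move=> /continuousP cf; apply: (measurability _ (@measurable_realfun.RGenOpens.measurableE R)).
move=> _ [_ [a [b ->] <-]]; rewrite setTI.
by apply: open_measurable_ambient; apply: cf; exact: interval_open.
Qed.

End cubes.

Section extra.

Lemma cvg_exists_lt (R : realFieldType) (u : (\bar R)^nat) (l c : \bar R) :
  u k @[k --> \oo] --> l -> (l < c)%E -> exists k, (u k < c)%E.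
Proof.
move=> ul lc; apply: contrapT => /forallNP H.
have : (c <= l)%E.
  by apply: cvge_to_ge ul _; apply: nearW => k; rewrite leNgt; exact/negP.
by rewrite leNgt lc.
Qed.

End extra.

(** * Regularity of finite measures *)

Section outer_regularity.
Variables (R : realType) (n : nat).
Local Notation V := (ambient R n).
Variable nu : {measure set V -> \bar R}.
Hypothesis nuoo : (nu setT < +oo)%E.

Let nu_lty (A : set V) : measurable A -> (nu A < +oo)%E.
Proof.
by move=> mA; apply: le_lt_trans nuoo; apply: le_measure => //; rewrite inE.
Qed.

(** Approximation from both sides makes the class stable under complements, on the way to a
    sigma-algebra. *)
Definition regular_set (A : set V) := measurable A /\
  forall e : R, 0 < e -> exists U C : set V,
    [/\ open U, closed C, C `<=` A, A `<=` U & (nu (U `\` C) < e%:E)%E].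

Let regularC A : regular_set A -> regular_set (~` A).
Proof.
move=> [mA rA]; split; first exact: measurableC.
move=> e /rA[U [C [oU cC CA AU UC]]]; exists (~` C), (~` U); split.
- exact: closed_openC.
- exact: open_closedC.
- exact: subsetC.
- exact: subsetC.
- by rewrite (_ : _ `\` _ = U `\` C)// !setDE setCK setIC.
Qed.

Let regular_bigcup (A : nat -> set V) : (forall k, regular_set (A k)) ->
  regular_set (\bigcup_k A k).
Proof.
move=> rA; split; first by apply: bigcup_measurable => k _; exact: (rA k).1.
move=> e e0.
(* Half of [e] is spent on approximating the sets [A k]. The slack in [e / 2 < e] pays for keeping
   only finitely many of the closed sets, since an infinite union of closed sets need not be
   closed. *)
have e40 k : 0 < e / 2 / (2 ^ k.+1)%:R by rewrite !divr_gt0// ltr0n expn_gt0.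
have /choice[UC UCP] : forall k, exists UC : set V * set V,
    [/\ open UC.1, closed UC.2, UC.2 `<=` A k, A k `<=` UC.1 &
      (nu (UC.1 `\` UC.2) < (e / 2 / (2 ^ k.+1)%:R)%:E)%E].
  by move=> k; have [U [C UCk]] := (rA k).2 _ (e40 k); exists (U, C).
pose U := \bigcup_k (UC k).1.
pose C N := \bigcup_(k < N) (UC k).2.
have oU : open U by apply: bigcup_open => k _; have [] := UCP k.
have cC N : closed (C N).
  by apply: closed_bigcup => // k _; have [] := UCP k.
have mU : measurable U by exact: open_measurable_ambient.
have mC N : measurable (C N) by exact: closed_measurable_ambient.
have mUC k : measurable ((UC k).1 `\` (UC k).2).
  have [? ? _ _ _] := UCP k.
  by apply: measurableD; [exact: open_measurable_ambient|
                          exact: closed_measurable_ambient].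
have cvC : (nu \o (fun N => U `\` C N)) N @[N --> \oo] -->
    nu (\bigcap_N (U `\` C N)).
  apply: nonincreasing_cvg_mu.
  - by apply: nu_lty; exact: measurableD.
  - by move=> N; exact: measurableD.
  - by apply: bigcapT_measurable => N; exact: measurableD.
  - move=> N M NM; apply/subsetPset; apply: setDS => z [k /= kN Ckz].
    by exists k => //=; exact: leq_trans kN NM.
have lim_le : (nu (\bigcap_N (U `\` C N)) <= (e / 2)%:E)%E.
  apply: (@le_trans _ _ (\sum_(0 <= k <oo) nu ((UC k).1 `\` (UC k).2))%E).
    apply: measure_sigma_subadditive => //.
      by apply: bigcapT_measurable => N; exact: measurableD.
    move=> z zUC; have [[k _ Ukz] _] := zUC 0%N I.
    exists k => //; split => // Ckz; have [_ +] := zUC k.+1 I.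
    by apply; exists k => /=.
  have e20 : 0 <= e / 2 by rewrite divr_ge0// ltW.
  have := @epsilon_trick R (fun=> 0%E) _ xpredT (fun=> lexx 0%E) e20.
  rewrite [X in (_ <= X + _)%E -> _]eseries0// add0e; apply: le_trans.
  apply: lee_nneseries => // k _.
  by have [_ _ _ _ /ltW] := UCP k; rewrite add0e.
have : (nu (\bigcap_N (U `\` C N)) < e%:E)%E.
  by apply: le_lt_trans lim_le _; rewrite lte_fin ltr_pdivrMr// ltr_pMr// ltr1n.
move=> lim_lt.
have [N HN] := cvg_exists_lt cvC lim_lt.
exists U, (C N); split => //.
- by move=> z [k _]; have [_ _ + _ _] := UCP k => /[apply]; exists k.
- by move=> z [k _]; have [_ _ _ + _] := UCP k => /[apply]; exists k.
Qed.

Let regular_sigma_algebra (T : Type) (f : V -> T) :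
  sigma_algebra setT [set Y : set T | regular_set (f @^-1` Y)].
Proof.
split => /= [|A rA|A rA].
- rewrite preimage_set0; split => // e e0; exists set0, set0.
  by split => //; first [exact: open0|exact: closed0|rewrite setD0 measure0 lte_fin].
- by rewrite setTD preimage_setC; exact: regularC.
- by rewrite preimage_bigcup; exact: regular_bigcup.
Qed.

(** Open rays generate the Borel sets of the line, and the preimage of one is open and an increasing
    union of closed sets. With [f] a coordinate, this reaches the generators of the sigma-algebra of
    [V]. *)
Let regular_preimage (f : V -> R) (Y : set (measurableTypeR R)) :
  continuous f -> measurable Y -> regular_set (f @^-1` Y).
Proof.
move=> cf; rewrite (@measurable_realfun.RGenOInfty.measurableE R) => mY.
suff : [set Y | regular_set (f @^-1` Y)] Y by [].
apply: (smallest_sub (regular_sigma_algebra f) _ mY) => _ [a ->] /=.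
have oU : open (f @^-1` `]a, +oo[).
  by apply: open_comp => [? _|]; [exact: cf|exact: interval_open].
have mU := open_measurable_ambient oU.
split => // e e0.
pose C k := f @^-1` `[(a + k.+1%:R^-1), +oo[.
have cC k : closed (C k).
  apply: closed_comp => [? _|]; first exact: cf.
  exact: interval_closed.
have mC k := closed_measurable_ambient (cC k).
have CU k : C k `<=` f @^-1` `]a, +oo[.
  move=> z; rewrite /C /= !in_itv/= !andbT; apply: lt_le_trans.
  by rewrite ltrDl invr_gt0.
have cvC : (nu \o (fun k => f @^-1` `]a, +oo[ `\` C k)) k @[k --> \oo] -->
    nu (\bigcap_k (f @^-1` `]a, +oo[ `\` C k)).
  apply: nonincreasing_cvg_mu.
  - by apply: nu_lty; exact: measurableD.
  - by move=> N; exact: measurableD.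
  - by apply: bigcapT_measurable => N; exact: measurableD.
  - move=> N M NM; apply/subsetPset; apply: setDS => z.
    rewrite /C/= !in_itv/= !andbT; apply: le_trans.
    by rewrite lerD2l lef_pV2 ?posrE// ler_nat.
have U0 : \bigcap_k (f @^-1` `]a, +oo[ `\` C k) = set0.
  apply/seteqP; split => // z zUC.
  have := (zUC 0%N I).1; rewrite /= in_itv/= andbT => az.
  have [k ak] := ltr_add_invr az.
  by apply: (zUC k I).2; rewrite /C/= in_itv/= andbT ltW.
rewrite U0 measure0 in cvC.
have [|k Ck] := cvg_exists_lt cvC (_ : 0%E < e%:E)%E; first by rewrite lte_fin.
by exists (f @^-1` `]a, +oo[), (C k); split.
Qed.

Lemma measurable_regular (A : set V) : measurable A -> regular_set A.
Proof.
move=> mA; suff : [set Y | regular_set (id @^-1` Y)] A by [].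
apply: (smallest_sub (regular_sigma_algebra id) _ mA) => B [] [Y mY <-];
  rewrite /= setTI; last first.
  by apply: regular_preimage mY => z; exact: cvg_snd.
suff : [set Y | regular_set (fst @^-1` Y)] Y by [].
apply: (smallest_sub (@regular_sigma_algebra 'rV[R]_n fst) _ mY) => {}B.
rewrite -bigcup_seq/= => -[i _ [C mC <-]]; rewrite setTI.
apply: (regular_preimage (f := fun z : V => row_coord i z.1)) mC => z.
apply: (@cvg_comp _ _ _ fst (fun v : 'rV[R]_n => v ord0 i)).
  exact: cvg_fst.
exact: coord_continuous.
Qed.

End outer_regularity.

(** * Vitali covering and Lebesgue's density theorem *)

Section density.
Variables (R : realType) (n : nat).
Local Notation V := (ambient R n).
Local Notation mu := (@volume R n).
Implicit Types (z w : V) (r : R) (A : set V).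

(** Regularity is about finite measures, so the volume is first restricted to the cube that contains
    [A]. *)
Lemma outer_regular_bounded A (M e : R) : measurable A -> A `<=` ball 0 M ->
  0 < e -> exists U, [/\ open U, A `<=` U & (mu (U `\` A) < e%:E)%E].
Proof.
move=> mA AM e0; have mB := measurable_ambient_ball (0 : V) M.
pose nu := mrestr mu mB.
have nuoo : (nu setT < +oo)%E.
  rewrite /nu /mrestr setTI; have [M0|M0] := ltP 0 M; last first.
    by rewrite ball_ambient0// measure0.
  by rewrite volume_ball// ltry.
have [_ /(_ _ e0)[U [C [oU cC CA AU UC]]]] := measurable_regular nuoo mA.
exists (U `&` ball 0 M); split.
- by apply: openI => //; exact: ball_open.
- by move=> z Az; split; [exact: AU|exact: AM].
- apply: le_lt_trans UC; rewrite /nu/mrestr; apply: le_measure; rewrite ?inE.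
  + apply: measurableD => //; apply: measurableI => //.
    exact: open_measurable_ambient.
  + apply: measurableI => //; apply: measurableD.
      exact: open_measurable_ambient.
    exact: closed_measurable_ambient.
  + by move=> z [[Uz Bz] nAz]; split => //; split => // /CA.
Qed.

Lemma max_radius (s : seq (V * R)) (b0 : V * R) : exists2 b,
  b \in b0 :: s & forall b', b' \in b0 :: s -> b'.2 <= b.2.
Proof.
elim: s b0 => [b0|b1 s IH b0].
  by exists b0; rewrite ?mem_head// => b'; rewrite inE => /eqP ->.
have [b bs bmax] := IH b1; have [b0b|bb0] := leP b0.2 b.2.
  exists b; first by rewrite inE bs orbT.
  by move=> b'; rewrite inE => /predU1P[->//|/bmax].
exists b0; rewrite ?mem_head// => b'; rewrite inE => /predU1P[->//|/bmax].
by move=> /le_trans; apply; exact: ltW.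
Qed.

Let Bs (s : seq (V * R)) := \bigcup_(b in [set` s]) (ball b.1 b.2 : set V).

Let mBs s : measurable (Bs s).
Proof.
by apply: fin_bigcup_measurable => // b _; exact: measurable_ambient_ball.
Qed.

(* Greedy selection of a ball of maximal radius: the balls of s meeting it lie
   in the concentric ball of triple radius. *)
Lemma finite_vitali (s : seq (V * R)) (C : set V) (c : R) : 0 <= c ->
  measurable C ->
  (forall b, b \in s ->
    mu (ball b.1 b.2) <= c%:E * mu (C `&` ball b.1 b.2))%E ->
  (mu (Bs s) <= (3 ^+ n.+1 * c)%:E * mu (C `&` Bs s))%E.
Proof.
move=> c0 mC; have [m] := ubnP (size s); elim: m s => // m IH [|b0 s] sm Hs.
  by rewrite (_ : Bs [::] = set0) ?measure0 ?setI0 ?measure0 ?mule0//;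
    apply/seteqP; split => // z [].
have [b bs bmax] := max_radius s b0.
have K0 : 0 <= 3 ^+ n.+1 * c by rewrite mulr_ge0// exprn_ge0.
have [b20|b20] := leP b.2 0.
  rewrite (_ : Bs _ = set0) ?measure0 ?setI0 ?measure0 ?mule0//.
  apply/seteqP; split => // z [b' /= /bmax b'b].
  by rewrite ball_ambient0// (le_trans b'b).
pose P b' := `[< ball b.1 b.2 `&` ball b'.1 b'.2 = set0 >].
pose s' := [seq b' <- b0 :: s | P b'].
have bn : ~~ P b.
  apply/asboolP => /seteqP[+ _]; move=> /(_ b.1); apply; split;
  exact: ballxx.
have s'm : (size s' < m)%N.
  rewrite ltnS in sm; apply: leq_trans sm.
  rewrite size_filter -(count_predC P (b0 :: s)) -addn1 leq_add2l.
  by rewrite -has_count; apply/hasP; exists b.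
have Hs' b' : b' \in s' ->
    (mu (ball b'.1 b'.2) <= c%:E * mu (C `&` ball b'.1 b'.2))%E.
  by rewrite mem_filter => /andP[_ /Hs].
have {}IH := IH _ s'm Hs'.
have sub : Bs (b0 :: s) `<=` ball b.1 (3 * b.2) `|` Bs s'.
  move=> z [b' /= b's b'z]; have [Pb'|Pb'] := boolP (P b').
    by right; exists b' => //=; rewrite mem_filter Pb'.
  left; move/asboolPn : Pb' => /eqP/set0P[w [bw b'w]].
  have -> : 3 * b.2 = b.2 + (b.2 + b.2) by ring.
  apply: ball_triangle bw _; apply: (@le_ball _ _ _ (b'.2 + b'.2)).
    by rewrite lerD ?bmax.
  by apply: ball_triangle b'z; exact/ball_sym.
have m3 := measurable_ambient_ball b.1 (3 * b.2).
have mb := measurable_ambient_ball b.1 b.2.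
apply: (@le_trans _ _ (mu (ball b.1 (3 * b.2)) + mu (Bs s'))%E).
  apply: le_trans (measureU2 _ m3 (mBs s')).
  by apply: le_measure; rewrite ?inE//; exact: measurableU.
have -> : mu (ball b.1 (3 * b.2)) = ((3 ^+ n.+1)%:E * mu (ball b.1 b.2))%E.
  by rewrite !volume_ball ?mulr_gt0// -EFinM -mulrnAr exprMn.
apply: (@le_trans _ _ ((3 ^+ n.+1 * c)%:E * mu (C `&` ball b.1 b.2) +
    (3 ^+ n.+1 * c)%:E * mu (C `&` Bs s'))%E).
  apply: leeD => //; rewrite EFinM -muleA; apply: lee_pmul => //; last exact: Hs.
rewrite -ge0_muleDr; [|exact: measure_ge0|exact: measure_ge0].
apply: lee_wpmul2l; first by rewrite lee_fin.
rewrite -measureU//; [|exact: measurableI|exact: measurableI|].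
  apply: le_measure; rewrite ?inE//.
  - by apply: measurableU; exact: measurableI.
  - exact: measurableI.
  - move=> z [[Cz bz]|[Cz [b' /= b's b'z]]]; split => //; first by exists b.
    by exists b' => //=; move: b's; rewrite mem_filter => /andP[].
apply/seteqP; split => // z [[_ bz] [_ [b' /=]]].
by rewrite mem_filter => /andP[/asboolP/seteqP[+ _] _] b'z => /(_ z); apply.
Qed.

(** The constant of [finite_vitali] does not depend on the number of balls, so continuity from below
    passes to countable families. *)
Lemma countable_vitali (F : nat -> V * R) (C : set V) (c : R) : 0 <= c ->
  measurable C ->
  (forall k, mu (ball (F k).1 (F k).2) <= c%:E * mu (C `&` ball (F k).1 (F k).2))%E ->
  (mu (\bigcup_k ball (F k).1 (F k).2) <= (3 ^+ n.+1 * c)%:E * mu C)%E.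
Proof.
move=> c0 mC HF.
pose G k := Bs [seq F i | i <- iota 0 k].
have GE : \bigcup_k ball (F k).1 (F k).2 = \bigcup_k G k.
  apply/seteqP; split => [z [k _ Fz]|z [k _ [b /= /mapP[i _ ->]] Fz]].
    exists k.+1 => //; exists (F k) => //; apply/mapP; exists k => //.
    by rewrite mem_iota/= add0n.
  by exists i.
rewrite GE; have mG k : measurable (G k) by exact: mBs.
have cvG : (mu \o G) k @[k --> \oo] --> mu (\bigcup_k G k).
  apply: nondecreasing_cvg_mu => //.
    exact: bigcupT_measurable.
  move=> i j ij; apply/subsetPset => z [b /= /mapP[k]].
  rewrite mem_iota/= add0n => ki -> Fz; exists (F k) => //; apply/mapP; exists k => //.
  by rewrite mem_iota/= add0n (leq_trans ki).
apply: cvge_to_le cvG _; apply: nearW => k /=.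
apply: le_trans (@finite_vitali _ C c c0 mC _) _.
  by move=> b /mapP[i _ ->].
apply: lee_pmul => //; first by rewrite lee_fin mulr_ge0// exprn_ge0.
by apply: le_measure; rewrite ?inE//; exact: measurableI.
Qed.

End density.

Section density.
Variables (R : realType) (n : nat).
Local Notation V := (ambient R n).
Local Notation mu := (@volume R n).
Implicit Types (z w : V) (r : R) (A : set V).

Definition density_point A z := forall d : R, 0 < d ->
  exists2 r0 : R, 0 < r0 & forall r, 0 < r < r0 ->
    (mu (ball z r `\` A) <= d%:E * mu (ball z r))%E.

Let bad (d : R) A := [set z | A z /\ forall r0 : R, 0 < r0 ->
  exists2 r, 0 < r < r0 & (d%:E * mu (ball z r) < mu (ball z r `\` A))%E].

(** A bad point has arbitrarily small cubes of which the complement of [A] fills the proportion [d].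
    Taken inside an open set [U] containing [A], they carry a fixed share of the small set [U] minus
    [A], so the covering bound makes their union small. The bad set is only covered, its
    measurability being unclear. *)
Let bad_cover A (M d e : R) : measurable A -> A `<=` ball 0 M ->
  0 < d -> 0 < e ->
  exists W, [/\ measurable W, bad d A `<=` W & (mu W <= e%:E)%E].
Proof.
move=> mA AM d0 e0.
(* The factor [2 ^+ n.+1] pays for enlarging a cube of radius [r] to one with rational centre and
   radius, the latter below [2 * r]. *)
pose c := 2 ^+ n.+1 / d.
have c0 : 0 < c by rewrite divr_gt0// exprn_gt0.
have e'0 : 0 < e / (3 ^+ n.+1 * c) by rewrite divr_gt0// mulr_gt0// exprn_gt0.
have [U [oU AU UA]] := outer_regular_bounded mA AM e'0.
have mC : measurable (U `\` A).
  by apply: measurableD => //; exact: open_measurable_ambient.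
pose ok (b : V * R) := 
  `[< (mu (ball b.1 b.2) <= c%:E * mu ((U `\` A) `&` ball b.1 b.2))%E >].
pose G (i : 'rV[rat]_n * rat * rat) : V * R :=
  if ok (rpt R i.1, ratr i.2) then (rpt R i.1, ratr i.2) else (0, 0).
pose F k : V * R := oapp G (0, 0) (unpickle k).
have okF k : (mu (ball (F k).1 (F k).2) <=
    c%:E * mu ((U `\` A) `&` ball (F k).1 (F k).2))%E.
  rewrite /F; case: unpickle => [i|] /=; last first.
    by rewrite ball_ambient0// measure0 mule_ge0// lee_fin ltW.
  rewrite /G; case: ifPn => [/asboolP//|_ /=].
  by rewrite ball_ambient0// measure0 mule_ge0// lee_fin ltW.
exists (\bigcup_k ball (F k).1 (F k).2); split.
- by apply: bigcupT_measurable => k; exact: measurable_ambient_ball.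
- move=> z [Az badz].
  have /nbhs_ballP[s/= s0 sU] : nbhs z U by apply: open_nbhs_nbhs; split=> //; exact: AU.
  have [r /andP[r0 rs] Hr] := badz (s / 2) (divr_gt0 s0 (ltr0n _ 2)).
  (* With these margins the rational cube contains [ball z r] and lies in the cube of radius
     [7 * r / 4] about [z], hence in [U] because [r < s / 2]. *)
  have [q zq] := @rational_point_near _ _ z (r / 4) (divr_gt0 r0 (ltr0n _ 4)).
  have [|p] := @rat_in_itvoo R (r + r / 4) (r + r / 2); first by lra.
  rewrite in_itv/= => /andP[p1 p2].
  have sub1 : ball z r `<=` ball (rpt R q) (ratr p).
    move=> w zw; apply: (@le_ball _ _ _ (r / 4 + r)); first by lra.
    by apply: ball_triangle zw; exact/ball_sym.
  have sub2 : ball (rpt R q) (ratr p) `<=` U.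
    apply: subset_trans sU => w qw.
    apply: (@le_ball _ _ _ (r / 4 + ratr p)); first by lra.
    exact: ball_triangle zq qw.
  have mp := measurable_ambient_ball (rpt R q) (ratr p).
  have okqp : ok (rpt R q, ratr p).
    apply/asboolP => /=.
    apply: (@le_trans _ _ (c%:E * mu (ball z r `\` A))%E).
      apply: (@le_trans _ _ (c%:E * (d%:E * mu (ball z r)))%E).
        rewrite muleA -EFinM /c divfK ?gt_eqF// !volume_ball//; last by lra.
        rewrite -EFinM lee_fin -exprMn lerXn2r// ?nnegrE; lra.
      by apply: lee_wpmul2l; [rewrite lee_fin ltW|exact: ltW].
    apply: lee_pmul => //; first by rewrite lee_fin ltW.
    apply: le_measure; rewrite ?inE.
    + by apply: measurableD => //; exact: measurable_ambient_ball.
    + exact: measurableI.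
    + by move=> w [zw nAw]; split; [split => //; apply/sub2/sub1|exact: sub1].
  exists (pickle (q, p)) => //; rewrite /F pickleK/= /G /= okqp /=.
  by apply: sub1; exact: ballxx.
- apply: le_trans (countable_vitali (ltW c0) mC okF) _.
  apply: (@le_trans _ _ ((3 ^+ n.+1 * c)%:E * (e / (3 ^+ n.+1 * c))%:E)%E).
    apply: lee_pmul => //; last exact: ltW.
    by rewrite lee_fin mulr_ge0// ?exprn_ge0// ltW.
  by rewrite -EFinM mulrC divfK// gt_eqF// mulr_gt0// exprn_gt0.
Qed.

Let bad_negligible A (M d : R) : measurable A -> A `<=` ball 0 M -> 0 < d ->
  mu.-negligible (bad d A).
Proof.
move=> mA AM d0.
have /choice[W WP] : forall k : nat, exists W,
    [/\ measurable W, bad d A `<=` W & (mu W <= k.+1%:R^-1%:E)%E].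
  by move=> k; apply: (bad_cover mA AM d0); rewrite invr_gt0.
have mW : measurable (\bigcap_k W k).
  by apply: bigcapT_measurable => k; have [] := WP k.
exists (\bigcap_k W k); split => //; last first.
  by move=> z bz k _; have [_ + _] := WP k; exact.
apply/eqP; rewrite eq_le measure_ge0 andbT; apply/lee_addgt0Pr => e e0.
rewrite add0e; have [k] := ltr_add_invr e0; rewrite add0r => ke.
apply: (@le_trans _ _ (mu (W k))).
  have [mWk _ _] := WP k.
  by apply: le_measure; rewrite ?inE// => z; exact.
have [_ _ /le_trans] := WP k; apply; rewrite lee_fin; exact: ltW.
Qed.

Theorem lebesgue_density A : measurable A ->
  mu.-negligible [set z | A z /\ ~ density_point A z].
Proof.
move=> mA.
(* Failure of density for some [d] is failure for some [j.+1%:R^-1], and intersecting [A] with a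
   cube around the origin only enlarges its complement. *)
apply: (@negligibleS _ _ _ mu (\bigcup_M \bigcup_j
  bad j.+1%:R^-1 (A `&` ball 0 M%:R))); last first.
  apply: negligible_bigcup => M; apply: negligible_bigcup => j.
  apply: (@bad_negligible _ M%:R).
  - by apply: measurableI => //; exact: measurable_ambient_ball.
  - exact: subIsetr.
  - by rewrite invr_gt0.
move=> z [Az /existsNP[d /not_implyP[d0 nd]]].
have [j] := ltr_add_invr d0; rewrite add0r => jd.
pose M := (Num.truncn `|z|).+1.
have zM : ball 0 M%:R z.
  by rewrite -ball_normE /= sub0r normrN truncnS_gt.
exists M => //; exists j => //; split => // r0 r00.
apply: contrapT => H; apply: nd; exists r0 => // r rr0.
have {H} : ~ ((j.+1%:R^-1)%:E * mu (ball z r) <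
    mu (ball z r `\` (A `&` ball (0 : V)%R M%:R)))%E by move=> ?; apply: H; exists r.
move=> /negP; rewrite -leNgt => H.
have mB x s := @measurable_ambient_ball R n x s.
apply: (@le_trans _ _ (mu (ball z r `\` (A `&` ball 0 M%:R)))).
  apply: le_measure; rewrite ?inE.
  - exact: measurableD.
  - by apply: measurableD => //; exact: measurableI.
  - by move=> w [zw nA]; split => // -[].
apply: le_trans H _; apply: lee_pmul => //.
by rewrite lee_fin ltW.
Qed.

End density.

(** * Directional derivatives and functions of class C^1 *)

Section directional_derivative.
Variables (R : realType) (V : normedModType R).
Implicit Types (f g : V -> R) (z v : V).

(** Reduces directional derivatives to derivatives of a real function along a line, to which the
    one-variable chain rule and mean value theorem apply. *)
Lemma is_derive_lineE f z v (h : R) df :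
  is_derive (h *: v + z) v f df <-> is_derive h 1 (fun t : R => f (t *: v + z)) df.
Proof.
have E : (fun k : R => k^-1 *: ((f \o shift (h *: v + z)) (k *: v) - f (h *: v + z))) =
    (fun k : R => k^-1 *: (((fun t : R => f (t *: v + z)) \o shift h) (k *: 1) -
      (fun t : R => f (t *: v + z)) h)).
  by apply/funext => k /=; rewrite [k *: 1]mulr1 scalerDl addrA.
by split => -[d e]; split; move: d e; rewrite /derivable /derive -?E// E.
Qed.

Lemma is_derive_line f z v df :
  is_derive z v f df <-> is_derive (0 : R) 1 (fun t : R => f (t *: v + z)) df.
Proof. by rewrite -is_derive_lineE scale0r add0r. Qed.

Lemma is_derive_comp1 f (g : R -> R) z v df dg :
  is_derive z v f df -> is_derive (f z) 1 g dg ->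
  is_derive z v (g \o f) (dg * df).
Proof.
move=> /is_derive_line Hf Hg; apply/is_derive_line.
apply: (@is_derive1_comp _ g (fun t : R => f (t *: v + z)) 0).
by rewrite scale0r add0r.
Qed.

Lemma derivable_line_continuous f z v : (forall w, derivable f w v) ->
  continuous (fun t : R => f (t *: v + z)).
Proof.
move=> df t; apply/differentiable_continuous/derivable1_diffP.
by have /is_derive_lineE[] : is_derive (t *: v + z) v f ('D_v f (t *: v + z)) by exact/derivableP.
Qed.

Lemma derive_MVT f z v (b : R) : 0 < b -> (forall w, derivable f w v) ->
  exists2 c : R, 0 < c < b & f (b *: v + z) - f z = 'D_v f (c *: v + z) * b.
Proof.
move=> b0 df.
have [t _||c cb E] := @MVT R (fun t : R => f (t *: v + z))
   (fun t => 'D_v f (t *: v + z)) 0 b b0.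
- exact/is_derive_lineE/derivableP.
- exact/continuous_subspaceT/derivable_line_continuous.
- by exists c => //; move: E; rewrite subr0 scale0r add0r.
Qed.

(** Smooth means class C^1 here, expressed by directional derivatives as in [C1]. *)
Definition smooth f := continuous f /\
  forall v, (forall z, derivable f z v) /\ continuous ('D_v f).

Lemma smoothP f (df : V -> V -> R) : continuous f ->
  (forall v z, is_derive z v f (df v z)) ->
  (forall v, continuous (df v)) -> smooth f.
Proof.
move=> cf Hf cdf; split => // v; split; first by move=> z; have [] := Hf v z.
rewrite (_ : 'D_v f = df v)//; apply/funext => z; by have [] := Hf v z.
Qed.

Lemma smooth_is_derive f z v : smooth f -> is_derive z v f ('D_v f z).
Proof. by move=> [_ /(_ v)[df _]]; exact/derivableP. Qed.

Lemma smooth_cst (a : R) : smooth (cst a).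
Proof.
apply: (@smoothP _ (fun _ _ => 0)) => //; first exact: cst_continuous.
by move=> v; exact: cst_continuous.
Qed.

Lemma smoothD f g : smooth f -> smooth g -> smooth (fun z => f z + g z).
Proof.
move=> sf sg; apply: (@smoothP _ (fun v z => 'D_v f z + 'D_v g z)).
- by move=> z; apply: cvgD; [exact: sf.1|exact: sg.1].
- move=> v z; apply: (@is_deriveD _ _ _ f g); exact: smooth_is_derive.
- by move=> v z; apply: cvgD; [exact: (sf.2 v).2|exact: (sg.2 v).2].
Qed.

Lemma smoothM f g : smooth f -> smooth g -> smooth (fun z => f z * g z).
Proof.
move=> sf sg; apply: (@smoothP _ (fun v z => f z * 'D_v g z + g z * 'D_v f z)).
- by move=> z; apply: cvgM; [exact: sf.1|exact: sg.1].
- move=> v z; apply: (@is_deriveM _ _ f g); exact: smooth_is_derive.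
- by move=> v z; apply: cvgD; apply: cvgM;
    [exact: sf.1|exact: (sg.2 v).2|exact: sg.1|exact: (sf.2 v).2].
Qed.

Lemma smoothZ (a : R) f : smooth f -> smooth (fun z => a * f z).
Proof. by move=> sf; apply: smoothM => //; exact: smooth_cst. Qed.

Lemma smoothN f : smooth f -> smooth (fun z => - f z).
Proof.
by move=> /(smoothZ (-1)); congr smooth; apply/funext => z; rewrite mulN1r.
Qed.

Lemma smoothB f g : smooth f -> smooth g -> smooth (fun z => f z - g z).
Proof. by move=> sf sg; apply: smoothD; [exact: sf|exact: smoothN]. Qed.

Lemma smooth_sum (I : Type) (s : seq I) (F : I -> V -> R) :
  (forall i, smooth (F i)) -> smooth (fun z => \sum_(i <- s) F i z).
Proof.
move=> sF; elim: s => [|i s IH].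
  by under eq_fun do rewrite big_nil; exact: smooth_cst.
by under eq_fun do rewrite big_cons; exact: smoothD.
Qed.

Lemma smooth_comp1 f (g dg : R -> R) : smooth f ->
  (forall x : R, is_derive x 1 g (dg x)) -> continuous dg ->
  smooth (g \o f).
Proof.
move=> sf Hg cdg.
have cg : continuous g.
  move=> x; apply/differentiable_continuous/derivable1_diffP.
  by have [] := Hg x.
apply: (@smoothP _ (fun v z => dg (f z) * 'D_v f z)).
- by move=> z; apply: continuous_comp; [exact: sf.1|exact: cg].
- by move=> v z; apply: is_derive_comp1 => //; exact: smooth_is_derive.
- move=> v z; apply: cvgM; last exact: (sf.2 v).2.
  by apply: continuous_comp; [exact: sf.1|exact: cdg].
Qed.

Lemma linear_is_derive (l : V -> R) z v :
  (forall a u w, l (a *: u + w) = a * l u + l w) -> is_derive z v l (l v).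
Proof.
move=> ll; apply/is_derive_line.
have -> : (fun t : R => l (t *: v + z)) = (fun t => t * l v + l z).
  by apply/funext => t; rewrite ll.
have H1 : is_derive (0 : R) 1 (fun t : R => t * l v) (l v).
  have := is_deriveM (is_derive_id (0:R) 1) (is_derive_cst (l v) (0:R) 1).
  congr is_derive.
  by rewrite /= [_ *: 0]mulr0 add0r [_ *: _]mulr1.
rewrite -[X in is_derive _ _ _ X]addr0.
exact: (is_deriveD H1 (is_derive_cst (l z) (0:R) 1)).
Qed.

Lemma smooth_linear (l : V -> R) :
  (forall a u w, l (a *: u + w) = a * l u + l w) -> continuous l -> smooth l.
Proof.
move=> ll cl; apply: (@smoothP _ (fun v z => l v)) => //.
- by move=> v z; exact: linear_is_derive.
- by move=> v; exact: cst_continuous.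
Qed.

Lemma is_derive_linear_comp (phi : V -> V) (l : V -> R) z v :
  (forall a u w, l (a *: u + w) = a * l u + l w) -> continuous l ->
  derivable phi z v -> is_derive z v (l \o phi) (l ('D_v phi z)).
Proof.
move=> ll cl dphi; set q := fun h => h^-1 *: ((phi \o shift z) (h *: v) - phi z).
have lN w : l (- w) = - l w.
  by have := ll (- 1) w 0; have := ll 1 0 0; rewrite scale1r addr0 mul1r
    => /esym/eqP; rewrite -subr_eq0 addrK => /eqP ->; rewrite scaleN1r !addr0 mulN1r.
have lB u w : l (u - w) = l u - l w by have := ll 1 u (- w); rewrite scale1r mul1r lN.
have l0 : l 0 = 0 by rewrite -(subrr (0 : V)) lB subrr.
have E : (fun h => h^-1 *: (((l \o phi) \o shift z) (h *: v) - (l \o phi) z)) = l \o q.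
  have lZ a u : l (a *: u) = a * l u by rewrite -[X in l X = _]addr0 ll l0 addr0.
  by apply/funext => h; rewrite /q /= lZ lB.
have cq : l \o q @ 0^' --> l ('D_v phi z).
  apply: (@cvg_comp _ _ _ q l); first exact: dphi.
  exact: cl.
split.
  by rewrite /derivable E; apply/cvg_ex; exists (l ('D_v phi z)).
by rewrite /derive E; apply: cvg_lim.
Qed.

End directional_derivative.

(** * Coordinates of R^(n+1) and vector fields of class C^1 *)

Section ambient_smooth.
Variables (R : realType) (n : nat).
Local Notation V := (ambient R n).
Implicit Types (z w v : V) (r : R).

Definition hcoord (i : 'I_n) z : R := z.1 ord0 i.
Definition vcoord z : R := z.2.
Definition edir (i : 'I_n) : V := (delta_mx ord0 i, 0).
Definition vdir : V := (0, 1).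

Lemma hcoord_linear i a (u w : V) :
  hcoord i (a *: u + w) = a * hcoord i u + hcoord i w.
Proof. by rewrite /hcoord !mxE. Qed.

Lemma vcoord_linear a (u w : V) :
  vcoord (a *: u + w) = a * vcoord u + vcoord w.
Proof. by []. Qed.

Lemma hcoord_continuous i : continuous (hcoord i).
Proof.
move=> z; apply: (@cvg_comp _ _ _ fst (fun v : 'rV[R]_n => v ord0 i)).
  exact: cvg_fst.
exact: coord_continuous.
Qed.

Lemma vcoord_continuous : continuous vcoord.
Proof. by move=> z; exact: cvg_snd. Qed.

Lemma smooth_hcoord i : smooth (hcoord i).
Proof. exact: smooth_linear (@hcoord_linear i) (@hcoord_continuous i). Qed.

Lemma smooth_vcoord : smooth vcoord.
Proof. exact: smooth_linear vcoord_linear vcoord_continuous. Qed.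

Lemma ambient_eq z w : (forall i, hcoord i z = hcoord i w) ->
  vcoord z = vcoord w -> z = w.
Proof.
case: z w => [z1 z2] [w1 w2]; rewrite /hcoord /vcoord /= => H ->.
by congr pair; apply/rowP.
Qed.

Lemma hcoord_le_norm i z : `|hcoord i z| <= `|z|.
Proof.
rewrite leNgt; apply/negP => H.
have /ambient_ballP : ball (0 : V) `|hcoord i z| z.
  by rewrite -ball_normE /ball_/= sub0r normrN.
move=> /(_ (le_lt_trans (normr_ge0 _) H))[/(_ i) + _].
by rewrite mxE sub0r normrN ltxx.
Qed.

Lemma vcoord_le_norm z : `|vcoord z| <= `|z|.
Proof.
rewrite leNgt; apply/negP => H.
have /ambient_ballP : ball (0 : V) `|vcoord z| z.
  by rewrite -ball_normE /ball_/= sub0r normrN.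
move=> /(_ (le_lt_trans (normr_ge0 _) H))[_ /=].
by rewrite sub0r normrN ltxx.
Qed.

Lemma norm_ambient_lt z r : 0 < r -> (forall i, `|hcoord i z| < r) ->
  `|vcoord z| < r -> `|z| < r.
Proof.
move=> r0 H1 H2; have : ball (0 : V) r z.
  apply/ambient_ballP => //=; rewrite sub0r normrN; split => // i.
  by rewrite mxE sub0r normrN; exact: H1.
by rewrite -ball_normE /ball_/= sub0r normrN.
Qed.

Lemma norm_ambient_le z r : 0 <= r -> (forall i, `|hcoord i z| <= r) ->
  `|vcoord z| <= r -> `|z| <= r.
Proof.
move=> r0 H1 H2; apply/ler_addgt0Pr => e e0; apply/ltW/norm_ambient_lt.
- by rewrite ltr_wpDl.
- by move=> i; rewrite (le_lt_trans (H1 i))// ltrDl.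
- by rewrite (le_lt_trans H2)// ltrDl.
Qed.

Lemma cvg_ambient (T : Type) (F : set_system T) (f : T -> V) (l : V) :
  Filter F -> (forall i, hcoord i \o f @ F --> hcoord i l) ->
  vcoord \o f @ F --> vcoord l -> f @ F --> l.
Proof.
move=> FF H1 H2; apply/cvgrPdist_lt => e e0; near=> x.
apply: norm_ambient_lt => //.
- move=> i; move: i; near: x; apply: filter_forall => i.
  have /cvgrPdist_lt/(_ e e0) := H1 i; apply: filterS => x.
  by rewrite /hcoord/= !mxE.
- by near: x; have /cvgrPdist_lt/(_ e e0) := H2.
Unshelve. all: by end_near. Qed.

Lemma C1_of_smooth (phi : V -> V) : (forall i, smooth (hcoord i \o phi)) ->
  smooth (vcoord \o phi) -> C1 phi.
Proof.
move=> sh sv v.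
pose D z : V := (\row_i 'D_v (hcoord i \o phi) z, 'D_v (vcoord \o phi) z).
have Hq z : (fun h => h^-1 *: ((phi \o shift z) (h *: v) - phi z)) @ 0^' --> D z.
  apply: cvg_ambient => [i|].
  - rewrite [hcoord i (D z)]mxE; have [+ _] := smooth_is_derive z v (sh i).
    rewrite /derivable /derive; set q := (fun h => _) => cq.
    rewrite (_ : _ \o _ = q)//; apply/funext => h.
    by rewrite /q /hcoord/= !mxE.
  - have [+ _] := smooth_is_derive z v sv.
    by rewrite /derivable /derive; set q := (fun h => _) => cq.
have DE : 'D_v phi = D by apply/funext => z; exact: cvg_lim (Hq z).
split; first by move=> z; apply/cvg_ex; exists (D z); exact: Hq.
rewrite DE => z; apply: cvg_ambient => [i|].
  rewrite (_ : _ \o _ = 'D_v (hcoord i \o phi)).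
    by rewrite [hcoord i (D z)]mxE; exact: ((sh i).2 v).2.
  by apply/funext => w; rewrite /= [LHS]mxE.
exact: (sv.2 v).2.
Qed.

End ambient_smooth.

Section ambient_C1.
Variables (R : realType) (n : nat).
Local Notation V := (ambient R n).
Local Notation mu := (@volume R n).
Implicit Types (z w v : V) (r : R) (f : V -> R).

Let trunc k (h : V) : V := (\row_i (if (i < k)%N then h.1 ord0 i else 0), 0).

Let truncS k (h : V) (kn : (k < n)%N) :
  trunc k.+1 h = (h.1 ord0 (Ordinal kn)) *: edir R (Ordinal kn) + trunc k h.
Proof.
apply: ambient_eq => [i|]; last by rewrite /vcoord /= scaler0 addr0.
rewrite /hcoord /= !mxE/= ltnS leq_eqVlt.
have [/eqP ik|ik] := boolP (i == k :> nat).
  have -> : i = Ordinal kn by exact/val_inj.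
  by rewrite /= eqxx ltnn mulr1 addr0.
rewrite /= (_ : (i == Ordinal kn) = false) ?mulr0 ?add0r//.
by apply: contraNF ik => /eqP ->.
Qed.

(* Move from z to z + h one coordinate at a time; each step is controlled by
   the mean value theorem. *)
Lemma continuous_of_directional f :
  (forall v, (forall z, derivable f z v) /\ continuous ('D_v f)) ->
  continuous f.
Proof.
move=> Hf z.
have bnd v : exists2 K : R, 0 < K & \forall w \near z, `|'D_v f w| <= K.
  exists (`|'D_v f z| + 1); first by rewrite ltr_pwDr.
  have /cvgrPdist_le/(_ 1 ltr01) := (Hf v).2 z; apply: filterS => w Hw.
  by rewrite -lerBlDl (le_trans (lerB_dist _ _))// distrC.
pose E (o : option 'I_n) : V := if o is Some i then edir R i else vdir R n.
have /choice[K HK] : forall o, exists K : R, 0 < K /\ \forall w \near z, `|'D_(E o) f w| <= K.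
  by move=> o; have [K K0 HK] := bnd (E o); exists K.
have : \forall w \near z, forall o : option 'I_n, `|'D_(E o) f w| <= K o.
  by apply: (filter_forall (nbhs_filter z)) => o; exact: (HK o).2.
move=> /nbhs_ballP[s/= s0 Hs].
have step o (t r : R) (w : V) : `|w - z| <= r -> `|t *: E o + w - z| <= r -> r < s ->
    `|t| <= r -> `|f (t *: E o + w) - f w| <= K o * r.
  move=> wz tz rs tr.
  have K0 := (HK o).1.
  wlog t0 : t w wz tz tr / 0 <= t.
    move=> H; have [t0|t0] := leP 0 t; first exact: (H t w wz tz tr t0).
    have wE : - t *: E o + (t *: E o + w) = w.
      by rewrite addrA -scalerDl addNr scale0r add0r.
    have := H (- t) (t *: E o + w) tz; rewrite wE normrN => /(_ wz tr).
    by rewrite distrC; apply; rewrite oppr_ge0 ltW.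
  move: t0; rewrite le_eqVlt => /predU1P[<-|t0].
    by rewrite scale0r add0r subrr normr0 mulr_ge0 ?(ltW K0)// (le_trans (normr_ge0 _) wz).
  have [c /andP[c0 ct] ->] := derive_MVT w t0 (Hf (E o)).1.
  rewrite normrM; apply: ler_pM => //; apply: (Hs (c *: E o + w) _ o).
  rewrite -ball_normE /ball_/= distrC.
  apply: le_lt_trans rs.
  (* The intermediate point is a convex combination of the two ends of the step, so it stays within
     [r] of [z]. *)
  have -> : c *: E o + w - z = (c / t) *: (t *: E o + w - z) + (1 - c / t) *: (w - z).
    rewrite -addrA -[in RHS]addrA scalerDr scalerA divfK ?gt_eqF// -addrA.
    by congr (_ + _); rewrite -scalerDl addrCA subrr addr0 scale1r.
  have ct0 : 0 <= c / t by apply: divr_ge0; apply: ltW.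
  have ct1 : 0 <= 1 - c / t by rewrite subr_ge0 ler_pdivrMr// mul1r ltW.
  apply: le_trans (ler_normD _ _) _; rewrite [X in X + _]normrZ [X in _ + X]normrZ (ger0_norm ct0) (ger0_norm ct1).
  apply: (@le_trans _ _ (c / t * r + (1 - c / t) * r)).
    by apply: lerD; [exact: (ler_wpM2l ct0)|exact: (ler_wpM2l ct1)].
  by rewrite -mulrDl addrCA subrr addr0 mul1r.
pose KK := \sum_(o : option 'I_n) K o.
have KK0 : 0 <= KK by apply: sumr_ge0 => i _; apply: ltW; exact: (HK i).1.
have KKo p : K p <= KK.
  rewrite /KK (bigD1 p)//= lerDl; by apply: sumr_ge0 => o' _; apply: ltW; exact: (HK o').1.
have tr_le k (h : V) : `|trunc k h| <= `|h|.
  apply: norm_ambient_le => // [i|]; last by rewrite /vcoord/= normr0.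
  rewrite [hcoord i _]mxE; case: ifPn => _; first exact: hcoord_le_norm.
  by rewrite normr0.
have tr k (h : V) : (k <= n)%N -> `|h| < s ->
    `|f (trunc k h + z) - f z| <= k%:R * (KK * `|h|).
  move=> kn hs; elim: k kn => [_|k IH kn].
    rewrite (_ : trunc 0 h = 0) ?add0r ?subrr ?normr0 ?mul0r//.
    by apply: ambient_eq => // i; rewrite [LHS]mxE [RHS]mxE.
  rewrite -(subrKA (f (trunc k h + z))) (le_trans (ler_normD _ _))//.
  rewrite -natr1 mulrDl mul1r addrC lerD ?IH 1?ltnW//.
  apply: (@le_trans _ _ (K (Some (Ordinal kn)) * `|h|)); last by rewrite ler_wpM2r.
  rewrite (truncS h kn) -addrA; apply: (step (Some (Ordinal kn)) _ `|h|) => //.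
  - by rewrite addrK; exact: tr_le.
  - by rewrite addrA -truncS addrK; exact: tr_le.
  - exact: (hcoord_le_norm (Ordinal kn) h).
have fin (h : V) : `|h| < s -> `|f (h + z) - f z| <= n.+1%:R * (KK * `|h|).
  move=> hs.
  have hE : h = h.2 *: E None + trunc n h.
    apply: ambient_eq => [i|]; rewrite /hcoord/vcoord/= ?mxE ?scaler0 ?ltn_ord ?mulr0 ?add0r ?addr0//.
    by rewrite [_ *: _]mulr1.
  rewrite -(subrKA (f (trunc n h + z))) (le_trans (ler_normD _ _))//.
  rewrite -natr1 mulrDl mul1r addrC lerD ?tr//.
  apply: (@le_trans _ _ (K None * `|h|)); last by rewrite ler_wpM2r.
  rewrite {1}hE -addrA; apply: (step None _ `|h|) => //.
  - by rewrite addrK; exact: tr_le.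
  - by rewrite addrA -hE addrK.
  - exact: vcoord_le_norm.
apply/cvgrPdist_lt => e e0.
pose L := n.+1%:R * KK + 1.
have L0 : 0 < L by rewrite ltr_pwDr// mulr_ge0.
have m0 : 0 < Num.min s (e / L) by rewrite lt_min s0 divr_gt0.
apply: filterS (nbhsx_ballx z _ m0) => w.
rewrite -ball_normE /ball_/= lt_min distrC => /andP[ws we].
have -> : w = (w - z) + z by rewrite subrK.
rewrite distrC; apply: (@le_lt_trans _ _ (L * `|w - z|)).
  by apply: le_trans (fin _ ws) _; rewrite mulrA ler_wpM2r// lerDl.
by rewrite mulrC -ltr_pdivlMr.
Qed.

Lemma C1_smooth_linear (phi : V -> V) (l : V -> R) :
  (forall a u w, l (a *: u + w) = a * l u + l w) -> continuous l ->
  C1 phi -> smooth (l \o phi).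
Proof.
move=> ll cl Cphi.
have H v : (forall z, derivable (l \o phi) z v) /\ continuous ('D_v (l \o phi)).
  have Hd z := is_derive_linear_comp ll cl ((Cphi v).1 z).
  split; first by move=> z; have [] := Hd z.
  rewrite (_ : 'D_v _ = l \o 'D_v phi).
    by move=> z; apply: continuous_comp; [exact: (Cphi v).2|exact: cl].
  by apply/funext => z; have [] := Hd z.
by split => //; exact: continuous_of_directional.
Qed.

(** [C1] speaks of the derivative of the whole field, while products and cutoffs act on its
    components. *)
Lemma C1P (phi : V -> V) : C1 phi <->
  (forall i, smooth (@hcoord R n i \o phi)) /\ smooth (@vcoord R n \o phi).
Proof.
split=> [Cphi|[]]; last exact: C1_of_smooth.
split=> [i|]; apply: C1_smooth_linear => //.
- exact: hcoord_linear.
- exact: hcoord_continuous.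
- exact: vcoord_continuous.
Qed.

End ambient_C1.

(** * Dominated convergence and vanishing integrals of derivatives *)

Section real_integral.
Context d (T : measurableType d) (R : realType) (mu : {measure set T -> \bar R}).
Implicit Types (f g : T -> R) (A : set T).

Lemma integrable_indic_lty A : measurable A -> (mu A < +oo)%E ->
  mu.-integrable setT (EFin \o (\1_A : T -> R)).
Proof.
move=> mA Aoo; apply/integrableP; split; first exact/measurable_EFinP.
rewrite (eq_integral (fun x => (\1_A x)%:E)); last first.
  by move=> t _; rewrite gee0_abs// lee_fin.
by rewrite integral_indic// setIT.
Qed.

Lemma integrable_bounded f A (C : R) : measurable_fun setT f -> measurable A ->
  (mu A < +oo)%E -> (forall z, `|f z| <= C) -> (forall z, ~ A z -> f z = 0) ->
  mu.-integrable setT (EFin \o f).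
Proof.
move=> mf mA Aoo fC fA.
apply: (@le_integrable _ _ _ mu setT measurableT _ (fun z => (C * \1_A z)%:E)).
- exact/measurable_EFinP.
- move=> z _ /=; rewrite lee_fin indicE; have [|] := boolP (z \in A).
    by rewrite mulr1 => _; rewrite (le_trans (fC z))// ler_norm.
  by rewrite notin_setE => /fA ->; rewrite normr0.
- rewrite (_ : (fun z => _) = (fun z => C%:E * (EFin \o \1_A) z)%E)//.
  by apply: integrableZl => //; exact: integrable_indic_lty.
Qed.

Lemma Rintegral_bigcvg (f_ : nat -> T -> R) f g :
  (forall k, measurable_fun setT (f_ k)) -> measurable_fun setT f ->
  {ae mu, forall z, f_ k z @[k --> \oo] --> f z} ->
  mu.-integrable setT (EFin \o g) -> (forall k z, `|f_ k z| <= g z) ->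
  (\int[mu]_z f_ k z) @[k --> \oo] --> \int[mu]_z f z.
Proof.
move=> mf_ mf cvf ig fg.
have [|||//||H1 H2 H3] := @dominated_convergence _ _ _ mu setT measurableT
   (fun k => EFin \o f_ k) (EFin \o f) (EFin \o g).
- by move=> k; exact/measurable_EFinP.
- exact/measurable_EFinP.
- by apply: filterS cvf => z cz _; apply: cvg_EFin => //; exact: nearW.
- by apply: aeW => z k _; rewrite lee_fin; exact: fg.
apply: fine_cvg.
rewrite fineK; first exact: H3.
by apply: integrable_fin_num => //.
Qed.

End real_integral.

Section ambient_integral.
Variables (R : realType) (n : nat).
Local Notation V := (ambient R n).
Local Notation mu := (@volume R n).
Implicit Types (z w v : V) (r : R) (f g : V -> R).

Lemma volume_ball_lty z r : (mu (ball z r) < +oo)%E.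
Proof.
have [r0|r0] := leP r 0; first by rewrite ball_ambient0// measure0.
by rewrite volume_ball// ltry.
Qed.

Lemma ge0_integral_shift (f : V -> \bar R) (a : V) : measurable_fun setT f ->
  (forall z, 0 <= f z)%E ->
  (\int[mu]_z f (z + a)%R = \int[mu]_z f z)%E.
Proof.
move=> mf f0.
have mS := @measurable_shift R n a.
pose nu := @measure_function_pushforward__canonical__measure_function_Measure
  _ _ V V R mu (fun z : V => z + a) mS.
rewrite -[RHS](@eq_measure_integral _ V R setT mu nu f); last first.
  by move=> A mA _; exact: volume_shift.
rewrite (@ge0_integral_pushforward _ _ V V R _ mS mu setT f).
- by rewrite preimage_setT.
- exact: measurableT.
- exact: mf.
- by move=> z _; exact: f0.
Qed.

Lemma integral_shift (f : V -> \bar R) (a : V) : measurable_fun setT f ->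
  (\int[mu]_z f (z + a)%R = \int[mu]_z f z)%E.
Proof.
move=> mf; rewrite [LHS]integralE [RHS]integralE; congr (_ - _)%E.
  rewrite -(@ge0_integral_shift (f^\+)%E a (measurable_funepos mf) (fun=> funepos_ge0 _ _)).
  by apply: eq_integral => z _; rewrite !funeposE.
rewrite -(@ge0_integral_shift (f^\-)%E a (measurable_funeneg mf) (fun=> funeneg_ge0 _ _)).
by apply: eq_integral => z _; rewrite !funenegE.
Qed.

Lemma Rintegral_shift f (a : V) : measurable_fun setT f ->
  \int[mu]_z f (z + a) = \int[mu]_z f z.
Proof.
move=> mf; congr fine; apply: (@integral_shift (EFin \o f) a).
exact/measurable_EFinP.
Qed.

Lemma measurable_comp_shift f (a : V) : measurable_fun setT f ->
  measurable_fun setT (fun z => f (z + a)).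
Proof. by move=> mf; apply: (measurableT_comp mf); exact: measurable_shift. Qed.

Lemma smooth_measurable f : smooth f -> measurable_fun setT f.
Proof. by move=> [cf _]; exact: continuous_measurable_ambient. Qed.

Lemma smooth_derive_measurable f v : smooth f -> measurable_fun setT ('D_v f).
Proof. by move=> [_ /(_ v)[_ cf]]; exact: continuous_measurable_ambient. Qed.

Lemma compact_ambient_ball r : compact [set z : V | `|z| <= r].
Proof.
have cS : compact ([set v : 'rV[R]_n | `|v| <= r] `*` (`[(- r), r]%classic : set R)).
  apply: compact_setX; last exact: segment_compact.
  apply: bounded_closed_compact.
    by exists r; split; [exact: num_real|move=> M rM v /= /le_trans; apply; exact: ltW].
  apply: (@closed_comp _ _ (fun v : 'rV[R]_n => `|v|) [set x : R | x <= r]).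
    by move=> v _; exact: norm_continuous.
  exact: closed_le.
apply: subclosed_compact cS _.
  apply: (@closed_comp _ _ (fun v : V => `|v|) [set x : R | x <= r]).
    by move=> v _; exact: norm_continuous.
  exact: closed_le.
move=> z zr; split => /=.
  by apply: le_trans zr; rewrite prod_normE le_max lexx.
rewrite in_itv/= -ler_norml; apply: le_trans zr.
exact: vcoord_le_norm.
Qed.

Lemma bounded_of_support f r : continuous f ->
  (forall z, r <= `|z| -> f z = 0) -> exists2 C, 0 <= C & forall z, `|f z| <= C.
Proof.
move=> cf fr.
have cI : compact (f @` [set z : V | `|z| <= r]).
  by apply: continuous_compact; [exact: continuous_subspaceT|exact: compact_ambient_ball].
have [M [_ HM]] := compact_bounded cI.
exists (`|M| + 1); first by rewrite addr_ge0.
move=> z; have [zr|zr] := leP `|z| r; last first.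
  by rewrite fr ?normr0 ?addr_ge0// ltW.
by apply: HM; [rewrite (le_lt_trans (ler_norm M))// ltrDl|exists z].
Qed.

Lemma derive_support f v r : (forall z, r <= `|z| -> f z = 0) ->
  forall z, r < `|z| -> 'D_v f z = 0.
Proof.
move=> fr z zr; rewrite -(derive_cst (0 : R) z v).
have [->|v0] := eqVneq v 0; first by rewrite !derive0.
apply: near_eq_derive => //.
have : \forall w \near z, r < `|w|.
  have : (fun w : V => `|w|) @ z --> `|z| by exact: norm_continuous.
  by move/cvgr_gt; apply.
by apply: filterS => w rw; rewrite fr// ltW.
Qed.

(** A difference quotient has zero integral because the volume is translation invariant, and the
    mean value theorem dominates the quotients by a bound for the derivative on a fixed cube.
    Applied to products, this is integration by parts. *)
Lemma integral_derive0 f v r : smooth f ->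
  (forall z, r <= `|z| -> f z = 0) -> \int[mu]_z 'D_v f z = 0.
Proof.
move=> sf fr.
pose h k : R := k.+1%:R^-1.
have h0 k : 0 < h k by rewrite invr_gt0.
pose q k z := (h k)^-1 * (f (z + h k *: v) - f z).
have mf := smooth_measurable sf.
have mq k : measurable_fun setT (q k).
  apply: measurable_funM => //; apply: measurable_funB => //.
  exact: measurable_comp_shift.
have [C1 C10 HC1] := bounded_of_support sf.1 fr.
have intf : mu.-integrable setT (EFin \o f).
  apply: (@integrable_bounded _ V R mu f (ball (0 : V) (`|r| + 1)) C1) => //.
  - exact: measurable_ambient_ball.
  - exact: volume_ball_lty.
  - move=> z; rewrite -ball_normE /ball_/= sub0r normrN => /negP; rewrite -leNgt => rz.
    by apply: fr; apply: le_trans rz; rewrite (le_trans (ler_norm r))// lerDl.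
have intfs a : mu.-integrable setT (EFin \o (fun z => f (z + a))).
  apply: (@integrable_bounded _ V R mu (fun z => f (z + a)) (ball (0 : V) (`|r| + `|a| + 1)) C1) => //.
  - exact: measurable_comp_shift.
  - exact: measurable_ambient_ball.
  - exact: volume_ball_lty.
  - move=> z; rewrite -ball_normE /ball_/= sub0r normrN => /negP; rewrite -leNgt => rz.
    apply: fr; have := lerB_normD z a; have := ler_norm r.
    by move: rz; set x := `|z|; set y := `|a|; set t := `|z + a|; lra.
have q0 k : \int[mu]_z q k z = 0.
  rewrite /q RintegralZl//; last first.
    by apply: (@integrableB _ _ _ mu setT measurableT (EFin \o (fun z => f (z + h k *: v))) (EFin \o f)).
  rewrite (@RintegralB _ _ _ mu setT (fun z => f (z + h k *: v)) f)//.
  by rewrite Rintegral_shift// subrr mulr0.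
have cq z : q k z @[k --> \oo] --> 'D_v f z.
  have [dfz _] := smooth_is_derive z v sf.
  have hc : h k @[k --> \oo] --> (0 : R)^'.
    have hn k : h k != 0 by rewrite gt_eqF.
    move=> P P0.
    have : \forall k \near \oo, h k != 0 -> P (h k) by exact: (@cvg_harmonic R _ P0).
    by move=> [N _ HN]; exists N => // k Nk; exact: (HN k Nk (hn k)).
  rewrite (_ : q^~ z = (fun t : R => t^-1 *: ((f \o shift z) (t *: v) - f z)) \o h).
    exact: (cvg_comp _ _ hc dfz).
  by apply/funext => k; rewrite /q /= [_ *: v + z]addrC.
have fr' z : r + 1 <= `|z| -> 'D_v f z = 0.
  by move=> rz; apply: derive_support fr _ _; lra.
have [C C0 HC] := bounded_of_support (sf.2 v).2 fr'.
(* Contains the supports of all the quotients, as [0 < h k <= 1]. *)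
pose B : set V := ball (0 : V) (`|r| + `|v| + 1).
have mB : measurable B by exact: measurable_ambient_ball.
have Hlim : (\int[mu]_z q k z) @[k --> \oo] --> \int[mu]_z 'D_v f z.
  apply: (@Rintegral_bigcvg _ _ _ mu q ('D_v f) (fun z => C * \1_B z)) => //.
  - exact: smooth_derive_measurable.
  - exact: aeW.
  - apply: (@integrable_bounded _ V R mu _ B C) => //.
    + by apply: measurable_funM => //; exact: measurable_indic.
    + exact: volume_ball_lty.
    + move=> z; rewrite normrM (ger0_norm C0) indicE.
      by case: (z \in B); rewrite ?normr1 ?normr0 ?mulr1 ?mulr0.
    + by move=> z zB; rewrite indicE memNset// mulr0.
  - move=> k z; rewrite indicE.
    have [zB|] := boolP (z \in B).
      have [c _ E] := derive_MVT z (h0 k) (sf.2 v).1.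
      rewrite /q [z + _]addrC E [_ * h k]mulrC mulKf ?gt_eqF//.
      by rewrite mulr1; exact: HC.
    rewrite notin_setE /B -ball_normE /ball_/= sub0r normrN => /negP.
    rewrite -leNgt => zr; have rz := ler_norm r.
    have hk1 : h k <= 1 by rewrite invf_le1// ler1n.
    have hv : `|h k *: v| <= `|v| by rewrite normrZ gtr0_norm// ler_piMl.
    have zv := lerB_normD z (h k *: v).
    have v0 := normr_ge0 v.
    move: zr rz hv zv v0; set a := `|z|; set b := `|z + _|; set c := `|v|; set e := `|h k *: v|; set r' := `|r|.
    move=> zr rz hv zv v0.
    have H1 : r <= a by lra.
    have H2 : r <= b by lra.
    by rewrite /q (fr _ H1) (fr _ H2) subrr mulr0 normr0 mulr0.
rewrite (_ : (fun k => _) = cst 0) in Hlim; last by apply/funext => k; exact: q0.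
by apply: (cvg_unique _ Hlim); [exact: norm_hausdorff|exact: cvg_cst].
Qed.

End ambient_integral.

(** * Truncated powers and the smoothing kernel *)

Section positive_part_power.
Variable R : realType.
Implicit Types x : R.

(** Truncated powers of order [m] are of class C^(m-1), and so give kernels and cutoffs by finite
    formulas. *)
Definition pospow (m : nat) x : R := Num.max x 0 ^+ m.

Lemma pospow_ge0 m x : 0 <= pospow m x.
Proof. by rewrite exprn_ge0// le_max lexx orbT. Qed.

Lemma pospow_le0 m x : x <= 0 -> pospow m.+1 x = 0.
Proof. by move=> x0; rewrite /pospow max_r// expr0n. Qed.

Lemma pospow_gt0E m x : 0 <= x -> pospow m x = x ^+ m.
Proof. by move=> x0; rewrite /pospow max_l. Qed.

Lemma continuous_pospow m : continuous (pospow m).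
Proof.
move=> x; apply: (@continuous_comp _ _ _ (fun x : R => Num.max x 0) (fun y => y ^+ m)).
  by apply: continuous_max; [exact: cvg_id|exact: cvg_cst].
exact: exprn_continuous.
Qed.

Lemma is_derive_pospow m x :
  is_derive x 1 (pospow m.+2) (m.+2%:R * pospow m.+1 x).
Proof.
have [x0|x0|->] := ltgtP x 0.
- rewrite pospow_le0 ?mulr0 ?ltW//.
  have H : \forall y \near x, cst (0 : R) y = pospow m.+2 y.
    by near=> y; rewrite pospow_le0// ltW//; near: y; exact: lt_nbhsl.
  exact: (near_eq_is_derive H (is_derive_cst (0 : R) x 1)).
- rewrite pospow_gt0E ?ltW//.
  have H : \forall y \near x, (fun y : R => y ^+ m.+2) y = pospow m.+2 y.
    by near=> y; rewrite pospow_gt0E// ltW//; near: y; exact: lt_nbhsr.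
  apply: (near_eq_is_derive H).
  have := is_deriveX m.+2 (is_derive_id x (1 : R)).
  rewrite [_ *: 1]mulr1; congr (is_derive _ _ _ _).
  by apply/funext => y; rewrite exprfctE.
- rewrite pospow_le0// mulr0.
  have cq : (fun h : R => h^-1 *: ((pospow m.+2 \o shift 0) (h *: (1 : R)) - pospow m.+2 0)) @ 0^' --> (0 : R).
    apply/cvgrPdist_le => e e0.
    near=> h; rewrite /= addr0 [h *: 1]mulr1 (pospow_le0 _ (lexx 0)) subr0 sub0r normrN.
    rewrite [_ *: _]/(_ * _) normrM (ger0_norm (pospow_ge0 _ _)) normfV.
    have h0 : 0 < `|h| by rewrite normr_gt0; near: h; exact: nbhs_dnbhs_neq.
    rewrite ler_pdivrMl//.
    have hm : Num.max h 0 <= `|h| by rewrite ge_max normr_ge0 ler_norm.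
    have hm0 : 0 <= Num.max h 0 by rewrite le_max lexx orbT.
    have he : `|h| <= Num.min e 1.
      near: h; apply: dnbhs0_le; rewrite lt_min e0; exact: ltr01.
    move: he; rewrite le_min => /andP[he h1].
    apply: (@le_trans _ _ (`|h| ^+ m.+2)); first by rewrite /pospow lerXn2r// nnegrE.
    rewrite exprS ler_pM2l// exprS; apply: le_trans he; rewrite ler_piMr// exprn_ile1//.
  split; first by apply/cvg_ex; exists 0.
  exact: cvg_lim.
Unshelve. all: by end_near. Qed.

End positive_part_power.

Section kernel.
Variables (R : realType) (n : nat).
Local Notation V := (ambient R n).
Local Notation mu := (@volume R n).
Implicit Types (s z : V) (e : R).

(* eucl_norm (s - (0, e / 2)) ^+ 2 / (e / 2) ^+ 2 *)
Definition kerarg e s : R :=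
  4 / e ^+ 2 * (\sum_(i < n) hcoord i s * hcoord i s +
                (vcoord s - e / 2) * (vcoord s - e / 2)).

(** A bump on the Euclidean ball of radius [e / 2] about [(0, e / 2)], hence at positive height. The
    exponent 3 makes its vertical derivative of class C^1 as well, so that the vertical derivative
    of a mollified function can enter a test field. *)
Definition kern e s : R := pospow 3 (1 - kerarg e s).

Lemma smooth_kerarg e : smooth (kerarg e).
Proof.
apply: smoothZ; apply: smoothD.
  by apply: smooth_sum => i; apply: smoothM; exact: smooth_hcoord.
by apply: smoothM; apply: smoothB; (exact: smooth_vcoord || exact: smooth_cst).
Qed.

Lemma smooth_1kerarg e : smooth (fun s => 1 - kerarg e s).
Proof. by apply: smoothB; [exact: smooth_cst|exact: smooth_kerarg]. Qed.

Lemma smooth_kern e : smooth (kern e).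
Proof.
apply: (smooth_comp1 (smooth_1kerarg e) (@is_derive_pospow R 1)).
by move=> x; apply: cvgM; [exact: cvg_cst|exact: continuous_pospow].
Qed.

Lemma derive_vdir_kerarg e s :
  'D_(vdir R n) (kerarg e) s = 4 / e ^+ 2 * (2 * (vcoord s - e / 2)).
Proof.
apply: (@derive_val _ _ _ _ _ _ _ _).
apply/is_derive_line.
set c := 4 / e ^+ 2; set a := vcoord s - e / 2.
set S := \sum_(i < n) hcoord i s * hcoord i s.
have -> : (fun t : R => kerarg e (t *: vdir R n + s)) =
    (cst c * (cst S + (id + cst a) * (id + cst a)) : R -> R).
  apply/funext => t; rewrite /kerarg -/c !fctE vcoord_linear /vcoord/= mulr1.
  congr (c * (_ + _)); last by rewrite /a; ring.
  by apply: eq_bigr => i _; rewrite !hcoord_linear /hcoord/= !mxE mulr0 add0r.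
have D1 := is_deriveD (is_derive_id (0 : R) (1 : R)) (is_derive_cst a (0 : R) (1 : R)).
have D2 := is_deriveD (is_derive_cst S (0 : R) (1 : R)) (is_deriveM D1 D1).
have := is_deriveM (is_derive_cst c (0 : R) (1 : R)) D2.
congr is_derive; rewrite !fctE /=.
change (c * (0 + ((0 + a) * (1 + 0) + (0 + a) * (1 + 0))) +
  (0 + (0 + a) * (0 + a)) * 0 = c * (2 * a)) || 
change (c * (0 + ((0 + a) * (1 + 0) + (0 + a) * (1 + 0))) +
  (S + (0 + a) * (0 + a)) * 0 = c * (2 * a)); by ring.
Qed.

Lemma smooth_derive_kern e : smooth ('D_(vdir R n) (kern e)).
Proof.
rewrite (_ : 'D_ _ _ = (fun s => (3 * pospow 2 (1 - kerarg e s)) *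
    (- (4 / e ^+ 2 * (2 * (vcoord s - e / 2)))))).
  apply: smoothM.
    apply: smoothZ; apply: (smooth_comp1 (smooth_1kerarg e) (@is_derive_pospow R 0)).
    by move=> x; apply: cvgM; [exact: cvg_cst|exact: continuous_pospow].
  apply: smoothN; do 2 apply: smoothZ.
  by apply: smoothB; [exact: smooth_vcoord|exact: smooth_cst].
apply/funext => s.
have H1 : is_derive s (vdir R n) (fun s => 1 - kerarg e s) (0 - 'D_(vdir R n) (kerarg e) s).
  exact: (is_deriveB (is_derive_cst (1:R) s (vdir R n)) (smooth_is_derive _ _ (smooth_kerarg e))).
have [_ ->] := is_derive_comp1 H1 (is_derive_pospow 1 _).
by rewrite sub0r derive_vdir_kerarg.
Qed.

Lemma kern_ge0 e s : 0 <= kern e s. Proof. exact: pospow_ge0. Qed.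

Lemma kerarg_ge0 e s : 0 <= kerarg e s.
Proof.
rewrite /kerarg mulr_ge0 ?divr_ge0 ?sqr_ge0// addr_ge0//; last exact: sqr_ge0.
by apply: sumr_ge0 => i _; exact: sqr_ge0.
Qed.

Lemma kern_le1 e s : kern e s <= 1.
Proof.
have [H|H] := leP (1 - kerarg e s) 0.
  by rewrite /kern pospow_le0.
have H1 : 1 - kerarg e s <= 1 by rewrite gerBl kerarg_ge0.
rewrite /kern pospow_gt0E ?(ltW H)//.
have := @lerXn2r R 3 (1 - kerarg e s) 1.
by rewrite !nnegrE ler01 (ltW H) expr1n; apply.
Qed.

Let sq_lt (x y : R) : 0 < y -> x * x < y * y -> `|x| < y.
Proof.
move=> y0 xy; case: ltP => // yx; move: xy; have := ler_pM (ltW y0) (ltW y0) yx yx.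
rewrite -normrM ger0_norm; last exact: sqr_ge0.
by move=> /le_lt_trans/[apply]; rewrite ltxx.
Qed.

Lemma kern_support e s : 0 < e -> kern e s != 0 ->
  `|s| < e /\ 0 < vcoord s.
Proof.
move=> e0 ks.
have : kerarg e s < 1.
  rewrite ltNge; apply: contra ks => H.
  by rewrite /kern pospow_le0// subr_le0.
rewrite /kerarg mulrAC ltr_pdivrMr ?exprn_gt0// mul1r => H.
have S0 : 0 <= \sum_(i < n) hcoord i s * hcoord i s.
  by apply: sumr_ge0 => i _; exact: sqr_ge0.
have v0 : 0 <= (vcoord s - e / 2) * (vcoord s - e / 2) by exact: sqr_ge0.
have H2 : (vcoord s - e / 2) * (vcoord s - e / 2) < (e / 2) * (e / 2).
  by move: H S0; rewrite expr2; lra.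
have H3 : `|vcoord s - e / 2| < e / 2.
  have e20 : 0 < e / 2 by rewrite divr_gt0.
  exact: sq_lt.
have H4 : 0 < vcoord s < e.
  by move: H3; rewrite ltr_norml => /andP[? ?]; apply/andP; split; lra.
have /andP[H5 H6] := H4; split => //.
apply: norm_ambient_lt => //; last by rewrite gtr0_norm.
move=> i; apply: sq_lt => //.
have : hcoord i s * hcoord i s <= \sum_(i < n) hcoord i s * hcoord i s.
  by rewrite (bigD1 i)//= lerDl; apply: sumr_ge0 => j _; exact: sqr_ge0.
by move: H; rewrite expr2; nra.
Qed.

(** On the cube of radius [kern_rad * e] about [(0, e / 2)] one gets [kerarg <= 4 * n.+1 * kern_rad
    ^ 2 <= 1 / 2], hence a kernel of at least [1 / 8]. This bounds the mass of the kernel below by a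
    fixed share of the volume of a cube of radius [e]. *)
Definition kern_rad : R := (4 * n.+1%:R)^-1.

Lemma kern_lower e s : 0 < e -> ball ((0, e / 2) : V) (kern_rad * e) s ->
  1 / 8 <= kern e s.
Proof.
move=> e0 /ambient_ballP; rewrite mulr_gt0 ?invr_gt0 ?mulr_gt0// => /(_ isT)[/= H1 H2].
have n0 : 0 < (n.+1%:R : R) by [].
have n1 : 1 <= (n.+1%:R : R) by rewrite ler1n.
have sq (x : R) : `|x| < kern_rad * e -> x * x <= (kern_rad * e) ^+ 2.
  by move=> /ltW xr; rewrite -expr2 -real_normK ?num_real// lerXn2r// nnegrE (le_trans (normr_ge0 x)).
have : kerarg e s <= 1 / 2.
  rewrite /kerarg mulrAC ler_pdivrMr ?exprn_gt0//.
  apply: (@le_trans _ _ (4 * (n.+1%:R * (kern_rad * e) ^+ 2))).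
    rewrite ler_pM2l//; set K := (kern_rad * e) ^+ 2.
    have -> : n.+1%:R * K = n%:R * K + K by rewrite -natr1 mulrDl mul1r.
    apply: lerD; last by apply: sq; rewrite distrC.
    rewrite -[n in n%:R]card_ord mulr_natl -sumr_const; apply: ler_sum => i _.
    by apply: sq; have := H1 i; rewrite mxE sub0r normrN.
  have -> : 4 * (n.+1%:R * (kern_rad * e) ^+ 2) = (4 * n.+1%:R)^-1 * e ^+ 2.
    by rewrite /kern_rad; field; rewrite ?gt_eqF// -?natr1 ?natr1 ?gt_eqF.
  apply: ler_wpM2r; first exact: sqr_ge0.
  by rewrite div1r lef_pV2 ?posrE ?mulr_gt0//; lra.
move=> H; rewrite /kern pospow_gt0E; last by lra.
have -> : 1 / 8 = (1 / 2 : R) ^+ 3 by field.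
by rewrite lerXn2r ?nnegrE; lra.
Qed.

End kernel.

(** * Limits along sequences and convolution with a kernel of bounded support *)

Section sequential.
Variable R : realType.

(** Dominated convergence is about sequences; a limit along a filter reduces to them by picking a
    counterexample in each [B k]. *)
Lemma cvg_sequential (T : Type) (F : set_system T) (q : T -> R) (L : R)
    (B : nat -> set T) : Filter F -> (forall k, F (B k)) ->
  (forall x : nat -> T, (forall k, B k (x k)) -> q (x k) @[k --> \oo] --> L) ->
  q @ F --> L.
Proof.
move=> FF FB H; apply/cvgrPdist_lt => e e0; apply: contrapT => nF.
have /choice[x Hx] : forall k, exists x, B k x /\ e <= `|L - q x|.
  move=> k; apply: contrapT => /forallNP nx; apply: nF.
  apply: filterS (FB k) => y By; rewrite ltNge; apply/negP => ye.
  by apply: (nx y).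
have /cvgrPdist_lt/(_ e e0)[N _ /(_ N (leqnn N))] := H x (fun k => (Hx k).1).
by rewrite /= ltNge (Hx N).2.
Qed.

Lemma near_dnbhs_seq (h : nat -> R) : (forall k, h k != 0 /\ `|h k| < k.+1%:R^-1) ->
  h k @[k --> \oo] --> (0 : R)^'.
Proof.
move=> Hh P [e/= e0 HP]; have [N] := ltr_add_invr e0; rewrite add0r => Ne.
exists N => // k Nk; apply: HP; last exact: (Hh k).1.
rewrite /ball_/= sub0r normrN; apply: lt_trans (Hh k).2 _; apply: le_lt_trans Ne.
by rewrite lef_pV2 ?posrE// ler_nat.
Qed.

Lemma derive_oppdir (V : normedModType R) (f : V -> R) z v :
  derivable f z v -> is_derive z (- v) f (- 'D_v f z).
Proof.
move=> df; apply/is_derive_line.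
have /is_derive_line : is_derive z v f ('D_v f z) by exact/derivableP.
set g := (fun t : R => f (t *: v + z)) => dg.
rewrite (_ : (fun t : R => _) = g \o -%R); last first.
  by apply/funext => t; rewrite /g/= scalerN scaleNr.
rewrite -mulrN1; apply: is_derive1_comp; first by rewrite oppr0.
Qed.

Lemma difference_quotient_bound (V : normedModType R) (f : V -> R) v (C h : R) z :
  (forall w, derivable f w v) -> (forall w, `|'D_v f w| <= C) -> h != 0 ->
  `|h^-1 * (f (h *: v + z) - f z)| <= C.
Proof.
move=> df fC; have pos (b : R) w : 0 < b -> `|b^-1 * (f (b *: v + w) - f w)| <= C.
  move=> b0; have [c _ ->] := derive_MVT w b0 df.
  by rewrite mulrCA mulVf ?gt_eqF// mulr1.
have [h0|h0 _|//] := ltgtP h 0; last exact: pos.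
have := pos (- h) (h *: v + z); rewrite oppr_gt0 => /(_ h0).
rewrite addrA scaleNr addNr add0r invrN mulNr -mulrN opprB => + _; exact.
Qed.

End sequential.

Section convolution.
Variables (R : realType) (n : nat).
Local Notation V := (ambient R n).
Local Notation mu := (@volume R n).
Variable u : V -> R.
Hypothesis mu_ : measurable_fun setT u.
Hypothesis u1 : forall z, `|u z| <= 1.
Implicit Types (k : V -> R) (z w v : V) (r : R).

(** A correlation: by a change of variables it is the integral of [u (s + z)] with weight [k s], and
    a derivative in [z] along [v] falls on [k] along [- v]. *)
Definition conv k z : R := \int[mu]_w (u w * k (w - z)).

Lemma measurable_conv_integrand k z : measurable_fun setT k ->
  measurable_fun setT (fun w => u w * k (w - z)).
Proof. by move=> mk; apply: measurable_funM => //; exact: measurable_comp_shift. Qed.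

Lemma integrable_support (f : V -> R) (C r : R) : measurable_fun setT f ->
  (forall z, `|f z| <= C) -> (forall z, r <= `|z| -> f z = 0) ->
  mu.-integrable setT (EFin \o f).
Proof.
move=> mf fC fr.
apply: (@integrable_bounded _ V R mu f (ball (0 : V) r) C) => //.
- exact: measurable_ambient_ball.
- exact: volume_ball_lty.
- move=> z; rewrite -ball_normE /ball_/= sub0r normrN => /negP.
  by rewrite -leNgt; exact: fr.
Qed.

Lemma integrable_conv k z r C : measurable_fun setT k ->
  (forall z, `|k z| <= C) -> (forall z, r <= `|z| -> k z = 0) ->
  mu.-integrable setT (EFin \o (fun w => u w * k (w - z))).
Proof.
move=> mk kC kr; apply: (@integrable_support _ C (r + `|z|)).
- exact: measurable_conv_integrand.
- move=> w; rewrite normrM -[leRHS]mul1r; exact: ler_pM.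
- move=> w rw; rewrite kr ?mulr0//; apply: le_trans (lerB_normD _ _).
  by rewrite normrN lerBrDr.
Qed.

Lemma integrable_dominator (r C : R) : 0 <= C ->
  mu.-integrable setT (EFin \o (fun w : V => C * \1_(ball (0 : V) r : set V) w)).
Proof.
move=> C0; have mB := measurable_ambient_ball (0 : V) r.
apply: (@integrable_support _ C r).
- by apply: measurable_funM => //; exact: measurable_indic.
- move=> z; rewrite normrM (ger0_norm C0) indicE.
  by case: (_ \in _); rewrite ?normr1 ?normr0 ?mulr1 ?mulr0.
- move=> z rz; rewrite indicE memNset ?mulr0// -ball_normE /ball_/= sub0r normrN.
  by apply/negP; rewrite -leNgt.
Qed.

Lemma dominator_bound (f : V -> R) (r C : R) : (forall z, `|f z| <= C) ->
  (forall z, r <= `|z| -> f z = 0) ->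
  forall z, `|f z| <= C * \1_(ball (0 : V) r : set V) z.
Proof.
move=> fC fr z; rewrite indicE; have [_|] := boolP (_ \in _).
  by rewrite mulr1.
rewrite notin_setE -ball_normE /ball_/= sub0r normrN => /negP.
by rewrite -leNgt => /fr ->; rewrite normr0 mulr0.
Qed.

Lemma continuous_conv k r : continuous k -> (forall z, r <= `|z| -> k z = 0) ->
  continuous (conv k).
Proof.
move=> ck kr z.
have [C C0 kC] := bounded_of_support ck kr.
have mk : measurable_fun setT k by exact: continuous_measurable_ambient.
apply: (@cvg_sequential R V (nbhs z) (conv k) (conv k z)
  (fun j : nat => ball z j.+1%:R^-1)).
  by move=> j; have j0 : 0 < j.+1%:R^-1 :> R; [rewrite invr_gt0|exact: (nbhsx_ballx z _ j0)].
move=> x Hx.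
apply: (@Rintegral_bigcvg _ V R mu (fun j w => u w * k (w - x j)) _
  (fun w => C * \1_(ball (0 : V) (r + `|z| + 1) : set V) w)).
- by move=> j; exact: measurable_conv_integrand.
- exact: measurable_conv_integrand.
- apply: aeW => w; apply: cvgM; first exact: cvg_cst.
  have xz : x j @[j --> \oo] --> z.
    apply/cvgrPdist_lt => e e0; have [N] := ltr_add_invr e0; rewrite add0r => Ne.
    exists N => // j Nj /=.
    have := Hx j; rewrite -ball_normE /ball_/= => /lt_trans; apply.
    apply: le_lt_trans Ne; by rewrite lef_pV2 ?posrE// ler_nat.
  apply: (@cvg_comp _ _ _ (fun j => w - x j) k _ (nbhs (w - z))); last exact: ck.
  by apply: cvgB => //; exact: cvg_cst.
- exact: integrable_dominator.
- move=> j; apply: dominator_bound => w.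
    by rewrite normrM -[leRHS]mul1r; exact: ler_pM.
  move=> rw; rewrite kr ?mulr0//.
  have xz : `|x j| <= `|z| + 1.
    have := Hx j; rewrite -ball_normE /ball_/= => xz.
    rewrite -[x j](subrK z) addrC (le_trans (ler_normD _ _))// lerD2l distrC ltW//.
    by rewrite (lt_le_trans xz)// invf_le1// ler1n.
  have := lerB_normD w (- x j); rewrite normrN; lra.
Qed.

Lemma is_derive_conv k z v r : smooth k -> (forall z, r <= `|z| -> k z = 0) ->
  is_derive z v (conv k) (conv ('D_(- v) k) z).
Proof.
move=> sk kr; have mk := smooth_measurable sk.
have mDk := smooth_derive_measurable (- v) sk.
have [C C0 kC] := bounded_of_support sk.1 kr.
have kr' w : r + 1 <= `|w| -> 'D_(- v) k w = 0.
  by move=> rw; apply: derive_support kr _ _; lra.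
have [D D0 kD] := bounded_of_support (sk.2 (- v)).2 kr'.
suff H : (fun h => h^-1 *: ((conv k \o shift z) (h *: v) - conv k z)) @ 0^' -->
    conv ('D_(- v) k) z.
  by split; [apply/cvg_ex; exists (conv ('D_(- v) k) z)|exact: cvg_lim].
apply: (@cvg_sequential R R (0^') _ _ (fun j : nat => [set h : R | h != 0 /\ `|h| < j.+1%:R^-1])).
  move=> j; exists j.+1%:R^-1; first by rewrite /= invr_gt0.
  by move=> h; rewrite /ball_/= sub0r normrN => hj h0; split.
move=> h Hh; have intk w := integrable_conv w mk kC kr.
pose q j w := u w * ((h j)^-1 * (k (h j *: (- v) + (w - z)) - k (w - z))).
have qE : (fun j => (h j)^-1 *: ((conv k \o shift z) (h j *: v) - conv k z)) =
    (fun j => \int[mu]_w q j w).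
  apply/funext => j; rewrite /conv /=.
  rewrite -(@RintegralB _ V R mu setT (fun w => u w * k (w - (h j *: v + z)))
     (fun w => u w * k (w - z)))//.
  have intd : mu.-integrable setT (EFin \o
      (fun w => u w * k (w - (h j *: v + z)) - u w * k (w - z))).
    exact: (@integrableB _ V R mu setT measurableT
     (EFin \o (fun w => u w * k (w - (h j *: v + z)))) (EFin \o (fun w => u w * k (w - z)))).
  apply: etrans (esym (RintegralZl (h j)^-1 measurableT intd)) _.
  apply: eq_Rintegral => w _; rewrite /q -mulrBr mulrCA; congr (_ * (_ * (k _ - _))).
  by rewrite scalerN opprD addrCA.
rewrite qE.
apply: (@Rintegral_bigcvg _ V R mu q (fun w => u w * 'D_(- v) k (w - z))
  (fun w => D * \1_(ball (0 : V) (r + `|z| + `|v| + 1) : set V) w)).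
- move=> j; apply: measurable_funM => //; apply: measurable_funM => //.
  apply: measurable_funB; last exact: measurable_comp_shift.
  rewrite (_ : (fun w => _) = (fun w => k (w + (h j *: (- v) - z)))).
    exact: measurable_comp_shift.
  by apply/funext => w; congr k; rewrite addrCA.
- exact: (measurable_conv_integrand z mDk).
- apply: aeW => w; apply: cvgM; first exact: cvg_cst.
  have [dk _] := smooth_is_derive (w - z) (- v) sk.
  exact: (cvg_comp _ _ (near_dnbhs_seq Hh) dk).
- exact: integrable_dominator.
- move=> j; have [hj0 hj1] := Hh j; apply: dominator_bound => w.
    rewrite normrM -[leRHS]mul1r; apply: ler_pM => //.
    by apply: difference_quotient_bound => //; exact: (sk.2 (- v)).1.
  move=> rw.
  have hv : `|h j *: - v| <= `|v|.
    rewrite normrZ normrN ler_piMl// ltW// (lt_le_trans hj1)//.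
    by rewrite invf_le1// ler1n.
  have H1 := lerB_normD w (- z); have H2 := lerB_normD (w - z) (h j *: - v).
  have v0 := normr_ge0 v.
  rewrite normrN in H1.
  rewrite [w - z + _]addrC in H2.
  by rewrite /q !kr; [rewrite subrr !mulr0|lra|lra].
Qed.

Lemma smooth_conv k r : smooth k -> (forall z, r <= `|z| -> k z = 0) ->
  smooth (conv k).
Proof.
move=> sk kr; apply: (@smoothP _ _ _ (fun v => conv ('D_(- v) k))).
- exact: (continuous_conv sk.1 kr).
- by move=> v z; exact: (is_derive_conv z v sk kr).
- move=> v; apply: (@continuous_conv _ (r + 1)); first exact: (sk.2 (- v)).2.
  by move=> z rz; apply: derive_support kr _ _; lra.
Qed.

Lemma smooth_derive_conv k r v : smooth k -> smooth ('D_v k) ->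
  (forall z, r <= `|z| -> k z = 0) -> smooth ('D_v (conv k)).
Proof.
move=> sk sDk kr.
have -> : 'D_v (conv k) = conv (fun z => - 'D_v k z).
  apply/funext => z; have [_ ->] := is_derive_conv z v sk kr.
  congr (Rintegral _ _ _); apply/funext => w.
  by have [_ ->] := derive_oppdir ((sk.2 v).1 (w - z)).
apply: (@smooth_conv _ (r + 1)); first exact: smoothN.
by move=> z rz; rewrite (derive_support v kr) ?oppr0//; lra.
Qed.

Lemma convE k z : measurable_fun setT k ->
  conv k z = \int[mu]_s (u (s + z) * k s).
Proof.
move=> mk; rewrite /conv -(@Rintegral_shift _ _ (fun w => u w * k (w - z)) z).
  by apply: eq_Rintegral => s _; rewrite addrK.
exact: measurable_conv_integrand.
Qed.

End convolution.

Section real_fubini.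
Context d1 d2 (T1 : measurableType d1) (T2 : measurableType d2) (R : realType).
Variables (m1 : {sigma_finite_measure set T1 -> \bar R})
          (m2 : {sigma_finite_measure set T2 -> \bar R}).

Lemma real_Fubini (F : T1 * T2 -> R) :
  (m1 \x m2)%E.-integrable setT (EFin \o F) ->
  (forall x, m2.-integrable setT (EFin \o (fun y => F (x, y)))) ->
  (forall y, m1.-integrable setT (EFin \o (fun x => F (x, y)))) ->
  m1.-integrable setT (EFin \o (fun x => \int[m2]_y F (x, y))) /\
  \int[m1]_x \int[m2]_y F (x, y) = \int[m2]_y \int[m1]_x F (x, y).
Proof.
move=> iF i1 i2.
have E1 : EFin \o (fun x => \int[m2]_y F (x, y)) = fubini_F m2 (EFin \o F).
  apply/funext => x; rewrite /fubini_F /= /Rintegral fineK//.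
  exact: (integrable_fin_num measurableT (i1 x)).
have E2 : EFin \o (fun y => \int[m1]_x F (x, y)) = fubini_G m1 (EFin \o F).
  apply/funext => y; rewrite /fubini_G /= /Rintegral fineK//.
  exact: (integrable_fin_num measurableT (i2 y)).
split.
- by rewrite E1; exact: integrable_fubini_F.
- have := Fubini iF; rewrite -/(fubini_F m2 (EFin \o F)) => H.
  rewrite /Rintegral; congr fine.
  transitivity (\int[m1]_x fubini_F m2 (EFin \o F) x)%E.
    by rewrite -E1.
  transitivity (\int[m2]_x fubini_G m1 (EFin \o F) x)%E; first exact: H.
  by rewrite -E2.
Qed.

End real_fubini.

(** * Test fields, fluxes and the perimeter *)

Section test_fields.
Variables (R : realType) (n : nat).
Local Notation V := (ambient R n).
Local Notation mu := (@volume R n).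
Local Notation Om := (@Omega R n).
Implicit Types (phi psi : V -> V) (u : V -> R) (z w v : V) (r : R) (E F : set V).

Definition test_field phi :=
  [/\ C1 phi, compact_support_in Om phi & forall z, eucl_norm (phi z) <= 1].

Definition supported_in phi r eta :=
  (forall z, r < `|z| -> phi z = 0) /\ (forall z, vcoord z < eta -> phi z = 0).

(** A compact set in the open half space has a positive minimal height. The height [eta] is what
    leaves room for further fields near the boundary. *)
Lemma compact_supportP phi : compact_support_in Om phi <->
  exists r eta, 0 < eta /\ supported_in phi r eta.
Proof.
split=> [[K [cK KO Kphi]]|[r [eta [eta0 [Hr He]]]]].
- have [r [_ Kr]] := compact_bounded cK.
  have [K0|] := pselect (K !=set0); last first.
    move=> K0; exists 0, 1; split => //; split => z _; apply: Kphi => Kz; apply: K0; by exists z.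
  have [c cK' Hc] := @compact_EVT_min V R (@vcoord R n) K K0 cK
    (continuous_subspaceT (@vcoord_continuous R n)).
  exists (`|r| + 1), (vcoord c); split; first by move: cK'; rewrite inE => /KO.
  split=> z Hz; apply: Kphi => Kz.
    have : `|z| <= `|r| + 1.
      by apply: Kr => //; rewrite (le_lt_trans (ler_norm r))// ltrDl.
    by rewrite leNgt Hz.
  by move: Hz; rewrite ltNge Hc// inE.
- exists ([set z | `|z| <= r] `&` [set z | eta <= vcoord z]); split.
  + apply: compact_closedI; first exact: compact_ambient_ball.
    apply: (@closed_comp _ _ (@vcoord R n) [set x : R | eta <= x]).
      by move=> z _; exact: vcoord_continuous.
    exact: closed_ge.
  + by move=> z [_ /= /(lt_le_trans eta0)].
  + move=> z /not_andP[|] /=.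
      by move=> /negP; rewrite -ltNge => /Hr.
    by move=> /negP; rewrite -ltNge => /He.
Qed.

Lemma divergenceE phi z : divergence phi z =
  \sum_(i < n) 'D_(edir R i) (@hcoord R n i \o phi) z +
  'D_(vdir R n) (@vcoord R n \o phi) z.
Proof. by []. Qed.

Lemma continuous_divergence phi : C1 phi -> continuous (divergence phi).
Proof.
move=> /C1P[sh sv].
have cs (s : seq 'I_n) : continuous (fun z =>
    \sum_(i <- s) 'D_(edir R i) (@hcoord R n i \o phi) z).
  elim: s => [|i s IH].
    by under eq_fun do rewrite big_nil; exact: cst_continuous.
  under eq_fun do rewrite big_cons.
  by move=> z; apply: cvgD; [exact: ((sh i).2 _).2|exact: IH].
by move=> z; apply: cvgD; [exact: cs|exact: (sv.2 _).2].
Qed.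

Lemma divergence_near0 phi z : (\forall w \near z, phi w = 0) ->
  divergence phi z = 0.
Proof.
move=> phi0; have D0 (l : V -> R) v : l 0 = 0 -> 'D_v (l \o phi) z = 0.
  move=> l0; rewrite -(derive_cst (0 : R) z v); apply: near_eq_derive.
  by apply: filterS phi0 => w /= ->.
rewrite divergenceE big1 ?add0r; last by move=> i _; rewrite D0// /hcoord mxE.
by rewrite D0.
Qed.

Lemma divergence_support phi r eta : supported_in phi r eta ->
  (forall z, r < `|z| -> divergence phi z = 0) /\
  (forall z, vcoord z < eta -> divergence phi z = 0).
Proof.
move=> [Hr He]; split => z Hz; apply: divergence_near0.
- have : (fun w : V => `|w|) @ z --> `|z| by exact: norm_continuous.
  by move/cvgr_gt => /(_ _ Hz); apply: filterS => w; exact: Hr.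
- have := @vcoord_continuous R n z.
  by move/cvgr_lt => /(_ _ Hz); apply: filterS => w; exact: He.
Qed.

Lemma divergence_bound phi : C1 phi -> compact_support_in Om phi ->
  exists r C, [/\ 0 <= C, forall z, `|divergence phi z| <= C &
    forall z, r <= `|z| -> divergence phi z = 0].
Proof.
move=> Cphi /compact_supportP[r [eta [_ /divergence_support[Hr _]]]].
have Hr' z : r + 1 <= `|z| -> divergence phi z = 0 by move=> rz; apply: Hr; lra.
have [C C0 HC] := bounded_of_support (continuous_divergence Cphi) Hr'.
by exists (r + 1), C.
Qed.

Definition flux u phi : R := \int[mu]_z (u z * divergence phi z).

Lemma integrable_flux u phi (C : R) : measurable_fun setT u ->
  (forall z, `|u z| <= C) -> C1 phi -> compact_support_in Om phi ->
  mu.-integrable setT (EFin \o (fun z => u z * divergence phi z)).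
Proof.
move=> mu_ uC Cphi sphi; have [r [D [D0 HD Hr]]] := divergence_bound Cphi sphi.
apply: (@integrable_support _ _ _ (C * D) r).
- apply: measurable_funM => //.
  by apply: continuous_measurable_ambient; exact: continuous_divergence.
- by move=> z; rewrite normrM ler_pM.
- by move=> z /Hr ->; rewrite mulr0.
Qed.

Lemma indic_le1 E z : `|\1_E z : R| <= 1.
Proof. by rewrite indicE; case: (_ \in _); rewrite ?normr1 ?normr0. Qed.

Lemma integral_flux E phi : measurable E -> E `<=` Om -> C1 phi ->
  compact_support_in Om phi ->
  (\int[mu]_(z in Om) (\1_E z * divergence phi z)%:E)%E = (flux (\1_E) phi)%:E.
Proof.
move=> mE EO Cphi sphi.
have mI : measurable_fun setT (\1_E : V -> R) by exact: measurable_indic.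
rewrite /flux /Rintegral fineK; last first.
  exact: (integrable_fin_num measurableT (integrable_flux mI (@indic_le1 E) Cphi sphi)).
rewrite [LHS]integral_mkcond; apply: eq_integral => z _; rewrite patchE indicE.
case: ifPn => // zO; rewrite memNset ?mul0r// => /EO.
by move: zO; rewrite notin_setE.
Qed.

Lemma perimeter_le E (p : \bar R) : measurable E -> E `<=` Om ->
  (forall phi, test_field phi -> (flux (\1_E) phi)%:E <= p)%E ->
  (perimeter E <= p)%E.
Proof.
move=> mE EO H; apply: ge_ereal_sup => _ [phi [Cphi sphi bphi] <-].
by rewrite integral_flux//; exact: H.
Qed.

Lemma flux_le_perimeter E phi : measurable E -> E `<=` Om -> test_field phi ->
  ((flux (\1_E) phi)%:E <= perimeter E)%E.
Proof.
move=> mE EO [Cphi sphi bphi]; rewrite -integral_flux//.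
by apply: ereal_sup_ubound; exists phi.
Qed.

Lemma eucl_norm_vertical (a : R) : eucl_norm ((0, a) : V) = `|a|.
Proof.
rewrite /eucl_norm big1 ?add0r ?sqrtr_sqr// => i _.
by rewrite mxE expr0n.
Qed.

Lemma test_field0 : test_field (fun=> 0).
Proof.
split.
- apply: C1_of_smooth => [i|].
    by rewrite (_ : _ \o _ = cst (hcoord i (0 : V)))//; exact: smooth_cst.
  by rewrite (_ : _ \o _ = cst (vcoord (0 : V)))//; exact: smooth_cst.
- by apply/compact_supportP; exists 0, 1.
- by move=> z; rewrite [X in eucl_norm X](_ : _ = (0, 0))// eucl_norm_vertical normr0.
Qed.

Lemma flux0 u : flux u (fun=> 0) = 0.
Proof.
rewrite /flux /Rintegral (eq_integral (fun=> 0%E)) ?integral0// => z _.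
have -> : divergence (fun=> (0 : V)) z = 0 by apply: divergence_near0;
  exact: (filterS (fun (w : V) _ => erefl) (@filterT V (nbhs z) (nbhs_filter (z : V)))).
by rewrite mulr0.
Qed.

Lemma perimeter_ge0 E : measurable E -> E `<=` Om -> (0 <= perimeter E)%E.
Proof.
by move=> mE EO; have := flux_le_perimeter mE EO test_field0; rewrite flux0.
Qed.

Lemma BV_setP E : BV_set E <->
  [/\ measurable E, E `<=` Om, (mu E < +oo)%E & (perimeter E < +oo)%E].
Proof.
have mO : measurable Om.
  apply: open_measurable_ambient; rewrite (_ : Om = @vcoord R n @^-1` [set x : R | 0 < x])//.
  by apply: open_comp; [move=> z _; exact: vcoord_continuous|exact: open_gt].
split=> [[mE EO [iE pE]]|[mE EO muE pE]]; split => //.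
- move/integrableP : iE => [_].
  rewrite (eq_integral (fun x => (\1_E x)%:E)); last first.
    by move=> t _ /=; rewrite ger0_norm// indicE.
  by rewrite integral_indic// setIidl.
- split => //; apply: (@integrableS _ _ _ mu setT) => //.
  exact: integrable_indic_lty.
Qed.

Lemma BV_perimeter E : BV_set E -> exists2 p : R, 0 <= p & perimeter E = p%:E.
Proof.
move=> /BV_setP[mE EO _]; have := perimeter_ge0 mE EO.
case: (perimeter E) => // p p0 _; by exists p.
Qed.

Lemma continuous_shift (f : V -> R) (a : V) : continuous f ->
  continuous (fun z => f (z + a)).
Proof.
move=> cf z; apply: (@cvg_comp _ _ _ (fun z => z + a) f _ (nbhs (z + a))).
  by apply: cvgD; [exact: cvg_id|exact: cvg_cst].
exact: cf.
Qed.

Lemma smooth_shift (f : V -> R) (a : V) : smooth f -> smooth (fun z => f (z + a)).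
Proof.
move=> sf; apply: (@smoothP _ _ _ (fun v z => 'D_v f (z + a))).
- exact: continuous_shift sf.1.
- move=> v z; have [df dE] := smooth_is_derive (z + a) v sf.
  by split; move: df dE; rewrite /derivable /derive;
    (have -> : (fun h => h^-1 *: ((f \o shift (z + a)) (h *: v) - f (z + a))) =
      (fun h => h^-1 *: (((fun z => f (z + a)) \o shift z) (h *: v) - f (z + a)))
      by apply/funext => h /=; rewrite addrA).
- by move=> v; exact: (@continuous_shift ('D_v f) a (sf.2 v).2).
Qed.

Lemma derive_shift_ambient (f : V -> R) (a v z : V) :
  'D_v (fun z => f (z + a)) z = 'D_v f (z + a).
Proof.
rewrite /derive.
have -> : (fun h : R => h^-1 *: (((fun z => f (z + a)) \o shift z) (h *: v) - f (z + a))) =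
    (fun h : R => h^-1 *: ((f \o shift (z + a)) (h *: v) - f (z + a))).
  by apply/funext => h /=; rewrite addrA.
by [].
Qed.

(** The condition [vcoord a <= 0] moves the field upwards, away from the boundary. *)
Lemma test_field_shift phi (a : V) : test_field phi -> vcoord a <= 0 ->
  test_field (fun z => phi (z + a)) /\
  forall z, divergence (fun z => phi (z + a)) z = divergence phi (z + a).
Proof.
move=> [/C1P[sh sv] /compact_supportP[r [eta [eta0 [Hr He]]]] bphi] a0; split.
  split.
  - apply: C1_of_smooth => [i|]; first exact: (smooth_shift a (sh i)).
    exact: (smooth_shift a sv).
  - apply/compact_supportP; exists (r + `|a|), eta; split => //; split => z Hz.
      by apply: Hr; have := lerB_normD z a; lra.
    by apply: He; rewrite /vcoord/= in a0 Hz *; lra.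
  - by move=> z; exact: bphi.
move=> z; rewrite !divergenceE; congr (_ + _); last first.
  exact: (derive_shift_ambient (@vcoord R n \o phi)).
by apply: eq_bigr => i _; exact: (derive_shift_ambient (@hcoord R n i \o phi)).
Qed.

End test_fields.

Section integrable_scale.
Context d (T : measurableType d) (R : realType) (mu : {measure set T -> \bar R}).

Lemma integrable_scaler (f : T -> R) (r : R) :
  mu.-integrable setT (EFin \o f) ->
  mu.-integrable setT (EFin \o (fun x => f x * r)).
Proof. by move=> fi; exact: (integrableZr measurableT r fi). Qed.

Lemma integrable_scalel (f : T -> R) (r : R) :
  mu.-integrable setT (EFin \o f) ->
  mu.-integrable setT (EFin \o (fun x => r * f x)).
Proof. by move=> fi; exact: (integrableZl measurableT r fi). Qed.

Lemma integrable_add (f g : T -> R) :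
  mu.-integrable setT (EFin \o f) -> mu.-integrable setT (EFin \o g) ->
  mu.-integrable setT (EFin \o (fun x => f x + g x)).
Proof. by move=> fi gi; exact: (integrableD measurableT fi gi). Qed.

Lemma integrable_sub (f g : T -> R) :
  mu.-integrable setT (EFin \o f) -> mu.-integrable setT (EFin \o g) ->
  mu.-integrable setT (EFin \o (fun x => f x - g x)).
Proof. by move=> fi gi; exact: (integrableB measurableT fi gi). Qed.

End integrable_scale.

(** * Mollified indicators *)

Section mollification.
Variables (R : realType) (n : nat).
Local Notation V := (ambient R n).
Local Notation mu := (@volume R n).
Local Notation Om := (@Omega R n).
Implicit Types (phi : V -> V) (z w v s : V) (r e : R) (E F : set V).

Lemma Rintegral_indic E : measurable E -> \int[mu]_z (\1_E z : R) = fine (mu E).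
Proof.
by move=> mE; rewrite /Rintegral integral_indic; [rewrite setIT|exact: measurableT|exact: mE].
Qed.

Definition kint e : R := \int[mu]_s kern e s.

Let kern_meas e : measurable_fun setT (@kern R n e).
Proof. exact: smooth_measurable (smooth_kern _ _). Qed.

Lemma kern_eq0 e s : 0 < e -> e <= `|s| -> kern e s = 0.
Proof.
move=> e0 es; apply/eqP/negPn/negP => /(kern_support e0)[].
by rewrite ltNge es.
Qed.

Let kern_abs e s : `|@kern R n e s| <= 1.
Proof. by rewrite ger0_norm ?kern_ge0 ?kern_le1. Qed.

Lemma integrable_kern e : 0 < e -> mu.-integrable setT (EFin \o @kern R n e).
Proof.
move=> e0; apply: (@integrable_support _ _ _ 1 e) => // z.
exact: kern_eq0.
Qed.

Lemma kern_rad_gt0 : 0 < kern_rad R n.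
Proof. by rewrite invr_gt0 mulr_gt0. Qed.

Lemma kint_lower e : 0 < e ->
  (kern_rad R n * e *+ 2) ^+ n.+1 / 8 <= kint e.
Proof.
move=> e0; have re0 : 0 < kern_rad R n * e by rewrite mulr_gt0// kern_rad_gt0.
pose B : set V := ball ((0, e / 2) : V) (kern_rad R n * e).
have mB : measurable B by exact: measurable_ambient_ball.
have iB : mu.-integrable setT (EFin \o (\1_B : V -> R)).
  apply: integrable_indic_lty => //; exact: volume_ball_lty.
have -> : (kern_rad R n * e *+ 2) ^+ n.+1 / 8 = \int[mu]_z (1 / 8 * \1_B z).
  by rewrite RintegralZl// Rintegral_indic// volume_ball//= mulrC mul1r.
apply: le_Rintegral => //.
- exact: integrable_scalel.
- exact: integrable_kern.
- move=> z _; rewrite indicE; have [zB|_] := boolP (z \in B).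
    by rewrite mulr1; apply: kern_lower => //; rewrite inE in zB.
  by rewrite mulr0 kern_ge0.
Qed.

Lemma kint_gt0 e : 0 < e -> 0 < kint e.
Proof.
move=> e0; apply: lt_le_trans (kint_lower e0).
by rewrite divr_gt0// exprn_gt0// pmulrn_lgt0// mulr_gt0// kern_rad_gt0.
Qed.

Definition molli e s : R := (kint e)^-1 * kern e s.

Lemma smooth_molli e : smooth (molli e).
Proof. by apply: smoothZ; exact: smooth_kern. Qed.

Lemma smooth_derive_molli e : smooth ('D_(vdir R n) (molli e)).
Proof.
have -> : 'D_(vdir R n) (molli e) = (fun z => (kint e)^-1 * 'D_(vdir R n) (@kern R n e) z).
  apply/funext => z; rewrite /molli.
  have dk := smooth_is_derive z (vdir R n) (smooth_kern n e).
  have [_ ->] := is_deriveM (is_derive_cst (kint e)^-1 z (vdir R n)) dk.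
  by rewrite scaler0 addr0.
by apply: smoothZ; exact: smooth_derive_kern.
Qed.

Lemma molli_ge0 e s : 0 < e -> 0 <= molli e s.
Proof. by move=> e0; rewrite mulr_ge0 ?kern_ge0// invr_ge0 ltW// kint_gt0. Qed.

Lemma molli_eq0 e s : 0 < e -> e <= `|s| -> molli e s = 0.
Proof. by move=> e0 es; rewrite /molli kern_eq0 ?mulr0. Qed.

Lemma molli_vcoord e s : 0 < e -> molli e s != 0 -> 0 < vcoord s.
Proof.
by move=> e0; rewrite mulf_eq0 negb_or => /andP[_ /(kern_support e0)[]].
Qed.

Lemma molli_le e s : 0 < e -> molli e s <= (kint e)^-1.
Proof.
by move=> e0; rewrite /molli ler_piMr ?kern_le1// invr_ge0 ltW// kint_gt0.
Qed.

Let molli_abs e s : 0 < e -> `|molli e s| <= (kint e)^-1.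
Proof. by move=> e0; rewrite ger0_norm ?molli_ge0 ?molli_le. Qed.

Lemma molli_measurable e : measurable_fun setT (molli e).
Proof. exact: smooth_measurable (smooth_molli e). Qed.

Lemma integrable_molli e : 0 < e -> mu.-integrable setT (EFin \o molli e).
Proof.
move=> e0; apply: (@integrable_support _ _ _ (kint e)^-1 e).
- exact: molli_measurable.
- by move=> z; exact: molli_abs.
- by move=> z; exact: molli_eq0.
Qed.

Lemma Rintegral_molli e : 0 < e -> \int[mu]_s molli e s = 1.
Proof.
move=> e0; rewrite /molli RintegralZl//; last exact: integrable_kern.
by rewrite mulVf// gt_eqF// kint_gt0.
Qed.

Definition moll E e : V -> R := conv (\1_E) (molli e).

Let mI E : measurable E -> measurable_fun setT (\1_E : V -> R).
Proof. by move=> mE; exact: measurable_indic. Qed.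

Lemma smooth_moll E e : measurable E -> 0 < e -> smooth (moll E e).
Proof.
move=> mE e0; apply: (smooth_conv (mI mE) (@indic_le1 _ _ E) (r := e) (smooth_molli e)).
by move=> z; exact: molli_eq0.
Qed.

Lemma smooth_derive_moll E e : measurable E -> 0 < e ->
  smooth ('D_(vdir R n) (moll E e)).
Proof.
move=> mE e0; apply: (smooth_derive_conv (mI mE) (@indic_le1 _ _ E) (r := e) (smooth_molli e)).
  exact: smooth_derive_molli.
by move=> z; exact: molli_eq0.
Qed.

Lemma mollE E e z : measurable E ->
  moll E e z = \int[mu]_s (\1_E (s + z) * molli e s).
Proof. by move=> mE; apply: convE; [exact: mI|exact: molli_measurable]. Qed.

Let integrable_moll E e z : measurable E -> 0 < e ->
  mu.-integrable setT (EFin \o (fun s => \1_E (s + z) * molli e s)).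
Proof.
move=> mE e0; apply: (@integrable_support _ _ _ (kint e)^-1 e).
- apply: measurable_funM; last exact: molli_measurable.
  exact: (measurable_comp_shift z (mI mE)).
- move=> s; rewrite normrM -[leRHS]mul1r; apply: ler_pM => //.
    exact: indic_le1.
  exact: molli_abs.
- by move=> s es; rewrite molli_eq0// mulr0.
Qed.

Lemma moll_ge0_le1 E e z : measurable E -> 0 < e -> 0 <= moll E e z <= 1.
Proof.
move=> mE e0; rewrite (mollE e z mE); apply/andP; split.
  by apply: Rintegral_ge0 => s _; apply: mulr_ge0; [rewrite indicE|exact: molli_ge0].
rewrite -(Rintegral_molli e0); apply: le_Rintegral => //.
- exact: integrable_moll.
- exact: integrable_molli.
- move=> s _; rewrite ler_piMl ?molli_ge0//.
Qed.

Let measurable_add : measurable_fun setT (fun p : V * V => p.1 + p.2).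
Proof.
apply/measurable_fun_pairP; split.
  apply: measurable_rowP => i.
  rewrite (_ : _ \o _ = (fun p : V * V => row_coord i p.1.1 + row_coord i p.2.1)); last first.
    by apply/funext => p; rewrite /row_coord /= mxE.
  apply: measurable_funD; (apply: measurableT_comp; first exact: measurable_row_coord);
    exact: measurableT_comp.
rewrite (_ : _ \o _ = (fun p : V * V => (p.1.2 : R) + (p.2.2 : R)))//.
by apply: measurable_funD; exact: measurableT_comp.
Qed.

(** By Fubini the flux of the mollified indicator is the mean, with weight [molli e s], of the
    fluxes of [E] through the fields [phi (z - s)]. Where the weight is nonzero [s] has positive
    height, so these are test fields and each flux is at most [p]. *)
Lemma flux_moll_le E e phi (p : R) : measurable E -> E `<=` Om -> 0 < e ->
  perimeter E = p%:E -> test_field phi -> flux (moll E e) phi <= p.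
Proof.
move=> mE EO e0 Ep tphi; have [Cphi sphi _] := tphi.
have [r [C [C0 fC fr]]] := divergence_bound Cphi sphi.
set f := divergence phi in fC fr.
have mf : measurable_fun setT f.
  by apply: continuous_measurable_ambient; exact: continuous_divergence.
pose F (q : V * V) : R := \1_E (q.1 + q.2) * molli e q.1 * f q.2.
have k0 : 0 <= (kint e)^-1 by rewrite invr_ge0 ltW// kint_gt0.
have FC q : `|F q| <= (kint e)^-1 * C.
  rewrite normrM; apply: ler_pM => //.
  rewrite normrM -[leRHS]mul1r; apply: ler_pM => //; first exact: indic_le1.
  exact: molli_abs.
have mF : measurable_fun setT F.
  apply: measurable_funM.
    apply: measurable_funM.
      exact: (measurableT_comp (mI mE) measurable_add).
    exact: (measurableT_comp (molli_measurable e) measurable_fst).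
  exact: (measurableT_comp mf measurable_snd).
pose Be : set V := ball (0 : V) e; pose Br : set V := ball (0 : V) r.
have mBe : measurable Be by exact: measurable_ambient_ball.
have mBr : measurable Br by exact: measurable_ambient_ball.
have BB : (mu \x mu)%E (Be `*` Br) = (mu Be * mu Br)%E by exact: product_measure1E.
have iF : (mu \x mu)%E.-integrable setT (EFin \o F).
  apply: (@integrable_bounded _ _ _ (mu \x mu)%E F
    (Be `*` Br) ((kint e)^-1 * C)) => //.
  - exact: measurableX.
  - rewrite [X in (X < _)%E]BB.
    apply: lte_mul_pinfty => //; last exact: volume_ball_lty.
    by rewrite ge0_fin_numE//; exact: volume_ball_lty.
  - move=> [s z] /not_andP[|] /=; rewrite /Be /Br -ball_normE /ball_/= sub0r normrN => /negP;
      rewrite -leNgt => H.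
      by rewrite /F /= molli_eq0// mulr0 mul0r.
    by rewrite /F /= fr// mulr0.
have i1 s : mu.-integrable setT (EFin \o (fun z => F (s, z))).
  apply: (@integrable_support _ _ _ ((kint e)^-1 * C) r) => //.
    by apply: (measurableT_comp mF); exact: measurable_pair1.
  by move=> z rz; rewrite /F /= fr// mulr0.
have i2 z : mu.-integrable setT (EFin \o (fun s => F (s, z))).
  apply: (@integrable_support _ _ _ ((kint e)^-1 * C) e) => //.
    by apply: (measurableT_comp mF); exact: measurable_pair2.
  by move=> s es; rewrite /F /= molli_eq0// mulr0 mul0r.
have [iFs Fub] := real_Fubini iF i1 i2.
have -> : flux (moll E e) phi = \int[mu]_s \int[mu]_z F (s, z).
  rewrite Fub /flux; apply: eq_Rintegral => z _.
  rewrite (mollE e z mE).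
  exact: (esym (RintegralZr (f z) measurableT (integrable_moll z mE e0))).
have FE s z : F (s, z) = \1_E (s + z) * molli e s * f z by [].
have fE z : divergence phi z = f z by [].
clearbody F f.
rewrite -[leRHS]mul1r -(Rintegral_molli e0).
rewrite -(RintegralZr p measurableT (integrable_molli e0)).
apply: (le_Rintegral measurableT iFs).
  exact: integrable_scaler (integrable_molli e0).
move=> s _.
have -> : \int[mu]_z F (s, z) = molli e s * flux (\1_E) (fun z => phi (z - s)).
  have [s0|s0] := eqVneq (molli e s) 0.
    rewrite s0 mul0r /Rintegral (_ : (fun z => (F (s, z))%:E) = cst 0%E).
      by rewrite integral0.
    by apply/funext => z; rewrite FE s0 mulr0 mul0r.
  have vs := molli_vcoord e0 s0.
  have [tphis divs] : test_field (fun z => phi (z - s)) /\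
      forall z, divergence (fun z => phi (z - s)) z = divergence phi (z - s).
    by apply: test_field_shift => //; rewrite /vcoord/= oppr_le0 ltW.
  have mfs : measurable_fun setT (fun z => \1_E z * divergence (fun z => phi (z - s)) z).
    apply: measurable_funM; first exact: mI.
    apply: continuous_measurable_ambient; apply: continuous_divergence.
    by have [] := tphis.
  have Es z : \1_E (z + s) * divergence (fun z => phi (z - s)) (z + s) = \1_E (z + s) * f z.
    by rewrite divs addrK fE.
  rewrite /flux -(Rintegral_shift s mfs).
  have -> : \int[mu]_z (\1_E (z + s) * divergence (fun z => phi (z - s)) (z + s)) =
      \int[mu]_z (\1_E (z + s) * f z).
    by apply: eq_Rintegral => z _; exact: Es.
  have iEf : mu.-integrable setT (EFin \o (fun z => \1_E (z + s) * f z)).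
    apply: (@integrable_support _ _ _ (1 * C) r).
    + by apply: measurable_funM => //; exact: (measurable_comp_shift s (mI mE)).
    + by move=> z; rewrite normrM; apply: ler_pM; rewrite ?indic_le1.
    + by move=> z rz; rewrite fr ?mulr0.
  rewrite -(RintegralZl (molli e s) measurableT iEf).
  have gen (a b c : R) : a * b * c = b * (a * c) by ring.
  by apply: eq_Rintegral => z _; rewrite FE [s + z]addrC; exact: gen.
have [->|s0] := eqVneq (molli e s) 0; first by rewrite !mul0r.
apply: ler_wpM2l; first exact: molli_ge0.
have vs := molli_vcoord e0 s0.
have [tphis _] : test_field (fun z => phi (z - s)) /\
    forall z, divergence (fun z => phi (z - s)) z = divergence phi (z - s).
  by apply: test_field_shift => //; rewrite /vcoord/= oppr_le0 ltW.
by have := flux_le_perimeter mE EO tphis; rewrite Ep lee_fin.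
Qed.

(** [D] stands for whichever of [E] and its complement contains [z]: the error only counts the part
    of the cube outside [D], with the mollifier bounded by [(kint e)^-1]. *)
Lemma moll_dist E (D : set V) e z : measurable E -> measurable D -> 0 < e ->
  (forall w, `|\1_E w - \1_E z| = \1_(~` D) w :> R) ->
  `|moll E e z - \1_E z| <= (kint e)^-1 * fine (mu (ball z e `\` D)).
Proof.
move=> mE mD e0 HD; rewrite (mollE e z mE).
have k0 : 0 <= (kint e)^-1 by rewrite invr_ge0 ltW// kint_gt0.
have mB : measurable (ball z e `\` D).
  by apply: measurableD => //; exact: measurable_ambient_ball.
have iE : mu.-integrable setT (EFin \o (fun s => \1_E z * molli e s)).
  exact: integrable_scalel (integrable_molli e0).
have -> : \1_E z = \int[mu]_s (\1_E z * molli e s).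
  by rewrite RintegralZl ?Rintegral_molli ?mulr1//; exact: integrable_molli.
rewrite -RintegralB//; last exact: integrable_moll.
have id : mu.-integrable setT (EFin \o (fun s => \1_E (s + z) * molli e s - \1_E z * molli e s)).
  exact: (integrable_sub (integrable_moll z mE e0) iE).
apply: le_trans (le_normr_Rintegral measurableT id) _.
have iB : mu.-integrable setT (EFin \o (\1_(ball z e `\` D) : V -> R)).
  apply: integrable_indic_lty => //; apply: le_lt_trans (volume_ball_lty z e).
  apply: le_measure; rewrite ?inE//; exact: measurable_ambient_ball.
have iB2 : mu.-integrable setT (EFin \o (fun s => \1_(ball z e `\` D) (s + z) : R)).
  apply: (@integrable_support _ _ _ 1 e).
  - exact: (measurable_comp_shift z (mI mB)).
  - by move=> s; exact: indic_le1.
  - move=> s es; rewrite indicE memNset// => -[+ _].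
    rewrite -ball_normE /ball_/= opprD addrCA subrr addr0 normrN.
    by rewrite ltNge es.
apply: (@le_trans _ _ (\int[mu]_s ((kint e)^-1 * \1_(ball z e `\` D) (s + z)))).
  apply: le_Rintegral => //.
  - by have /integrable_abse := id.
  - exact: integrable_scalel.
  - move=> s _; rewrite -mulrBl normrM HD (ger0_norm (molli_ge0 _ e0)).
    have [es|se] := leP e `|s|.
      by rewrite molli_eq0// mulr0 mulr_ge0// indicE.
    rewrite mulrC ler_pM ?molli_ge0 ?molli_le ?indicE// ler_nat.
    have [sD|sD] := boolP (s + z \in ~` D) => //.
    rewrite (_ : _ \in _ `\` _) // inE; split; last by move: sD; rewrite inE.
    by rewrite -ball_normE /ball_/= opprD addrCA subrr addr0 normrN.
rewrite RintegralZl// (@Rintegral_shift _ _ (\1_(ball z e `\` D)) z); last exact: mI.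
by rewrite Rintegral_indic.
Qed.

Lemma moll_cvg_density E (D : set V) z : measurable E -> measurable D ->
  (forall w, `|\1_E w - \1_E z| = \1_(~` D) w :> R) -> density_point D z ->
  moll E k.+1%:R^-1 z @[k --> \oo] --> (\1_E z : R).
Proof.
move=> mE mD HD dD; apply/cvgrPdist_le => eps eps0.
have kr := kern_rad_gt0; have krn : 0 < kern_rad R n ^+ n.+1 by rewrite exprn_gt0.
(* By [kint_lower], [kint e] is at least [kern_rad ^ n.+1 / 8] times the volume of [ball z e]; this
   ratio converts a proportion of the cube into an error. *)
have d0 : 0 < eps * (kern_rad R n ^+ n.+1 / 8) by rewrite mulr_gt0// divr_gt0.
have [r0 r00 Hr0] := dD _ d0.
have [N] := ltr_add_invr r00; rewrite add0r => Nr0.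
exists N => // k Nk /=; set e := k.+1%:R^-1.
have e0 : 0 < e by rewrite invr_gt0.
have er0 : e < r0.
  by apply: le_lt_trans Nr0; rewrite lef_pV2 ?posrE// ler_nat.
have := Hr0 e; rewrite e0 er0 => /(_ isT).
rewrite volume_ball// -EFinM => H.
have mB : measurable (ball z e `\` D).
  by apply: measurableD => //; exact: measurable_ambient_ball.
have fB : mu (ball z e `\` D) \is a fin_num.
  by rewrite ge0_fin_numE// (le_lt_trans H)// ltry.
rewrite distrC (le_trans (moll_dist mE mD e0 HD))//.
have {}H : fine (mu (ball z e `\` D)) <=
    eps * (kern_rad R n ^+ n.+1 / 8) * (e *+ 2) ^+ n.+1.
  by rewrite -lee_fin fineK.
have k0 := kint_gt0 e0; rewrite mulrC ler_pdivrMr//.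
apply: (le_trans H); rewrite -mulrA ler_pM2l//.
apply: le_trans (kint_lower e0); rewrite -mulrnAr exprMn.
by rewrite mulrAC.
Qed.

Lemma moll_cvg_ae E : measurable E ->
  {ae mu, forall z, moll E k.+1%:R^-1 z @[k --> \oo] --> (\1_E z : R)}.
Proof.
move=> mE; have mEC := measurableC mE.
apply: (negligibleS _ (negligibleU (lebesgue_density mE) (lebesgue_density mEC))).
move=> z /= nz; have [Ez|Ez] := pselect (E z).
  left; split => // dz; apply: nz.
  apply: moll_cvg_density dz => // w; rewrite [X in _ - X]indicE mem_set//.
  rewrite !indicE in_setC; case: (w \in E); rewrite ?subrr ?normr0//.
  by rewrite sub0r normrN normr1.
right; split => // dz; apply: nz.
apply: moll_cvg_density dz => // w; rewrite [X in _ - X]indicE memNset//.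
by rewrite setCK subr0 indicE ger0_norm.
Qed.

End mollification.

(** * Smooth minimum and maximum of two functions *)

Section smooth_max.
Variables (R : realType) (V : normedModType R).
Implicit Types (f g : V -> R).

Lemma smoothV f : smooth f -> (forall z, f z != 0) -> smooth (fun z => (f z)^-1).
Proof.
move=> sf f0; have cV : continuous (fun z => (f z)^-1).
  by move=> z; apply: cvgV; [exact: f0|exact: sf.1].
apply: (@smoothP _ _ _ (fun v z => - (f z)^-1 ^+ 2 * 'D_v f z)) => //.
- move=> v z; have [df _] := smooth_is_derive z v sf.
  split; first exact: (derivableV (f0 z) df).
  have := deriveV (f0 z) df; rewrite exprVn; exact.
- move=> v z; apply: cvgM; last exact: (sf.2 v).2.
  apply: cvgN; apply: (@cvg_comp _ _ _ (fun z => (f z)^-1) (fun y => y ^+ 2)); first exact: cV.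
  exact: exprn_continuous.
Qed.

Definition sabs (d x : R) : R := Num.sqrt (x * x + d * d).

Lemma sabs_gt0 (d x : R) : 0 < d -> 0 < sabs d x.
Proof.
by move=> d0; rewrite sqrtr_gt0 ltr_wpDl ?mulr_gt0// -expr2 sqr_ge0.
Qed.

Lemma is_derive_sabs (d x : R) : 0 < d -> is_derive x 1 (sabs d) (x / sabs d x).
Proof.
move=> d0; have D1 := is_derive_id x (1 : R).
have D2 := is_deriveD (is_deriveM D1 D1) (is_derive_cst (d * d) x (1 : R)).
have y0 : 0 < (id * id + cst (d * d) : R -> R) x.
  by rewrite !fctE ltr_wpDl ?mulr_gt0// -expr2 sqr_ge0.
have := is_derive1_comp (is_derive1_sqrt y0) D2.
congr (is_derive _ _ _ _).
have s0 := sabs_gt0 x d0; rewrite !fctE.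
change ((2 * sabs d x)^-1 * (x * 1 + x * 1 + 0) = x / sabs d x).
by field; rewrite gt_eqF.
Qed.

Lemma continuous_sabs (d : R) : 0 < d -> continuous (sabs d).
Proof.
move=> d0 x; apply/differentiable_continuous/derivable1_diffP.
by have [] := is_derive_sabs x d0.
Qed.

Lemma smooth_sabs (d : R) f : 0 < d -> smooth f -> smooth (sabs d \o f).
Proof.
move=> d0 sf; apply: (smooth_comp1 sf (fun x => is_derive_sabs x d0)).
move=> x; apply: cvgM; first exact: cvg_id.
by apply: cvgV; [rewrite gt_eqF// sabs_gt0|exact: continuous_sabs].
Qed.

Lemma sabs_norm (d x : R) : 0 < d -> `|x| <= sabs d x <= `|x| + d.
Proof.
move=> d0; have nd : 0 <= `|x| + d by rewrite addr_ge0// ltW.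
apply/andP; split; first by rewrite -sqrtr_sqr expr2 ler_wsqrtr// lerDl mulr_ge0// ltW.
rewrite -[leRHS](ger0_norm nd) -sqrtr_sqr ler_wsqrtr//.
have -> : x * x = `|x| * `|x| by rewrite -normrM ger0_norm// -expr2 sqr_ge0.
by have := normr_ge0 x; rewrite expr2; nra.
Qed.

Definition smin (d : R) f g z := 2^-1 * (f z + g z - sabs d (f z - g z)).
Definition smax (d : R) f g z := 2^-1 * (f z + g z + sabs d (f z - g z)).
(** The derivative of [smin] in its first argument and of [smax] in its second. It lies in [0, 1],
    so it can weight a convex combination of fields. *)
Definition sweight (d : R) f g z := 2^-1 * (1 - (f z - g z) / sabs d (f z - g z)).

Lemma sweight_ge0_le1 (d : R) f g z : 0 < d -> 0 <= sweight d f g z <= 1.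
Proof.
move=> d0; have s0 := sabs_gt0 (f z - g z) d0.
have /andP[+ _] := sabs_norm (f z - g z) d0.
rewrite /sweight ler_norml => /andP[H1 H2].
have H3 : (f z - g z) / sabs d (f z - g z) <= 1 by rewrite ler_pdivrMr// mul1r.
have H4 : -1 <= (f z - g z) / sabs d (f z - g z) by rewrite ler_pdivlMr// mulN1r.
move: H3 H4; set q := _ / _; lra.
Qed.

Section smoothness.
Variables (d : R) (f g : V -> R).
Hypotheses (d0 : 0 < d) (sf : smooth f) (sg : smooth g).

Let sS : smooth (fun z => sabs d (f z - g z)).
Proof. exact: (smooth_sabs d0 (smoothB sf sg)). Qed.

Lemma smooth_smin : smooth (smin d f g).
Proof. exact: (smoothZ _ (smoothB (smoothD sf sg) sS)). Qed.

Lemma smooth_smax : smooth (smax d f g).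
Proof. exact: (smoothZ _ (smoothD (smoothD sf sg) sS)). Qed.

Lemma smooth_sweight : smooth (sweight d f g).
Proof.
apply: smoothZ; apply: smoothB; first exact: smooth_cst.
apply: smoothM; first exact: smoothB.
by apply: smoothV => // z; rewrite gt_eqF// sabs_gt0.
Qed.

Let DS v z : is_derive z v (fun z => sabs d (f z - g z))
  ((f z - g z) / sabs d (f z - g z) * ('D_v f z - 'D_v g z)).
Proof.
apply: (@is_derive_comp1 _ _ (fun z => f z - g z) (sabs d)); last exact: is_derive_sabs.
exact: (is_deriveB (smooth_is_derive z v sf) (smooth_is_derive z v sg)).
Qed.

Lemma is_derive_smin v z : is_derive z v (smin d f g)
  (sweight d f g z * 'D_v f z + (1 - sweight d f g z) * 'D_v g z).
Proof.
have D1 := is_deriveD (smooth_is_derive z v sf) (smooth_is_derive z v sg).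
have := is_deriveM (is_derive_cst (2^-1 : R) z v) (is_deriveB D1 (DS v z)).
congr (is_derive _ _ _ _); rewrite /sweight !fctE.
set q := (f z - g z) / _; set a := 'D_v f z; set b := 'D_v g z.
rewrite scaler0 addr0.
change (2^-1 * (a + b - q * (a - b)) = 2^-1 * (1 - q) * a + (1 - 2^-1 * (1 - q)) * b).
by field.
Qed.

Lemma is_derive_smax v z : is_derive z v (smax d f g)
  ((1 - sweight d f g z) * 'D_v f z + sweight d f g z * 'D_v g z).
Proof.
have D1 := is_deriveD (smooth_is_derive z v sf) (smooth_is_derive z v sg).
have := is_deriveM (is_derive_cst (2^-1 : R) z v) (is_deriveD D1 (DS v z)).
congr (is_derive _ _ _ _); rewrite /sweight !fctE.
set q := (f z - g z) / _; set a := 'D_v f z; set b := 'D_v g z.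
rewrite scaler0 addr0.
change (2^-1 * (a + b + q * (a - b)) = (1 - 2^-1 * (1 - q)) * a + 2^-1 * (1 - q) * b).
by field.
Qed.

(* With m = smin, M = smax and p = sweight one has Dm = p Df + (1 - p) Dg and
   DM = (1 - p) Df + p Dg, so that the first order terms cancel. *)
Definition cross (a b : V -> R) z :=
  smin d f g z * a z + smax d f g z * b z
  - f z * (sweight d f g z * a z + (1 - sweight d f g z) * b z)
  - g z * ((1 - sweight d f g z) * a z + sweight d f g z * b z).

Variables (a b : V -> R).
Hypotheses (sa : smooth a) (sb : smooth b).

Let sp := smooth_sweight.
Let sq : smooth (fun z => 1 - sweight d f g z).
Proof. by apply: smoothB; [exact: smooth_cst|exact: sp]. Qed.
Let sA : smooth (fun z => sweight d f g z * a z + (1 - sweight d f g z) * b z).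
Proof. exact: (smoothD (smoothM sp sa) (smoothM sq sb)). Qed.
Let sB : smooth (fun z => (1 - sweight d f g z) * a z + sweight d f g z * b z).
Proof. exact: (smoothD (smoothM sq sa) (smoothM sp sb)). Qed.

Lemma smooth_cross : smooth (cross a b).
Proof.
apply: smoothB; last exact: (smoothM sg sB).
apply: smoothB; last exact: (smoothM sf sA).
exact: (smoothD (smoothM smooth_smin sa) (smoothM smooth_smax sb)).
Qed.

Lemma derive_cross v z : 'D_v (cross a b) z =
  smin d f g z * 'D_v a z + smax d f g z * 'D_v b z
  - f z * 'D_v (fun z => sweight d f g z * a z + (1 - sweight d f g z) * b z) z
  - g z * 'D_v (fun z => (1 - sweight d f g z) * a z + sweight d f g z * b z) z.
Proof.
have D1 := is_deriveD (is_deriveM (is_derive_smin v z) (smooth_is_derive z v sa))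
   (is_deriveM (is_derive_smax v z) (smooth_is_derive z v sb)).
have D2 := is_deriveM (smooth_is_derive z v sf) (smooth_is_derive z v sA).
have D3 := is_deriveM (smooth_is_derive z v sg) (smooth_is_derive z v sB).
have [_ E] := is_deriveB (is_deriveB D1 D2) D3.
apply: etrans E _.
set A := fun z => _ + _; set B := fun z => _ + _; set p := sweight d f g z.
change ((smin d f g z * 'D_v a z + a z * (p * 'D_v f z + (1 - p) * 'D_v g z)
 + (smax d f g z * 'D_v b z + b z * ((1 - p) * 'D_v f z + p * 'D_v g z)))
 - (f z * 'D_v A z + (p * a z + (1 - p) * b z) * 'D_v f z)
 - (g z * 'D_v B z + ((1 - p) * a z + p * b z) * 'D_v g z) =
 smin d f g z * 'D_v a z + smax d f g z * 'D_v b z - f z * 'D_v A z - g z * 'D_v B z).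
by ring.
Qed.

End smoothness.
End smooth_max.

(** * Submodularity of the perimeter *)

Section submodularity.
Variables (R : realType) (n : nat).
Local Notation V := (ambient R n).
Local Notation mu := (@volume R n).
Local Notation Om := (@Omega R n).
Implicit Types (phi psi : V -> V) (z w v s : V) (r e d : R) (E F : set V)
  (f g p : V -> R).

Lemma eucl_norm_le1 z : (eucl_norm z <= 1) =
  (\sum_(i < n) hcoord i z ^+ 2 + vcoord z ^+ 2 <= 1).
Proof. by rewrite /eucl_norm -[X in _ <= X]sqrtr1 ler_sqrt. Qed.

Definition blend p phi psi z : V := p z *: phi z + (1 - p z) *: psi z.

Lemma hcoord_blend p phi psi i z : hcoord i (blend p phi psi z) =
  p z * hcoord i (phi z) + (1 - p z) * hcoord i (psi z).
Proof. by rewrite /blend /hcoord !mxE. Qed.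

Lemma vcoord_blend p phi psi z : vcoord (blend p phi psi z) =
  p z * vcoord (phi z) + (1 - p z) * vcoord (psi z).
Proof. by []. Qed.

Let sqr_convex (t a b : R) : 0 <= t <= 1 ->
  (t * a + (1 - t) * b) ^+ 2 <= t * a ^+ 2 + (1 - t) * b ^+ 2.
Proof.
move=> /andP[t0 t1]; rewrite -subr_ge0.
have -> : t * a ^+ 2 + (1 - t) * b ^+ 2 - (t * a + (1 - t) * b) ^+ 2 =
  t * (1 - t) * (a - b) ^+ 2 by ring.
by rewrite mulr_ge0 ?sqr_ge0// mulr_ge0// subr_ge0.
Qed.

(** The Euclidean unit ball is convex: the squares are compared coordinate by coordinate. *)
Lemma test_blend p phi psi : smooth p -> (forall z, 0 <= p z <= 1) ->
  test_field phi -> test_field psi -> test_field (blend p phi psi).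
Proof.
move=> sp p01 [/C1P[sh sv] /compact_supportP[r [eta [eta0 [Hr He]]]] nphi].
move=> [/C1P[sh' sv'] /compact_supportP[r' [eta' [eta'0 [Hr' He']]]] npsi].
have sq : smooth (fun z => 1 - p z) by apply: smoothB; [exact: smooth_cst|exact: sp].
split.
- apply: C1_of_smooth => [i|].
    rewrite (_ : _ \o _ = (fun z => p z * (hcoord i \o phi) z + (1 - p z) * (hcoord i \o psi) z)).
      exact: (smoothD (smoothM sp (sh i)) (smoothM sq (sh' i))).
    by apply/funext => z; rewrite /= hcoord_blend.
  rewrite (_ : _ \o _ = (fun z => p z * (@vcoord R n \o phi) z + (1 - p z) * (@vcoord R n \o psi) z)); last by [].
  exact: (smoothD (smoothM sp sv) (smoothM sq sv')).
- apply/compact_supportP; exists (Num.max r r'), (Num.min eta eta').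
  split; first by rewrite lt_min eta0.
  split=> z; rewrite ?gt_max ?lt_min => /andP[H1 H2]; rewrite /blend.
    by rewrite Hr// Hr'// !scaler0 addr0.
  by rewrite He// He'// !scaler0 addr0.
- move=> z; have := nphi z; have := npsi z; rewrite !eucl_norm_le1 => H1 H2.
  have /andP[t0 t1] := p01 z; have t1' : 0 <= 1 - p z by rewrite subr_ge0.
  apply: (@le_trans _ _ (p z * (\sum_(i < n) hcoord i (phi z) ^+ 2 + vcoord (phi z) ^+ 2)
     + (1 - p z) * (\sum_(i < n) hcoord i (psi z) ^+ 2 + vcoord (psi z) ^+ 2))).
    rewrite !mulrDr addrACA lerD//; last by rewrite vcoord_blend sqr_convex// t0.
    rewrite !mulr_sumr -big_split/=; apply: ler_sum => i _.
    by rewrite hcoord_blend sqr_convex// t0.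
  apply: (@le_trans _ _ (p z * 1 + (1 - p z) * 1)); last by lra.
  by apply: lerD; apply: ler_wpM2l.
Qed.

Lemma Rintegral_sum0 (I : Type) (s : seq I) (G : I -> V -> R) :
  (forall i, mu.-integrable setT (EFin \o G i) /\ \int[mu]_z G i z = 0) ->
  mu.-integrable setT (EFin \o (fun z => \sum_(i <- s) G i z)) /\
  \int[mu]_z (\sum_(i <- s) G i z) = 0.
Proof.
move=> HG; elim: s => [|i s [IH1 IH2]].
  have -> : (fun z : V => \sum_(i <- [::]) G i z) = cst 0.
    by apply/funext => z; rewrite big_nil.
  by split; [exact: integrable0|rewrite /Rintegral integral0].
have -> : (fun z : V => \sum_(j <- i :: s) G j z) =
    (fun z => G i z + \sum_(j <- s) G j z).
  by apply/funext => z; rewrite big_cons.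
split; first exact: integrable_add (HG i).1 IH1.
by rewrite (RintegralD measurableT (HG i).1 IH1) (HG i).2 IH2 addr0.
Qed.

Section flux_identity.
Variables (d : R) (f g : V -> R).
Hypotheses (d0 : 0 < d) (sf : smooth f) (sg : smooth g).
Hypotheses (f01 : forall z, 0 <= f z <= 1) (g01 : forall z, 0 <= g z <= 1).

Let fg1 z : `|f z - g z| <= 1.
Proof.
by have /andP[? ?] := f01 z; have /andP[? ?] := g01 z; rewrite ler_norml; apply/andP; split; lra.
Qed.

Lemma smin_bound z : `|smin d f g z| <= 2 + d.
Proof.
have /andP[? ?] := f01 z; have /andP[? ?] := g01 z.
have /andP[] := sabs_norm (f z - g z) d0; have := fg1 z; have := normr_ge0 (f z - g z).
by move=> H1 H2 H3 H4; rewrite /smin ler_norml; apply/andP; split; lra.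
Qed.

Lemma smax_bound z : `|smax d f g z| <= 2 + d.
Proof.
have /andP[? ?] := f01 z; have /andP[? ?] := g01 z.
have /andP[] := sabs_norm (f z - g z) d0; have := fg1 z; have := normr_ge0 (f z - g z).
by move=> H1 H2 H3 H4; rewrite /smax ler_norml; apply/andP; split; lra.
Qed.

(** The two sides differ by the integral of the divergence of the field with components [cross],
    which has bounded support. The new fields are convex combinations with weights [sweight] and
    [1 - sweight], hence again test fields. *)
Lemma flux_minmax phi psi : test_field phi -> test_field psi ->
  exists phi' psi', [/\ test_field phi', test_field psi' &
   flux (smin d f g) phi + flux (smax d f g) psi = flux f phi' + flux g psi'].
Proof.
move=> tphi tpsi.
have sp := smooth_sweight d0 sf sg.
set p := sweight d f g in sp.
have p01 z : 0 <= p z <= 1 by exact: sweight_ge0_le1.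
pose q z := 1 - p z.
have sq : smooth q by apply: smoothB; [exact: smooth_cst|exact: sp].
have q01 z : 0 <= q z <= 1 by have /andP[? ?] := p01 z; rewrite /q; apply/andP; split; lra.
have tphi' := test_blend sp p01 tphi tpsi.
have tpsi' := test_blend sq q01 tphi tpsi.
exists (blend p phi psi), (blend q phi psi); split; [exact: tphi'|exact: tpsi'|].
have [Cphi Sphi _] := tphi; have [Cpsi Spsi _] := tpsi.
have [Cphi' Sphi' _] := tphi'; have [Cpsi' Spsi' _] := tpsi'.
have f1 z : `|f z| <= 1 by have /andP[? ?] := f01 z; rewrite ger0_norm.
have g1 z : `|g z| <= 1 by have /andP[? ?] := g01 z; rewrite ger0_norm.
have mf := smooth_measurable sf; have mg := smooth_measurable sg.
have mm := smooth_measurable (smooth_smin d0 sf sg).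
have mM := smooth_measurable (smooth_smax d0 sf sg).
have I1 := integrable_flux mm smin_bound Cphi Sphi.
have I2 := integrable_flux mM smax_bound Cpsi Spsi.
have I3 := integrable_flux mf f1 Cphi' Sphi'.
have I4 := integrable_flux mg g1 Cpsi' Spsi'.
apply/eqP; rewrite -subr_eq0 opprD addrA /flux.
rewrite -(RintegralD measurableT I1 I2).
rewrite -(RintegralB measurableT (integrable_add I1 I2) I3).
rewrite -(RintegralB measurableT (integrable_sub (integrable_add I1 I2) I3) I4).
(* The coordinate directions are indexed by [option 'I_n], with [None] for the vertical one, so that
   one identity treats them all. *)
pose a (o : option 'I_n) := if o is Some i then hcoord i \o phi else @vcoord R n \o phi.
pose b (o : option 'I_n) := if o is Some i then hcoord i \o psi else @vcoord R n \o psi.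
pose D (o : option 'I_n) := if o is Some i then edir R i else vdir R n.
have sa o : smooth (a o).
  by have /C1P[sh sv] := Cphi; case: o => [i|]; [exact: sh|exact: sv].
have sb o : smooth (b o).
  by have /C1P[sh sv] := Cpsi; case: o => [i|]; [exact: sh|exact: sv].
pose W o := cross d f g (a o) (b o).
have sW o : smooth (W o) by exact: (smooth_cross d0 sf sg (sa o) (sb o)).
have /compact_supportP[r [eta [eta0 [Hr _]]]] := Sphi.
have /compact_supportP[r' [eta' [eta'0 [Hr' _]]]] := Spsi.
pose rr := Num.max r r' + 1.
have W0 o z : rr <= `|z| -> W o z = 0.
  move=> rz; have [zr zr'] : r < `|z| /\ r' < `|z|.
    have : Num.max r r' < `|z| by apply: lt_le_trans rz; rewrite /rr ltrDl.
    by rewrite gt_max => /andP[].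
  have a0 : a o z = 0.
    by case: o => [i|] /=; rewrite (Hr _ zr)// /hcoord mxE.
  have b0 : b o z = 0.
    by clear a0; case: o => [i|] /=; rewrite (Hr' _ zr')// /hcoord mxE.
  by rewrite /W /cross a0 b0 !mulr0 !addr0 !mulr0 !subr0.
have HW o : mu.-integrable setT (EFin \o 'D_(D o) (W o)) /\
    \int[mu]_z 'D_(D o) (W o) z = 0.
  split; last exact: (integral_derive0 _ (sW o) (W0 o)).
  have DW0 z : rr + 1 <= `|z| -> 'D_(D o) (W o) z = 0.
    by move=> rz; apply: (derive_support _ (W0 o)); lra.
  have [C _ HC] := bounded_of_support ((sW o).2 (D o)).2 DW0.
  apply: (integrable_support _ HC DW0).
  exact: smooth_derive_measurable.
have [_ E] := Rintegral_sum0 (index_enum (option 'I_n)) HW.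
apply/eqP; rewrite -[RHS]E; apply: eq_Rintegral => z _.
have key o : 'D_(D o) (W o) z =
   smin d f g z * 'D_(D o) (a o) z + smax d f g z * 'D_(D o) (b o) z
  - f z * 'D_(D o) (fun z => p z * a o z + (1 - p z) * b o z) z
  - g z * 'D_(D o) (fun z => (1 - p z) * a o z + p z * b o z) z.
  exact: (derive_cross d0 sf sg (sa o) (sb o)).
have divE (phi1 : V -> V) (c : option 'I_n -> V -> R) :
    (forall i, c (Some i) = hcoord i \o phi1) -> c None = @vcoord R n \o phi1 ->
    divergence phi1 z = \sum_(o : option 'I_n) 'D_(D o) (c o) z.
  move=> H1 H2; rewrite divergenceE (bigD1 None)//= H2 addrC; congr (_ + _).
  rewrite (reindex_omap Some id)/=; last by case.
  by apply: eq_big => [i|i _]; rewrite ?eqxx// H1.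
rewrite (divE phi a)// (divE psi b)//.
rewrite (divE (blend p phi psi) (fun o z => p z * a o z + (1 - p z) * b o z)); last 2 first.
- by move=> i; apply/funext => w; rewrite /= hcoord_blend.
- by apply/funext => w; exact: (esym (vcoord_blend p phi psi w)).
rewrite (divE (blend q phi psi) (fun o z => (1 - p z) * a o z + p z * b o z)); last 2 first.
- by move=> i; apply/funext => w; rewrite /= hcoord_blend /q subKr.
- apply/funext => w; apply: etrans (esym (vcoord_blend q phi psi w)).
  by rewrite /q subKr.
rewrite !mulr_sumr -big_split/= -sumrB -sumrB.
by apply: eq_bigr => o _; rewrite key.
Qed.

End flux_identity.

(** The scale of the smooth minimum and maximum equals that of the mollification, so one limit
    removes both. The limit is identified by writing a minimum or maximum as half of the sum minus
    or plus the absolute difference. *)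
Lemma flux_submodular E F (P Q : R) phi psi : BV_set E -> BV_set F ->
  perimeter E = P%:E -> perimeter F = Q%:E ->
  test_field phi -> test_field psi ->
  flux (\1_(E `&` F)) phi + flux (\1_(E `|` F)) psi <= P + Q.
Proof.
move=> /BV_setP[mE EO _ _] /BV_setP[mF FO _ _] EP FQ tphi tpsi.
pose e k : R := k.+1%:R^-1.
have e0 k : 0 < e k by rewrite invr_gt0.
have e1 k : e k <= 1 by rewrite invf_le1// ler1n.
pose u k := moll E (e k); pose v k := moll F (e k).
have su k : smooth (u k) by exact: smooth_moll.
have sv k : smooth (v k) by exact: smooth_moll.
have u01 k z : 0 <= u k z <= 1 by exact: moll_ge0_le1.
have v01 k z : 0 <= v k z <= 1 by exact: moll_ge0_le1.
have le k : flux (smin (e k) (u k) (v k)) phi + flux (smax (e k) (u k) (v k)) psi <= P + Q.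
  have [phi' [psi' [tphi' tpsi' ->]]] :=
    flux_minmax (e0 k) (su k) (sv k) (u01 k) (v01 k) tphi tpsi.
  by apply: lerD; [exact: (flux_moll_le mE EO (e0 k) EP)|exact: (flux_moll_le mF FO (e0 k) FQ)].
have flux_cvg (w : nat -> V -> R) (w0 : V -> R) chi : (forall k, measurable_fun setT (w k)) ->
    measurable_fun setT w0 -> (forall k z, `|w k z| <= 3) ->
    {ae mu, forall z, w k z @[k --> \oo] --> w0 z} -> test_field chi ->
    flux (w k) chi @[k --> \oo] --> flux w0 chi.
  move=> mw mw0 w3 cw [Cchi Schi _].
  have [r [C [C0 fC fr]]] := divergence_bound Cchi Schi.
  have mdiv : measurable_fun setT (divergence chi).
    by apply: continuous_measurable_ambient; exact: continuous_divergence.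
  apply: (@Rintegral_bigcvg _ V R mu (fun k z => w k z * divergence chi z) _
    (fun z => (3 * C) * \1_(ball (0 : V) r : set V) z)).
  - by move=> k; apply: measurable_funM.
  - by apply: measurable_funM.
  - by apply: filterS cw => z cz; apply: cvgM => //; exact: cvg_cst.
  - by apply: integrable_dominator; rewrite mulr_ge0.
  - move=> k; apply: dominator_bound => z.
      by rewrite normrM; apply: ler_pM.
    by move=> /fr ->; rewrite mulr0.
have cu := moll_cvg_ae mE; have cv := moll_cvg_ae mF.
have ce : e k @[k --> \oo] --> (0 : R) by exact: cvg_harmonic.
have csabs (x : nat -> R) (y : R) : x k @[k --> \oo] --> y ->
    sabs (e k) (x k) @[k --> \oo] --> `|y|.
  move=> xy; have nxy : `|x k| @[k --> \oo] --> `|y| by apply: cvg_norm.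
  apply: (@squeeze_cvgr _ _ _ _ (fun k => `|x k|) (fun k => `|x k| + e k)) => //.
    by apply: nearW => k; exact: sabs_norm.
  by rewrite -[X in _ --> X]addr0; apply: cvgD.
have c1 : flux (smin (e k) (u k) (v k)) phi @[k --> \oo] --> flux (\1_(E `&` F)) phi.
  apply: flux_cvg => //.
  - by move=> k; apply: smooth_measurable; exact: smooth_smin.
  - by apply: measurable_indic; exact: measurableI.
  - move=> k z; apply: le_trans (smin_bound (e0 k) (u01 k) (v01 k) z) _.
    by have := e1 k; lra.
  - apply: filterS2 cu cv => z cuz cvz.
    have -> : \1_(E `&` F) z = 2^-1 * (\1_E z + \1_F z - `|\1_E z - \1_F z|) :> R.
      rewrite !indicE in_setI; case: (z \in E); case: (z \in F) => /=;
        rewrite ?subrr ?subr0 ?sub0r ?normrN ?normr0 ?normr1; lra.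
    apply: cvgM; first exact: cvg_cst.
    apply: cvgB; first exact: cvgD.
    by apply: csabs; apply: cvgB.
have c2 : flux (smax (e k) (u k) (v k)) psi @[k --> \oo] --> flux (\1_(E `|` F)) psi.
  apply: flux_cvg => //.
  - by move=> k; apply: smooth_measurable; exact: smooth_smax.
  - by apply: measurable_indic; exact: measurableU.
  - move=> k z; apply: le_trans (smax_bound (e0 k) (u01 k) (v01 k) z) _.
    by have := e1 k; lra.
  - apply: filterS2 cu cv => z cuz cvz.
    have -> : \1_(E `|` F) z = 2^-1 * (\1_E z + \1_F z + `|\1_E z - \1_F z|) :> R.
      rewrite !indicE in_setU; case: (z \in E); case: (z \in F) => /=;
        rewrite ?subrr ?subr0 ?sub0r ?normrN ?normr0 ?normr1; lra.
    apply: cvgM; first exact: cvg_cst.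
    apply: cvgD; first exact: cvgD.
    by apply: csabs; apply: cvgB.
by apply: (cvgr_to_le (cvgD c1 c2)); apply: nearW => k; exact: le.
Qed.

Theorem perimeter_submodular E F : BV_set E -> BV_set F ->
  [/\ BV_set (E `&` F), BV_set (E `|` F) &
  (perimeter (E `&` F) + perimeter (E `|` F) <= perimeter E + perimeter F)%E].
Proof.
move=> BE BF; have [P P0 EP] := BV_perimeter BE; have [Q Q0 FQ] := BV_perimeter BF.
have /BV_setP[mE EO Eoo _] := BE; have /BV_setP[mF FO Foo _] := BF.
have mI : measurable (E `&` F) by exact: measurableI.
have mU : measurable (E `|` F) by exact: measurableU.
have IO : E `&` F `<=` Om by move=> z [/EO].
have UO : E `|` F `<=` Om by move=> z [/EO|/FO].
have sub := flux_submodular BE BF EP FQ.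
(* The supremum over [phi] is taken with [psi] fixed. The choice [psi = 0] shows that the perimeter
   of the intersection is finite, after which it may be subtracted and the supremum over [psi]
   taken. *)
have H1 psi : test_field psi ->
    (perimeter (E `&` F) <= (P + Q - flux (\1_(E `|` F)) psi)%:E)%E.
  move=> tpsi; apply: perimeter_le => // phi tphi.
  by rewrite lee_fin lerBrDr; exact: sub.
have pI : (perimeter (E `&` F) < +oo)%E.
  by apply: le_lt_trans (H1 _ (test_field0 R n)) _; rewrite ltry.
have BI : BV_set (E `&` F).
  apply/BV_setP; split => //; apply: le_lt_trans Eoo.
  by apply: le_measure; rewrite ?inE.
have [I I0 EI] := BV_perimeter BI.
have H2 : (perimeter (E `|` F) <= (P + Q - I)%:E)%E.
  apply: perimeter_le => // psi /H1; rewrite EI !lee_fin; lra.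
have BU : BV_set (E `|` F).
  apply/BV_setP; split => //.
    by apply: (le_lt_trans (measureU2 _ mE mF)); rewrite lte_add_pinfty.
  by apply: (le_lt_trans H2); rewrite ltry.
split => //; have [U U0 EU] := BV_perimeter BU.
by move: H2; rewrite EI EU EP FQ -!EFinD !lee_fin; lra.
Qed.

End submodularity.

(** * Step functions, cutoffs and vertical fields *)

Section step.
Variable R : realType.
Implicit Types x : R.

Let a x := pospow 1 (2 * x - 1).
Let b x := pospow 1 (2 - 2 * x).

(** A quotient of truncated squares, rising from 0 at [1 / 2] to 1 at [1]. The two truncated linear
    terms add up to at least 1, so the denominator never vanishes and the quotient is of class
    C^1. *)
Definition step x : R :=
  pospow 2 (2 * x - 1) / (pospow 2 (2 * x - 1) + pospow 2 (2 - 2 * x)).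

Definition dstep x : R :=
  4 * a x * b x * (a x + b x) / (a x ^+ 2 + b x ^+ 2) ^+ 2.

Let p2 x : pospow 2 x = pospow 1 x ^+ 2.
Proof. by rewrite /pospow expr1. Qed.

Let a_ge0 x : 0 <= a x. Proof. exact: pospow_ge0. Qed.
Let b_ge0 x : 0 <= b x. Proof. exact: pospow_ge0. Qed.

Let ab1 x : 1 <= a x + b x.
Proof.
rewrite /a /b /pospow !expr1.
have H1 : 2 * x - 1 <= Num.max (2 * x - 1) 0 by rewrite le_max lexx.
have H2 : 2 - 2 * x <= Num.max (2 - 2 * x) 0 by rewrite le_max lexx.
by lra.
Qed.

Let den x : 1 / 2 <= a x ^+ 2 + b x ^+ 2.
Proof. have := ab1 x; have := sqr_ge0 (a x - b x); rewrite !expr2; nra. Qed.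

Let den_gt0 x : 0 < a x ^+ 2 + b x ^+ 2.
Proof. by apply: lt_le_trans (den x); lra. Qed.

Lemma step_le0 x : x <= 1 / 2 -> step x = 0.
Proof. by move=> x2; rewrite /step pospow_le0 ?mul0r//; lra. Qed.

Lemma step_ge1 x : 1 <= x -> step x = 1.
Proof.
move=> x1; rewrite /step (@pospow_le0 _ 1 (2 - 2 * x)) ?addr0; last by lra.
rewrite divff; first exact: erefl.
by rewrite pospow_gt0E; [rewrite expf_neq0// gt_eqF|]; lra.
Qed.

Lemma step_ge0_le1 x : 0 <= step x <= 1.
Proof.
rewrite /step !p2 divr_ge0 ?sqr_ge0 ?addr_ge0 ?sqr_ge0//=.
by rewrite ler_pdivrMr ?den_gt0// mul1r lerDl sqr_ge0.
Qed.

Lemma is_derive_step x : is_derive x 1 step (dstep x).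
Proof.
have D1 : is_derive x 1 (fun y : R => 2 * y - 1) 2.
  have := is_deriveB (is_deriveM (is_derive_cst (2:R) x (1:R)) (is_derive_id x (1:R)))
    (is_derive_cst (1:R) x (1:R)).
  by congr (is_derive _ _ _ _); rewrite /= !subr0 scaler0 addr0 [_ *: 1]mulr1.
have D2 : is_derive x 1 (fun y : R => 2 - 2 * y) (- 2).
  have := is_deriveB (is_derive_cst (2:R) x (1:R))
    (is_deriveM (is_derive_cst (2:R) x (1:R)) (is_derive_id x (1:R))).
  by congr (is_derive _ _ _ _); rewrite /= sub0r scaler0 addr0 [_ *: 1]mulr1.
have DN := is_derive_comp1 D1 (is_derive_pospow 0 _).
have DM := is_derive_comp1 D2 (is_derive_pospow 0 _).
have DD := is_deriveD DN DM.
have d0 : ((pospow 2 \o (fun y => 2 * y - 1)) + (pospow 2 \o (fun y => 2 - 2 * y))) x != 0.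
  by rewrite fctE /= !p2 gt_eqF// den_gt0.
have := is_deriveM DN (is_deriveV d0 DD).
congr (is_derive _ _ _ _).
have dd := den_gt0 x; rewrite !fctE /= !p2 -/(a x) -/(b x) /dstep.
change (a x ^+ 2 * (- (a x ^+ 2 + b x ^+ 2) ^- 2 * (2 * a x * 2 + 2 * b x * (- 2))) +
  (a x ^+ 2 + b x ^+ 2)^-1 * (2 * a x * 2) =
  4 * a x * b x * (a x + b x) / (a x ^+ 2 + b x ^+ 2) ^+ 2).
by field; rewrite gt_eqF.
Qed.

Lemma continuous_dstep : continuous dstep.
Proof.
have ca : continuous a.
  move=> x; apply: (@continuous_comp _ _ _ (fun x => 2 * x - 1) (pospow 1)).
    by apply: cvgB; [apply: cvgM; [exact: cvg_cst|exact: cvg_id]|exact: cvg_cst].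
  exact: continuous_pospow.
have cb : continuous b.
  move=> x; apply: (@continuous_comp _ _ _ (fun x => 2 - 2 * x) (pospow 1)).
    by apply: cvgB; [exact: cvg_cst|apply: cvgM; [exact: cvg_cst|exact: cvg_id]].
  exact: continuous_pospow.
have cden : continuous (fun x => a x ^+ 2 + b x ^+ 2).
  move=> x; apply: cvgD.
    apply: (@cvg_comp _ _ _ a (fun y => y ^+ 2)); [exact: ca|exact: exprn_continuous].
  apply: (@cvg_comp _ _ _ b (fun y => y ^+ 2)); [exact: cb|exact: exprn_continuous].
move=> x; apply: cvgM; last first.
  apply: cvgV; first by rewrite expf_neq0// gt_eqF// den_gt0.
  apply: (@cvg_comp _ _ _ (fun x => a x ^+ 2 + b x ^+ 2) (fun y => y ^+ 2)).
    exact: cden.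
  exact: exprn_continuous.
apply: cvgM; last by apply: cvgD; [exact: ca|exact: cb].
apply: cvgM; last exact: cb.
by apply: cvgM; [exact: cvg_cst|exact: ca].
Qed.

Lemma dstep_ge0 x : 0 <= dstep x.
Proof.
rewrite /dstep divr_ge0 ?sqr_ge0// mulr_ge0 ?addr_ge0//.
by rewrite mulr_ge0// mulr_ge0.
Qed.

Lemma dstep_outside x : x <= 1 / 2 \/ 1 <= x -> dstep x = 0.
Proof.
move=> [H|H]; rewrite /dstep.
  by rewrite /a pospow_le0 ?mulr0 ?mul0r//; lra.
by rewrite /b (@pospow_le0 _ 0 (2 - 2 * x)) ?mulr0 ?mul0r//; lra.
Qed.

Lemma dstep_le x : dstep x <= 4.
Proof.
have [H|H] := pselect (x <= 1 / 2 \/ 1 <= x).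
  by rewrite dstep_outside.
have [H1 H2] : 1 / 2 < x /\ x < 1.
  by split; rewrite ltNge; apply/negP => Hx; apply: H; [left|right].
have ab : a x + b x = 1.
  by rewrite /a /b !pospow_gt0E ?expr1; lra.
rewrite /dstep ab mulr1 ler_pdivrMr ?exprn_gt0 ?den_gt0//.
have := den x; have := a_ge0 x; have := b_ge0 x.
set A := a x in ab *; set B := b x in ab *; move=> B0 A0 dn.
have D2 : 1 / 4 <= (A ^+ 2 + B ^+ 2) ^+ 2 by rewrite [X in _ <= X]expr2; nra.
by apply: (@le_trans _ _ 1); [nra|lra].
Qed.

End step.

Section cutoffs.
Variables (R : realType) (n : nat).
Local Notation V := (ambient R n).
Local Notation mu := (@volume R n).
Local Notation Om := (@Omega R n).
Local Notation vd := (vdir R n).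
Implicit Types (phi psi : V -> V) (z w v : V) (r eta : R).

Definition vstep eta z : R := step (eta^-1 * vcoord z).
Definition dvstep eta z : R := eta^-1 * dstep (eta^-1 * vcoord z).

Lemma smooth_vstep eta : smooth (vstep eta).
Proof.
apply: (smooth_comp1 (smoothZ eta^-1 (smooth_vcoord R n)) (@is_derive_step R)).
exact: continuous_dstep.
Qed.

Lemma is_derive_vstep eta z : is_derive z vd (vstep eta) (dvstep eta z).
Proof.
have H : is_derive z vd (fun z => eta^-1 * vcoord z) eta^-1.
  have := is_deriveM (is_derive_cst eta^-1 z vd)
     (linear_is_derive z vd (@vcoord_linear R n)).
  by congr (is_derive _ _ _ _); rewrite scaler0 addr0 /vcoord/= [_ *: 1]mulr1.
by have := is_derive_comp1 H (is_derive_step _); rewrite mulrC.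
Qed.

Lemma vstep_ge0_le1 eta z : 0 <= vstep eta z <= 1.
Proof. exact: step_ge0_le1. Qed.

Lemma vstep0 eta z : 0 < eta -> vcoord z <= eta / 2 -> vstep eta z = 0.
Proof.
by move=> e0 H; apply: step_le0; rewrite mulrC ler_pdivrMr// mulrC mul1r.
Qed.

Lemma vstep1 eta z : 0 < eta -> eta <= vcoord z -> vstep eta z = 1.
Proof.
by move=> e0 H; apply: step_ge1; rewrite mulrC ler_pdivlMr// mul1r.
Qed.

Lemma continuous_dvstep eta : continuous (dvstep eta).
Proof.
move=> z; apply: cvgM; first exact: cvg_cst.
apply: (@cvg_comp _ _ _ (fun z => eta^-1 * vcoord z) (@dstep R)); last exact: continuous_dstep.
by apply: cvgM; [exact: cvg_cst|exact: vcoord_continuous].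
Qed.

Lemma dvstep_bound eta z : 0 < eta -> 0 <= dvstep eta z <= 4 / eta.
Proof.
move=> e0; have ei : 0 <= eta^-1 by rewrite invr_ge0 ltW.
rewrite /dvstep mulr_ge0 ?dstep_ge0//= [4 / eta]mulrC.
by apply: ler_wpM2l => //; exact: dstep_le.
Qed.

(** A function of the horizontal variable alone, so that it acts as a constant for vertical
    derivatives. The parameter [r] bounds the squared norm on its support. *)
Definition hcut r z : R := 1 - step (r^-1 * \sum_(i < n) hcoord i z * hcoord i z).

Lemma smooth_hcut r : smooth (hcut r).
Proof.
apply: smoothB; first exact: smooth_cst.
apply: (smooth_comp1 _ (@is_derive_step R)); last exact: continuous_dstep.
by apply: smoothZ; apply: smooth_sum => i; apply: smoothM; exact: smooth_hcoord.
Qed.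

Lemma hcut_ge0_le1 r z : 0 <= hcut r z <= 1.
Proof.
have /andP[H1 H2] := step_ge0_le1 (r^-1 * \sum_(i < n) hcoord i z * hcoord i z).
by rewrite /hcut; apply/andP; split; lra.
Qed.

Lemma hcut1 r z : 0 < r -> \sum_(i < n) hcoord i z * hcoord i z <= r / 2 ->
  hcut r z = 1.
Proof.
move=> r0 H; rewrite /hcut step_le0 ?subr0//.
by rewrite mulrC ler_pdivrMr// mulrC mul1r.
Qed.

(** The bound is [Num.max r 1] because a coordinate of absolute value at least both has square at
    least [r]. *)
Lemma hcut0 r z i : 0 < r -> Num.max r 1 <= `|hcoord i z| -> hcut r z = 0.
Proof.
move=> r0; rewrite ge_max => /andP[H1 H2].
rewrite /hcut step_ge1 ?subrr// mulrC ler_pdivlMr// mul1r (bigD1 i)//=.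
apply: (@le_trans _ _ (hcoord i z * hcoord i z)); last first.
  by rewrite lerDl; apply: sumr_ge0 => j _; exact: sqr_ge0.
rewrite -[X in _ <= X]ger0_norm; last exact: sqr_ge0.
by rewrite normrM; nra.
Qed.

Lemma is_derive_hcut r z : is_derive z vd (hcut r) 0.
Proof.
apply/is_derive_line.
rewrite (_ : (fun t => _) = cst (hcut r z)); first exact: is_derive_cst.
apply/funext => t; rewrite /hcut /=; congr (1 - step (_ * _)).
by apply: eq_bigr => i _; rewrite !hcoord_linear /hcoord/= !mxE mulr0 add0r.
Qed.

Definition add_vertical phi (s : V -> R) z : V := phi z + (0, s z).

(** At each point at most one of the two fields is nonzero, so their sum keeps norm at most 1. *)
Lemma add_verticalP phi (s : V -> R) (r eta : R) : test_field phi -> smooth s ->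
  (forall z, `|s z| <= 1) -> (forall z, phi z = 0 \/ s z = 0) ->
  0 < eta -> (forall z, r < `|z| -> s z = 0) ->
  (forall z, vcoord z < eta -> s z = 0) ->
  test_field (add_vertical phi s) /\
  forall z, divergence (add_vertical phi s) z = divergence phi z + 'D_vd s z.
Proof.
move=> [Cphi Sphi nphi] ss s1 dis eta0 sr se.
have [sh sv] : (forall i, smooth (@hcoord R n i \o phi)) /\ smooth (@vcoord R n \o phi).
  exact/C1P.
have /compact_supportP[r' [eta' [eta'0 [Hr He]]]] := Sphi.
have hE i : hcoord i \o add_vertical phi s = hcoord i \o phi.
  by apply/funext => z; rewrite /hcoord /= !mxE addr0.
have vE : @vcoord R n \o add_vertical phi s = (fun z => (@vcoord R n \o phi) z + s z).
  by [].
split; first split.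
- apply: C1_of_smooth => [i|]; first by rewrite hE.
  by rewrite vE; exact: smoothD.
- apply/compact_supportP; exists (Num.max r r'), (Num.min eta eta').
  split; first by rewrite lt_min eta0.
  split=> z; rewrite ?gt_max ?lt_min => /andP[H1 H2]; rewrite /add_vertical.
    by rewrite sr// Hr// add0r.
  by rewrite se// He// add0r.
- move=> z; rewrite /add_vertical; have [->|->] := dis z.
    by rewrite add0r eucl_norm_vertical.
  by rewrite (_ : (0, 0) = 0 :> V)// addr0.
- move=> z; rewrite !divergenceE vE -addrA; congr (_ + _).
    by apply: eq_bigr => i _; rewrite hE.
  have [_ ->//] := is_deriveD (smooth_is_derive z vd sv) (smooth_is_derive z vd ss).
Qed.

End cutoffs.

(** * Lower limits, and variation along a line *)

Section fatou_tools.
Variable R : realType.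

Lemma le_limn_einf (u v : (\bar R)^nat) : (forall k, u k <= v k)%E ->
  (limn_einf u <= limn_einf v)%E.
Proof.
move=> uv; rewrite !limn_einf_lim; apply: lee_lim.
- exact: is_cvg_einfs.
- exact: is_cvg_einfs.
- apply: nearW => k; rewrite /einfs; apply: le_ereal_inf_tmp => _ [j kj <-].
  by apply: ge_ereal_inf; exists (u j) => //; exists j.
Qed.

End fatou_tools.

Section one_dim.
Variable R : realType.
Implicit Types (f df : R -> R) (a b t : R).

Lemma integral_derivative f df s t : (forall x : R, is_derive x 1 f (df x)) ->
  continuous df -> s < t ->
  (\int[lebesgue_measure]_(x in `[s, t]) (df x)%:E = (f t - f s)%:E)%E.
Proof.
move=> Df cdf st.
have cf : continuous f.
  move=> x; apply/differentiable_continuous/derivable1_diffP.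
  by have [] := Df x.
rewrite EFinB; apply: continuous_FTC2 => //.
- exact: continuous_subspaceT.
- split=> //.
  + by apply: cvg_at_right_filter; exact: cf.
  + by apply: cvg_at_left_filter; exact: cf.
- by move=> x _; rewrite derive1E; have [_ ->] := Df x.
Qed.

(** The weight [w] is integrated over the whole line but dominates the derivative only on [[a, b]]:
    it will be a cutoff times the absolute derivative. *)
Lemma variation_le_integral f df a b (w : R -> R) s t :
  (forall x : R, is_derive x 1 f (df x)) -> continuous df ->
  measurable_fun setT w ->
  (forall x, a <= x <= b -> `|df x| <= w x) -> (forall x, 0 <= w x) ->
  a <= s <= b -> a <= t <= b ->
  (`|f s - f t|%:E <= \int[lebesgue_measure]_x (w x)%:E)%E.
Proof.
move=> Df cdf mw dfw w0.
wlog st : s t / s <= t.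
  move=> H sab tab; have [st|/ltW ts] := leP s t; first exact: H.
  by rewrite distrC; exact: H.
move=> /andP[as_ sb] /andP[at_ tb].
move: st; rewrite le_eqVlt => /predU1P[->|st].
  by rewrite subrr normr0; apply: integral_ge0 => x _; rewrite lee_fin.
have FTC := integral_derivative Df cdf st.
have mdf : measurable_fun `[s, t] df.
  by apply: measurable_funTS; exact: continuous_measurable_fun.
have -> : (`|f s - f t|%:E = `| \int[lebesgue_measure]_(x in `[s, t]) (df x)%:E |)%E.
  by rewrite FTC /= distrC.
apply: (@le_trans _ _ (\int[lebesgue_measure]_(x in `[s, t]) `|(df x)%:E|)%E).
  by apply: le_abse_integral => //; exact/measurable_EFinP.
apply: (@le_trans _ _ (\int[lebesgue_measure]_(x in `[s, t]) (w x)%:E)%E).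
  apply: ge0_le_integral => //.
  - by apply: measurableT_comp => //; exact/measurable_EFinP.
  - by apply/measurable_EFinP; exact: measurable_funTS.
  - move=> x /=; rewrite in_itv/= => /andP[sx xt].
    by rewrite lee_fin dfw// (le_trans as_ sx) (le_trans xt tb).
apply: ge0_subset_integral => //.
- exact/measurable_EFinP.
- by move=> x _; rewrite lee_fin.
Qed.

End one_dim.

(** * Vertical slices and the measure of mixed segments *)

Section slices.
Variables (R : realType) (n : nat).
Local Notation V := (ambient R n).
Local Notation mu := (@volume R n).
Local Notation Om := (@Omega R n).
Local Notation vd := (vdir R n).
Local Notation lam := (@lebesgue_measure R).
Implicit Types (phi psi : V -> V) (z w v : V) (r eta a b : R) (E A : set V).

Definition strip a b : set V := [set z | a < vcoord z < b].

Definition slice A (y : 'rV[R]_n) : \bar R := lam (xsection A y).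

Lemma measurable_strip a b : measurable (strip a b).
Proof.
apply: open_measurable_ambient.
rewrite (_ : strip a b = @vcoord R n @^-1` `]a, b[%classic).
  by apply: open_comp; [move=> z _; exact: vcoord_continuous|exact: interval_open].
by apply/seteqP; split => z /=; rewrite in_itv.
Qed.

Lemma measurable_slice A : measurable A -> measurable_fun setT (slice A).
Proof. by move=> mA; exact: (measurable_fun_xsection lam mA). Qed.

Lemma slice_ge0 A y : (0 <= slice A y)%E. Proof. exact: measure_ge0. Qed.

Lemma le_slice A B y : measurable A -> measurable B -> A `<=` B ->
  (slice A y <= slice B y)%E.
Proof.
move=> mA mB AB; apply: le_measure; rewrite ?inE; [exact: measurable_xsection|
  exact: measurable_xsection|exact: le_xsection].
Qed.

Lemma slice_pos_point A N y : measurable A -> measurable N ->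
  (0 < slice A y)%E -> slice N y = 0%E -> exists t, A (y, t) /\ ~ N (y, t).
Proof.
move=> mA mN A0 N0; apply: contrapT => /forallNP H.
suff : (slice A y <= slice N y)%E by rewrite N0 leNgt A0.
apply: le_measure; rewrite ?inE; [exact: measurable_xsection|exact: measurable_xsection|].
move=> t; rewrite !xsectionE /= => At; apply: contrapT => Nt; exact: (H t).
Qed.

Lemma volume_slice A : measurable A -> mu A = (\int[leb R n]_y slice A y)%E.
Proof. by []. Qed.

Lemma slice_null A : measurable A -> mu A = 0%E ->
  exists Y : set 'rV[R]_n, [/\ measurable Y, leb R n (~` Y) = 0%E &
    forall y, Y y -> slice A y = 0%E].
Proof.
move=> mA A0; have mS := measurable_slice mA.
exists (slice A @^-1` [set 0%E]); split; last by [].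
- by rewrite -[X in measurable X]setTI; exact: mS.
- have : (\int[leb R n]_y `|slice A y| = 0)%E.
    by rewrite -A0 volume_slice//; apply: eq_integral => y _; rewrite gee0_abs// slice_ge0.
  move=> /(ae_eq_integral_abs _ measurableT mS)[B [mB B0 BS]].
  apply: (subset_measure0 _ mB _ B0).
    by apply: measurableC; rewrite -[X in measurable X]setTI; exact: mS.
  by move=> y /= Ay; apply: BS => /= /(_ I).
Qed.

Definition mixed E a b : set 'rV[R]_n :=
  [set y | (0 < slice (strip a b `&` E) y)%E /\ (0 < slice (strip a b `\` E) y)%E].

Lemma measurable_mixed E a b : measurable E -> measurable (mixed E a b).
Proof.
move=> mE; have mW := measurable_strip a b.
have pos A : measurable A -> measurable [set y | (0 < slice A y)%E].
  move=> mA; rewrite -[X in measurable X]setTI.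
  by apply: emeasurable_fun_o_infty => //; exact: measurable_slice.
apply: measurableI; apply: pos; first exact: measurableI.
exact: measurableD.
Qed.

Lemma flux_moll_cvg E phi : measurable E -> test_field phi ->
  flux (moll E k.+1%:R^-1) phi @[k --> \oo] --> flux (\1_E) phi.
Proof.
move=> mE [Cphi Sphi _].
have [r [C [C0 fC fr]]] := divergence_bound Cphi Sphi.
have mdiv : measurable_fun setT (divergence phi).
  by apply: continuous_measurable_ambient; exact: continuous_divergence.
have mm k : measurable_fun setT (moll E k.+1%:R^-1).
  by apply: smooth_measurable; apply: smooth_moll => //; rewrite invr_gt0.
have mI : measurable_fun setT (\1_E : V -> R) by exact: measurable_indic.
apply: (@Rintegral_bigcvg _ V R mu (fun k z => moll E k.+1%:R^-1 z * divergence phi z) _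
  (fun z => (1 * C) * \1_(ball (0 : V) r : set V) z)).
- by move=> k; apply: measurable_funM.
- by apply: measurable_funM.
- by apply: filterS (moll_cvg_ae mE) => z cz; apply: cvgM => //; exact: cvg_cst.
- by apply: integrable_dominator; rewrite mulr_ge0.
- move=> k; apply: dominator_bound => z.
    rewrite normrM; apply: ler_pM => //.
    have k0 : 0 < k.+1%:R^-1 :> R by rewrite invr_gt0.
    by have /andP[? ?] := moll_ge0_le1 z mE k0; rewrite ger0_norm.
  by move=> /fr ->; rewrite mulr0.
Qed.

Lemma continuous_vertical (f : V -> R) y : continuous f ->
  continuous (fun t : R => f (y, t)).
Proof.
move=> cf t; apply: (@cvg_comp _ _ _ (fun t : R => (y, t) : V) f _ (nbhs ((y, t) : V))).
  apply: (@cvg_ambient R n R (nbhs t)) => [i|]; last exact: cvg_id.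
  exact: (@cvg_cst _ (y ord0 i) _ (nbhs t) _).
exact: cf.
Qed.

Lemma is_derive_vertical (f df : V -> R) y (t : R) :
  (forall z, is_derive z vd f (df z)) ->
  is_derive t 1 (fun t : R => f (y, t)) (df (y, t)).
Proof.
move=> Df; have := Df (t *: vd + ((y, 0) : V)); move=> /is_derive_lineE.
have E0 s : s *: vd + ((y, 0) : V) = (y, s).
  by apply/pair_equal_spec; split => /=; [rewrite scaler0 add0r|rewrite addr0; exact: mulr1].
rewrite E0; rewrite (_ : (fun _ => _) = (fun t => f (y, t)))//.
by apply/funext => s; rewrite E0.
Qed.

(** With [a] the absolute value of [x] and [S = sabs d x], this bounds by [d] the loss in replacing
    the sign of [x] by the smooth quotient [x / S]. *)
Lemma mulrB_le_sqr (a d S : R) : 0 <= a -> 0 <= d -> 0 < S -> S <= a + d ->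
  (a - d) * S <= a * a.
Proof.
move=> a0 d0 S0 Sad; have [ad|da] := leP a d.
  by apply: (@le_trans _ _ 0); [rewrite mulr_le0_ge0 ?subr_le0// ltW|rewrite mulr_ge0].
apply: (@le_trans _ _ ((a - d) * (a + d))).
  by rewrite ler_pM2l ?subr_gt0.
by rewrite -subr_sqr !expr2 gerBl mulr_ge0.
Qed.

(** Fills the room left under a field that vanishes below height [2 * eta]; for large [r] it equals
    1 at heights in [[a, eta]]. *)
Definition window r a eta z : R := hcut r z * (vstep a z * (1 - vstep (2 * eta) z)).

Lemma smooth_window r a eta : smooth (@window r a eta).
Proof.
apply: smoothM; first exact: smooth_hcut.
apply: smoothM; first exact: smooth_vstep.
by apply: smoothB; [exact: smooth_cst|exact: smooth_vstep].
Qed.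

Lemma mulr_itv01 (x y : R) : 0 <= x <= 1 -> 0 <= y <= 1 -> 0 <= x * y <= 1.
Proof. by move=> /andP[x0 x1] /andP[y0 y1]; rewrite mulr_ge0// mulr_ile1. Qed.

Lemma window_ge0_le1 r a eta z : 0 <= window r a eta z <= 1.
Proof.
apply: mulr_itv01; first exact: hcut_ge0_le1.
apply: mulr_itv01; first exact: vstep_ge0_le1.
have /andP[b0 b1] := vstep_ge0_le1 (2 * eta) z; apply/andP; split; lra.
Qed.

Lemma window_eq0 r a eta z : 0 < r -> 0 < a -> 0 < eta ->
  [\/ Num.max (Num.max r 1) (2 * eta) < `|z|, vcoord z < a / 2 | 2 * eta <= vcoord z] ->
  window r a eta z = 0.
Proof.
move=> r0 a0 e0 [zr|za|ze].
- have [H|/existsNP[i /negP Hi]] := pselect (forall i, `|hcoord i z| < Num.max r 1); last first.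
    by rewrite /window (hcut0 (i := i) r0) ?mul0r// leNgt.
  have [ze|ze] := leP (2 * eta) (vcoord z).
    by rewrite /window (vstep1 _ ze) ?subrr ?mulr0// mulr_gt0.
  have [zv|zv] := leP (vcoord z) 0.
    by rewrite /window (@vstep0 _ _ a)// ?mul0r ?mulr0// (le_trans zv)// divr_ge0// ltW.
  exfalso; move: zr; apply/negP; rewrite -leNgt; apply: norm_ambient_le.
  + by rewrite le_max le_max ler01 !orbT.
  + by move=> i; rewrite le_max ltW.
  + by rewrite gtr0_norm// le_max (ltW ze) orbT.
- by rewrite /window (@vstep0 _ _ a)// ?mul0r ?mulr0// ltW.
- by rewrite /window (vstep1 _ ze) ?subrr ?mulr0// mulr_gt0.
Qed.

Lemma window_eq1 r a eta z : 0 < r -> 0 < a -> 0 < eta ->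
  \sum_(i < n) hcoord i z * hcoord i z <= r / 2 -> a <= vcoord z <= eta ->
  window r a eta z = 1.
Proof.
move=> r0 a0 e0 Hz /andP[az ze].
rewrite /window hcut1// vstep1// (@vstep0 _ _ (2 * eta)) ?mulr_gt0//; first by rewrite subr0 !mulr1.
by rewrite mulrC mulKf.
Qed.

Lemma window_integrable r a eta (g : V -> R) : 0 < r -> 0 < a -> 0 < eta ->
  continuous g -> mu.-integrable setT (EFin \o (fun z => window r a eta z * g z)).
Proof.
move=> r0 a0 e0 cg.
pose rr := Num.max (Num.max r 1) (2 * eta) + 1.
have w0 z : rr <= `|z| -> window r a eta z * g z = 0.
  move=> rz; rewrite window_eq0 ?mul0r//; apply: Or31.
  by apply: lt_le_trans rz; rewrite /rr ltrDl.
have cwg : continuous (fun z => window r a eta z * g z).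
  by move=> z; apply: cvgM; [exact: (smooth_window r a eta).1|exact: cg].
have [C _ HC] := bounded_of_support cwg w0.
by apply: (integrable_support _ HC w0); exact: continuous_measurable_ambient.
Qed.

(** The field [phi] is completed by a vertical field close to minus the sign of the vertical
    derivative of the mollified indicator. Integration by parts turns its flux into the weighted
    vertical variation, and the total flux is still at most [P]. *)
Lemma window_variation E e r a eta phi (P : R) : measurable E -> E `<=` Om ->
  perimeter E = P%:E -> 0 < e -> 0 < r -> 0 < a -> 0 < eta ->
  test_field phi -> (forall z, vcoord z < 2 * eta -> phi z = 0) ->
  \int[mu]_z (window r a eta z * `|'D_vd (moll E e) z|) <= P - flux (moll E e) phi.
Proof.
move=> mE EO EP e0 r0 a0 eta0 tphi phi0.
set u := moll E e; have su : smooth u by exact: smooth_moll.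
have sD : smooth ('D_vd u) by exact: smooth_derive_moll.
set w := window r a eta; have sw : smooth w by exact: smooth_window.
have w01 z : 0 <= w z <= 1 by exact: window_ge0_le1.
have iw (g : V -> R) : continuous g -> mu.-integrable setT (EFin \o (fun z => w z * g z)).
  by move=> cg; exact: window_integrable.
have cnD : continuous (fun z => `|'D_vd u z|).
  by move=> z; apply: cvg_norm; exact: sD.1.
have key d : 0 < d ->
    \int[mu]_z (w z * `|'D_vd u z|) <= P - flux u phi + d * \int[mu]_z (w z * 1).
  move=> d0.
  have sS : smooth (sabs d \o 'D_vd u) by exact: smooth_sabs.
  have S0 z : sabs d ('D_vd u z) != 0 by rewrite gt_eqF// sabs_gt0.
  have sq : smooth (fun z => 'D_vd u z / sabs d ('D_vd u z)).
    by apply: smoothM; [exact: sD|exact: smoothV].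
  (* Minus [w] times a smooth substitute for the sign of the derivative. The substitute costs at
     most [d] per unit of [w], and [d] tends to 0 at the end. *)
  pose s z := - (w z * ('D_vd u z / sabs d ('D_vd u z))).
  have ss : smooth s by apply: smoothN; exact: smoothM.
  have q1 z : `|'D_vd u z / sabs d ('D_vd u z)| <= 1.
    have sz := sabs_gt0 ('D_vd u z) d0.
    rewrite normrM normfV (gtr0_norm sz) ler_pdivrMr// mul1r.
    by have /andP[] := sabs_norm ('D_vd u z) d0.
  have s1 z : `|s z| <= 1.
    rewrite normrN normrM; have /andP[wz0 wz1] := w01 z.
    by rewrite (ger0_norm wz0) mulr_ile1.
  have s0 z : w z = 0 -> s z = 0 by move=> wz; rewrite /s wz mul0r oppr0.
  have dis z : phi z = 0 \/ s z = 0.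
    have [ze|ze] := ltP (vcoord z) (2 * eta); first by left; exact: phi0.
    by right; apply: s0; apply: window_eq0 => //; exact: Or33.
  have sr z : Num.max (Num.max r 1) (2 * eta) < `|z| -> s z = 0.
    by move=> zr; apply: s0; apply: window_eq0 => //; exact: Or31.
  have se z : vcoord z < a / 2 -> s z = 0.
    by move=> za; apply: s0; apply: window_eq0 => //; exact: Or32.
  have a20 : 0 < a / 2 by rewrite divr_gt0.
  have [tpsi divpsi] := add_verticalP tphi ss s1 dis a20 sr se.
  have le1 := flux_moll_le mE EO e0 EP tpsi.
  have u1 z : `|u z| <= 1.
    by have /andP[? ?] := moll_ge0_le1 z mE e0; rewrite ger0_norm.
  have [Cphi Sphi _] := tphi.
  have iphi := integrable_flux (smooth_measurable su) u1 Cphi Sphi.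
  pose rr := Num.max (Num.max r 1) (2 * eta) + 1.
  have sr' z : rr <= `|z| -> s z = 0.
    by move=> rz; apply: sr; apply: lt_le_trans rz; rewrite /rr ltrDl.
  have sDr z : rr + 1 <= `|z| -> 'D_vd s z = 0.
    by move=> rz; apply: (derive_support _ sr'); lra.
  have iuDs : mu.-integrable setT (EFin \o (fun z => u z * 'D_vd s z)).
    have [C C0 HC] := bounded_of_support (ss.2 vd).2 sDr.
    apply: (@integrable_support _ _ _ (1 * C) (rr + 1)).
    - by apply: measurable_funM; [exact: smooth_measurable|exact: smooth_derive_measurable].
    - by move=> z; rewrite normrM; apply: ler_pM.
    - by move=> z /sDr ->; rewrite mulr0.
  have isDu : mu.-integrable setT (EFin \o (fun z => s z * 'D_vd u z)).
    have := iw (fun z => - ('D_vd u z / sabs d ('D_vd u z)) * 'D_vd u z).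
    have H : continuous (fun z => - ('D_vd u z / sabs d ('D_vd u z)) * 'D_vd u z).
      by move=> z; apply: cvgM; [apply: cvgN; exact: sq.1|exact: sD.1].
    move=> /(_ H); congr (mu.-integrable _ _); apply/funext => z /=.
    by congr EFin; rewrite /s; ring.
  have parts : \int[mu]_z (u z * 'D_vd s z) = - \int[mu]_z (s z * 'D_vd u z).
    have us0 z : rr <= `|z| -> u z * s z = 0 by move=> /sr' ->; rewrite mulr0.
    have := integral_derive0 vd (smoothM su ss) us0.
    have -> : 'D_vd (fun z => u z * s z) = (fun z => u z * 'D_vd s z + s z * 'D_vd u z).
      apply/funext => z.
      by have [_ ->] := is_deriveM (smooth_is_derive z vd su) (smooth_is_derive z vd ss).
    by rewrite (RintegralD measurableT iuDs isDu) => /eqP; rewrite addr_eq0 => /eqP.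
  have fluxE : flux u (add_vertical phi s) = flux u phi - \int[mu]_z (s z * 'D_vd u z).
    rewrite -parts /flux -(RintegralD measurableT iphi iuDs).
    by apply: eq_Rintegral => z _; rewrite divpsi mulrDr.
  rewrite fluxE in le1.
  have -> : d * \int[mu]_z (w z * 1) = \int[mu]_z (d * (w z * 1)).
    by rewrite (RintegralZl d measurableT (iw (fun=> 1) (@cst_continuous _ _ _))).
  apply: (@le_trans _ _ ((- \int[mu]_z (s z * 'D_vd u z)) + \int[mu]_z (d * (w z * 1)))); last first.
    by rewrite lerD2r lerBrDr addrC.
  have iN : mu.-integrable setT (EFin \o (fun z => - 1 * (s z * 'D_vd u z))).
    exact: integrable_scalel.
  have id : mu.-integrable setT (EFin \o (fun z => d * (w z * 1))).
    by apply: integrable_scalel; apply: iw; exact: cst_continuous.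
  rewrite -mulN1r -(RintegralZl (-1) measurableT isDu) -(RintegralD measurableT iN id).
  apply: (le_Rintegral measurableT (iw _ cnD) (integrable_add iN id)) => z _.
  have /andP[wz0 _] := w01 z.
  have sz := sabs_gt0 ('D_vd u z) d0.
  have /andP[_ sN] := sabs_norm ('D_vd u z) d0.
  have -> : -1 * (s z * 'D_vd u z) + d * (w z * 1) =
      w z * ('D_vd u z * 'D_vd u z / sabs d ('D_vd u z) + d).
    by rewrite /s; ring.
  apply: ler_wpM2l => //; rewrite -lerBlDr ler_pdivlMr//.
  move: sN sz; set x := 'D_vd u z; set S := sabs d x => sN sz.
  have -> : x * x = `|x| * `|x| by rewrite -normrM ger0_norm// -expr2 sqr_ge0.
  exact: mulrB_le_sqr (normr_ge0 x) (ltW d0) sz sN.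
set K := \int[mu]_z (w z * 1) in key.
have K0 : 0 <= K.
  by apply: Rintegral_ge0 => z _; rewrite mulr1; have /andP[] := w01 z.
apply/ler_addgt0Pr => d d0.
(* [K] may vanish, hence the division by [K + 1] in the choice of the scale. *)
have K10 : 0 < K + 1 by rewrite ltr_wpDl.
apply: (le_trans (key (d / (K + 1)) (divr_gt0 d0 K10))).
by rewrite lerD2l mulrAC ler_pdivrMr// ler_pM2l// lerDl.
Qed.

Lemma measureI_conull d (T : measurableType d) (m : {measure set T -> \bar R}) (A Y : set T) :
  measurable A -> measurable Y -> m (~` Y) = 0%E -> m (A `&` Y) = m A.
Proof.
move=> mA mY Y0; rewrite [RHS](measureDI m mA mY).
rewrite [X in (X + _)%E](subset_measure0 _ (measurableC mY) _ Y0) ?add0e//.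
exact: measurableD.
Qed.

Lemma measurable_cylinder (c : R) :
  measurable [set y : 'rV[R]_n | \sum_(i < n) row_coord i y * row_coord i y <= c].
Proof.
rewrite -[X in measurable X]setTI.
rewrite (_ : [set y | _] = (fun y : 'rV[R]_n => \sum_(i < n) row_coord i y * row_coord i y) @^-1` `]-oo, c]%classic).
  have mS : measurable_fun setT (fun y : 'rV[R]_n => \sum_(i < n) row_coord i y * row_coord i y).
    by apply: measurable_sum => i; apply: measurable_funM; exact: measurable_row_coord.
  by apply: mS => //; exact: measurable_itv.
by apply/seteqP; split => y /=; rewrite in_itv.
Qed.

Lemma measurable_fun_limn_einf d (T : measurableType d) (f : (T -> \bar R)^nat) :
  (forall k, measurable_fun setT (f k)) ->
  measurable_fun setT (fun x => limn_einf (f ^~ x)).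
Proof.
move=> mf.
rewrite (_ : (fun x => _) = (fun x => - limn_esup ((fun k x => - f k x) ^~ x))%E).
  apply: measurableT_comp => //; apply: measurable_fun_limn_esup => k.
  exact: measurableT_comp.
apply/funext => x; rewrite -limn_einfN; congr limn_einf.
by apply/funext => k /=; rewrite oppeK.
Qed.

(** The strips with lower ends [a k] exhaust the strip from height 0; were all their slices null, so
    would be the countable union. *)
Lemma slice_strip_pos A eta y (a : nat -> R) : measurable A ->
  (forall e, 0 < e -> exists k, a k < e) -> (0 < slice (strip 0 eta `&` A) y)%E ->
  exists k, (0 < slice (strip (a k) eta `&` A) y)%E.
Proof.
move=> mA a0; apply: contraPP => /forallNP H; apply/negP; rewrite -leNgt.
have mX b : measurable (xsection (strip b eta `&` A) y).
  by apply: measurable_xsection; apply: measurableI => //; exact: measurable_strip.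
have : lam.-negligible (\bigcup_k xsection (strip (a k) eta `&` A) y).
  apply: negligible_bigcup => k; apply/negligibleP; first exact: mX.
  by apply/eqP; have /negP := H k; rewrite -leNgt measure_le0.
have sub : xsection (strip 0 eta `&` A) y `<=` \bigcup_k xsection (strip (a k) eta `&` A) y.
  move=> t; rewrite !xsectionE /= => -[/andP[t0 te] At].
  have [k ak] := a0 _ t0; exists k => //; rewrite xsectionE /=; split => //.
  by apply/andP.
move=> /(negligibleS sub)/(negligibleP _ (mX 0)); rewrite /slice => ->.
exact: lexx.
Qed.

(** On the line over a mixed point the mollified indicators tend to 1 at one height and to 0 at
    another, so the lower limit of their variation is at least 1. Fatou's lemma compares the measure
    of these points with [window_variation]. *)
Lemma mixed_window E r a eta phi (P : R) : measurable E -> E `<=` Om ->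
  perimeter E = P%:E -> 0 < r -> 0 < a -> 0 < eta ->
  test_field phi -> (forall z, vcoord z < 2 * eta -> phi z = 0) ->
  (leb R n (mixed E a eta `&`
     [set y | (\sum_(i < n) row_coord i y * row_coord i y <= r / 2)%R]) <=
   (P - flux (\1_E) phi)%:E)%E.
Proof.
move=> mE EO EP r0 a0 eta0 tphi phi0.
set Q := [set y | _].
have mQ : measurable Q by exact: measurable_cylinder.
pose u k := moll E k.+1%:R^-1.
have k0 k : 0 < k.+1%:R^-1 :> R by rewrite invr_gt0.
have su k : smooth (u k) by exact: smooth_moll.
have sD k : smooth ('D_vd (u k)) by exact: smooth_derive_moll.
have cD k : continuous (fun z => `|'D_vd (u k) z|).
  by move=> z; apply: cvg_norm; exact: (sD k).1.
pose w k z : R := window r a eta z * `|'D_vd (u k) z|.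
have cw k : continuous (w k).
  by move=> z; apply: cvgM; [exact: (smooth_window r a eta).1|exact: cD].
have w0 k z : 0 <= w k z.
  by rewrite mulr_ge0//; have /andP[] := window_ge0_le1 r a eta z.
have mW k : measurable_fun setT (EFin \o w k).
  by apply/measurable_EFinP; exact: continuous_measurable_ambient.
have W0 k z : (0 <= (EFin \o w k) z)%E by rewrite lee_fin.
pose G k y := fubini_F lam (EFin \o w k) y.
have mG k : measurable_fun setT (G k) by exact: measurable_fun_fubini_tonelli_F.
have G0 k y : (0 <= G k y)%E by exact: integral_ge0.
have IG k : (\int[leb R n]_y G k y <= (P - flux (u k) phi)%:E)%E.
  rewrite -(fubini_tonelli1 _ (mW k) (W0 k)).
  have iw : mu.-integrable setT (EFin \o w k) by exact: window_integrable.
  rewrite -[leLHS]fineK; last exact: (integrable_fin_num measurableT iw).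
  by rewrite lee_fin; exact: window_variation.
(* [N] is a null set containing the points where the mollified indicators fail to converge. Almost
   every vertical line meets it in length zero, so the two heights can be chosen off [N]. *)
have [N [mN N0 HN]] := moll_cvg_ae mE.
have [Y [mY Y0 HY]] := slice_null mN N0.
have mM := measurable_mixed a eta mE.
have mW0 := measurable_strip a eta.
have point y : (mixed E a eta `&` Q `&` Y) y -> (1 <= limn_einf (G ^~ y))%E.
  move=> [[[pE pC] Qy] Yy].
  have [t1 [[t1W Et1] Nt1]] := slice_pos_point (measurableI _ _ mW0 mE) mN pE (HY _ Yy).
  have [t2 [[t2W Et2] Nt2]] := slice_pos_point (measurableD mW0 mE) mN pC (HY _ Yy).
  have cv t : ~ N (y, t) -> u k (y, t) @[k --> \oo] --> (\1_E ((y, t) : V) : R).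
    by move=> Nt; apply: contrapT => H; apply: Nt; apply: HN.
  have c1 := cv _ Nt1; have c2 := cv _ Nt2.
  have cvk : (`|u k (y, t1) - u k (y, t2)|)%:E @[k --> \oo] --> (1%:E : \bar R).
    apply: cvg_EFin; first by near=> k.
    rewrite (_ : 1 = `|\1_E ((y, t1) : V) - \1_E ((y, t2) : V)| :> R).
      by apply: cvg_norm; apply: cvgB.
    by rewrite !indicE mem_set// memNset// subr0 normr1.
  have [<- _] := cvg_limn_einf_sup cvk.
  apply: le_limn_einf => k.
  apply: (@variation_le_integral _ (fun t => u k (y, t)) (fun t => 'D_vd (u k) (y, t)) a eta).
  - by move=> t; apply: (@is_derive_vertical (u k) ('D_vd (u k))) => z; exact: smooth_is_derive.
  - exact: (@continuous_vertical ('D_vd (u k)) y (sD k).1).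
  - by apply: continuous_measurable_fun; exact: (@continuous_vertical (w k)).
  - by move=> t tab; rewrite /w window_eq1// mul1r.
  - by move=> t.
  - by case/andP: t1W => ? ?; rewrite !ltW.
  - by case/andP: t2W => ? ?; rewrite !ltW.
have mMQ := measurableI _ _ mM mQ.
have mMQY := measurableI _ _ mMQ mY.
have -> : leb R n (mixed E a eta `&` Q) = leb R n (mixed E a eta `&` Q `&` Y).
  exact/esym/measureI_conull.
have g0 y : (0 <= limn_einf (G ^~ y))%E.
  have [<- _] := cvg_limn_einf_sup (@cvg_cst _ (0%E : \bar R) _ \oo _).
  by apply: le_limn_einf => k; exact: G0.
rewrite -(setIT (_ `&` Y)) -integral_indic//.
apply: (@le_trans _ _ (\int[leb R n]_y limn_einf (G ^~ y))%E).
  apply: ge0_le_integral => //.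
  - by apply/measurable_EFinP; exact: measurable_indic.
  - exact: measurable_fun_limn_einf.
  - move=> y _; rewrite indicE; have [yA|_] := boolP (y \in _).
      by apply: point; exact/set_mem.
    exact: g0.
apply: (le_trans (fatou _ measurableT mG (fun k y _ => G0 k y))).
apply: (le_trans (le_limn_einf IG)).
have cv : (P - flux (u k) phi)%:E @[k --> \oo] --> (P - flux (\1_E) phi)%:E.
  apply: cvg_EFin; first by near=> k.
  by apply: cvgB; [exact: cvg_cst|exact: flux_moll_cvg].
by have [-> _] := cvg_limn_einf_sup cv.
Unshelve. all: by end_near.
Qed.

(** The bound of [mixed_window] depends neither on the lower end nor on the horizontal radius.
    Letting them tend to 0 and to infinity, the sets [F k] increase to the mixed set. *)
Lemma mixed_bound E eta phi (P : R) : measurable E -> E `<=` Om ->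
  perimeter E = P%:E -> 0 < eta ->
  test_field phi -> (forall z, vcoord z < 2 * eta -> phi z = 0) ->
  (leb R n (mixed E 0 eta) <= (P - flux (\1_E) phi)%:E)%E.
Proof.
move=> mE EO EP eta0 tphi phi0.
pose a k : R := eta / k.+2%:R.
pose F k := mixed E (a k) eta `&`
     [set y | (\sum_(i < n) row_coord i y * row_coord i y <= k.+1%:R / 2)%R].
have mF k : measurable (F k).
  by apply: measurableI; [exact: measurable_mixed|exact: measurable_cylinder].
have aS k l : (k <= l)%N -> a l <= a k.
  by move=> kl; rewrite ler_pM2l// lef_pV2 ?posrE// ler_nat !ltnS.
have ndF : {homo F : k l / (k <= l)%N >-> (k <= l)%O}.
  move=> k l kl; apply/subsetPset => y [[y1 y2] y3].
  have sk : strip (a k) eta `<=` strip (a l) eta.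
    by move=> z /andP[z1 z2]; apply/andP; split => //; exact: le_lt_trans (aS _ _ kl) z1.
  have mk := measurable_strip (a k) eta; have ml := measurable_strip (a l) eta.
  split; first split.
  - apply: lt_le_trans y1 _; apply: le_slice; [exact: measurableI|exact: measurableI|exact: setSI].
  - apply: lt_le_trans y2 _; apply: le_slice; [exact: measurableD|exact: measurableD|exact: setSD].
  - by apply: (le_trans y3); rewrite ler_pM2r ?invr_gt0// ler_nat ltnS.
have UF : \bigcup_k F k = mixed E 0 eta.
  apply/seteqP; split => y.
    move=> [k _ [[y1 y2] _]].
    have sk : strip (a k) eta `<=` strip 0 eta.
      move=> z /andP[z1 z2]; apply/andP; split => //; apply: le_lt_trans z1.
      by rewrite divr_ge0// ltW.
    have mk := measurable_strip (a k) eta; have ml := measurable_strip 0 eta.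
    split.
    - apply: lt_le_trans y1 _; apply: le_slice; [exact: measurableI|exact: measurableI|exact: setSI].
    - apply: lt_le_trans y2 _; apply: le_slice; [exact: measurableD|exact: measurableD|exact: setSD].
  move=> [y1 y2].
  have a0 e : 0 < e -> exists k, a k < e.
    move=> e0; exists (Num.truncn (eta / e)).
    rewrite /a ltr_pdivrMr// mulrC -ltr_pdivrMr//.
    by apply: (lt_trans (truncnS_gt _)); rewrite ltr_nat.
  have [k1 Hk1] := slice_strip_pos mE a0 y1.
  have [k2 Hk2] := slice_strip_pos (measurableC mE) a0 y2.
  pose S := \sum_(i < n) row_coord i y * row_coord i y.
  have S0 : 0 <= S by apply: sumr_ge0 => i _; rewrite -expr2 sqr_ge0.
  pose k3 := Num.truncn (S * 2).
  have mono A k l : measurable A -> (k <= l)%N ->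
      (0 < slice (strip (a k) eta `&` A) y)%E -> (0 < slice (strip (a l) eta `&` A) y)%E.
    move=> mA kl /lt_le_trans; apply; apply: le_slice.
    - by apply: measurableI => //; exact: measurable_strip.
    - by apply: measurableI => //; exact: measurable_strip.
    - move=> z [/andP[z1 z2] Az]; split => //; apply/andP; split => //.
      exact: le_lt_trans (aS _ _ kl) z1.
  exists (maxn k1 (maxn k2 k3)) => //; split; first split.
  - by apply: (mono _ _ _ mE _ Hk1); rewrite leq_maxl.
  - by apply: (mono _ _ _ (measurableC mE) _ Hk2); rewrite leq_max leq_maxl orbT.
  - rewrite /= -/S ler_pdivlMr//; apply: (le_trans (ltW (truncnS_gt _))).
    by rewrite ler_nat ltnS !leq_max leqnn !orbT.
have cF := nondecreasing_cvg_mu mF (bigcup_measurable (fun k _ => mF k)) ndF.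
rewrite -UF -(cvg_lim _ (cF _ (leb R n)))//; apply: lime_le; first exact: cvgP (cF _ _).
apply: nearW => k; apply: mixed_window => //; by rewrite divr_gt0.
Qed.

End slices.

(** * Boundary layers and the trace of a set *)

Section boundary_layer.
Variables (R : realType) (n : nat).
Local Notation V := (ambient R n).
Local Notation mu := (@volume R n).
Local Notation Om := (@Omega R n).
Local Notation vd := (vdir R n).
Local Notation lam := (@lebesgue_measure R).
Implicit Types (phi psi : V -> V) (z w v : V) (r eta a b : R) (E F A : set V).

Definition full E a : set 'rV[R]_n := [set y | slice (strip 0 a `\` E) y = 0%E].
Definition void E a : set 'rV[R]_n := [set y | slice (strip 0 a `&` E) y = 0%E].
(** The heights are restricted to a sequence so that the union is measurable; a smaller height only
    weakens the condition. *)
Definition tr E : set 'rV[R]_n := \bigcup_k full E k.+1%:R^-1.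

Lemma measurable_slice0 A : measurable A -> measurable [set y | slice A y = 0%E].
Proof.
move=> mA; rewrite -[X in measurable X]setTI.
by apply: (measurable_slice mA measurableT (Y := [set 0%E])).
Qed.

Lemma measurable_full E a : measurable E -> measurable (full E a).
Proof.
by move=> mE; apply: measurable_slice0; apply: measurableD => //; exact: measurable_strip.
Qed.

Lemma measurable_void E a : measurable E -> measurable (void E a).
Proof.
by move=> mE; apply: measurable_slice0; apply: measurableI => //; exact: measurable_strip.
Qed.

Lemma measurable_tr E : measurable E -> measurable (tr E).
Proof. by move=> mE; apply: bigcup_measurable => k _; exact: measurable_full. Qed.

Lemma mixedE E a y : ~ mixed E 0 a y -> full E a y \/ void E a y.
Proof.
move=> H; have [H1|H1] := pselect (0 < slice (strip 0 a `&` E) y)%E.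
  left; apply/eqP; rewrite eq_le slice_ge0 andbT leNgt.
  by apply/negP => H2; exact: H.
by right; apply/eqP; rewrite eq_le slice_ge0 andbT leNgt; apply/negP.
Qed.

Lemma slice0_le A B y : measurable A -> measurable B -> A `<=` B ->
  slice B y = 0%E -> slice A y = 0%E.
Proof.
move=> mA mB AB B0; apply/eqP; rewrite eq_le slice_ge0 andbT.
by rewrite -[X in (_ <= X)%E]B0; exact: le_slice.
Qed.

Lemma slice_setU0 A B y : measurable A -> measurable B ->
  slice A y = 0%E -> slice B y = 0%E -> slice (A `|` B) y = 0%E.
Proof.
move=> mA mB A0 B0; have mAB := measurableU _ _ mA mB.
apply/(negligibleP _ (measurable_xsection y mAB)).
apply: (@negligibleS _ _ _ _ (xsection A y `|` xsection B y)).
  by move=> t; rewrite /setU /= !xsectionE.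
by apply: negligibleU; apply/negligibleP => //; exact: measurable_xsection.
Qed.

Lemma le_strip a b : a <= b -> @strip R n 0 a `<=` @strip R n 0 b.
Proof.
by move=> ab z /andP[z0 za]; apply/andP; split => //; exact: lt_le_trans za ab.
Qed.

Lemma full_le E a b : measurable E -> a <= b -> full E b `<=` full E a.
Proof.
move=> mE ab y; apply: slice0_le; try (by apply: measurableD => //; exact: measurable_strip).
by apply: setSD; exact: le_strip.
Qed.

Lemma void_le E a b : measurable E -> a <= b -> void E b `<=` void E a.
Proof.
move=> mE ab y; apply: slice0_le; try (by apply: measurableI => //; exact: measurable_strip).
by apply: setSI; exact: le_strip.
Qed.

Lemma full_void E a y : measurable E -> 0 < a -> full E a y -> void E a y -> False.
Proof.
move=> mE a0 fy vy.
have mS := @measurable_strip R n 0 a.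
have N : lam.-negligible (xsection (@strip R n 0 a) y).
  apply: (@negligibleS _ _ _ _ (xsection (@strip R n 0 a `\` E) y `|`
      xsection (@strip R n 0 a `&` E) y)).
    move=> t; rewrite /setU /= !xsectionE /= => st.
    by have [Et|Et] := pselect (E (y, t)); [right|left].
  apply: negligibleU; apply/negligibleP => //.
  - by apply: measurable_xsection; exact: measurableD.
  - by apply: measurable_xsection; exact: measurableI.
have : lam `]0, a[%classic = 0%E.
  apply/negligibleP; first exact: measurable_itv.
  by apply: negligibleS N => t; rewrite xsectionE /= in_itv.
by rewrite lebesgue_measure_itv /= lte_fin a0 oppr0 adde0 => -[] /eqP; rewrite gt_eqF.
Qed.

Lemma exists_inv_lt a : 0 < a -> exists k, k.+1%:R^-1 < a.
Proof.
move=> a0; exists (Num.truncn a^-1).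
by rewrite -[ltRHS]invrK ltf_pV2 ?posrE ?invr_gt0// truncnS_gt.
Qed.

Lemma full_tr E a y : measurable E -> 0 < a -> full E a y -> tr E y.
Proof.
move=> mE a0 fy; have [k ka] := exists_inv_lt a0.
by exists k => //; apply: full_le fy => //; exact: ltW.
Qed.

Lemma void_ntr E a y : measurable E -> 0 < a -> void E a y -> ~ tr E y.
Proof.
move=> mE a0 vy [k _ fy].
have m0 : 0 < Num.min a k.+1%:R^-1 by rewrite lt_min a0 invr_gt0 ltr0n.
apply: (@full_void E (Num.min a k.+1%:R^-1) y mE m0).
  by apply: full_le fy => //; rewrite ge_min lexx orbT.
by apply: void_le vy => //; rewrite ge_min lexx.
Qed.

Lemma tr_mono E F : measurable E -> measurable F -> E `<=` F -> tr E `<=` tr F.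
Proof.
move=> mE mF EF y [k _ fy]; exists k => //.
apply: slice0_le fy; try (by apply: measurableD => //; exact: measurable_strip).
exact: setDS.
Qed.

(** The derivative of a vertical step has integral 1 on each vertical line, so this averages the
    indicator over heights below [eta]. It replaces the measure of the trace by an integral over the
    half space, which passes to limits of sets. *)
Definition layer E eta : R := \int[mu]_z (\1_E z * dvstep eta z).

Lemma layer_bound E eta : 0 < eta -> forall z, 0 <= \1_E z * dvstep eta z <= 4 / eta.
Proof.
move=> e0 z; have /andP[d0 d4] := dvstep_bound z e0.
have e4 : 0 <= 4 / eta by rewrite divr_ge0// ltW.
by rewrite indicE; case: (_ \in _); rewrite ?mul1r ?mul0r ?d0 ?lexx.
Qed.

Lemma measurable_dvstep eta : measurable_fun setT (@dvstep R n eta).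
Proof. by apply: continuous_measurable_ambient; exact: continuous_dvstep. Qed.

Lemma measurable_layer E eta : measurable E ->
  measurable_fun setT (fun z => \1_E z * dvstep eta z).
Proof.
by move=> mE; apply: measurable_funM; [exact: measurable_indic|exact: measurable_dvstep].
Qed.

Lemma integrable_layer E eta : measurable E -> (mu E < +oo)%E -> 0 < eta ->
  mu.-integrable setT (EFin \o (fun z => \1_E z * dvstep eta z)).
Proof.
move=> mE Eoo e0; apply: (@integrable_bounded _ _ _ _ _ E (4 / eta)) => //.
- exact: measurable_layer.
- by move=> z; have /andP[? ?] := layer_bound E e0 z; rewrite ger0_norm.
- by move=> z Ez; rewrite indicE memNset// mul0r.
Qed.

Lemma integral_dvstep eta y : 0 < eta ->
  (\int[lam]_t (dvstep eta ((y, t) : V))%:E = 1)%E.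
Proof.
move=> e0.
have <- : (\int[lam]_(t in `[0%R, eta]) (dvstep eta ((y, t) : V))%:E = 1)%E.
  have D x : is_derive (x : R) 1 (fun t : R => vstep eta ((y, t) : V)) (dvstep eta ((y, x) : V)).
    apply: (@is_derive_vertical R n (vstep eta) (dvstep eta)) => z; exact: is_derive_vstep.
  rewrite (integral_derivative D _ e0); last first.
    exact: (@continuous_vertical R n (dvstep eta) y (@continuous_dvstep R n eta)).
  by rewrite vstep1// vstep0 ?subr0//= divr_ge0// ltW.
rewrite [RHS]integral_mkcond; apply: eq_integral => t _; rewrite patchE.
case: ifPn => // /negP tN; rewrite /dvstep dstep_outside ?mulr0//.
have [t0|t0] := leP t 0.
  by left; rewrite mulrC ler_pdivrMr//; apply: (le_trans t0); rewrite mulr_ge0// ltW.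
right; rewrite mulrC ler_pdivlMr// mul1r leNgt; apply/negP => te.
by apply: tN; rewrite inE /= in_itv /= !ltW.
Qed.

Definition layer_slice E eta y : \bar R :=
  fubini_F lam (EFin \o (fun z => \1_E z * dvstep eta z)) y.

Lemma measurable_line (f : V -> R) (y : 'rV[R]_n) : measurable_fun setT f ->
  measurable_fun setT (fun t => f (y, t)).
Proof. by move=> mf; exact: (measurableT_comp mf (measurable_pair1 y)). Qed.

Lemma measurable_layer_line E eta y : measurable E ->
  measurable_fun setT (fun t => (\1_E ((y, t) : V) * dvstep eta ((y, t) : V))%:E).
Proof.
move=> mE; apply/measurable_EFinP.
exact: (@measurable_line (fun z => \1_E z * dvstep eta z) y (measurable_layer eta mE)).
Qed.

Lemma measurable_dvstep_line eta y :
  measurable_fun setT (fun t => (dvstep eta ((y, t) : V))%:E).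
Proof.
apply/measurable_EFinP.
exact: (@measurable_line (dvstep eta) y (measurable_dvstep eta)).
Qed.

Lemma layer_slice_ge0 E eta y : 0 < eta -> (0 <= layer_slice E eta y)%E.
Proof.
by move=> e0; apply: integral_ge0 => t _; rewrite lee_fin; case/andP: (layer_bound E e0 (y, t)).
Qed.

Lemma layer_slice_le1 E eta y : measurable E -> 0 < eta -> (layer_slice E eta y <= 1)%E.
Proof.
move=> mE e0; rewrite -(integral_dvstep y e0).
apply: ge0_le_integral => //.
- by move=> t _; rewrite lee_fin; case/andP: (layer_bound E e0 (y, t)).
- exact: measurable_layer_line.
- exact: measurable_dvstep_line.
- move=> t _; rewrite lee_fin; have /andP[d0 _] := dvstep_bound (y, t) e0.
  by rewrite ler_piMl// indicE lern1 leq_b1.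
Qed.

Lemma dvstep_out eta z : 0 < eta -> ~ @strip R n 0 eta z -> dvstep eta z = 0.
Proof.
move=> e0 /negP; rewrite negb_and -!leNgt => H; rewrite /dvstep dstep_outside ?mulr0//.
case/orP: H => H; [left|right].
  by rewrite mulrC ler_pdivrMr//; apply: (le_trans H); rewrite mulr_ge0// ltW.
by rewrite mulrC ler_pdivlMr// mul1r.
Qed.

Lemma layer_slice_full E eta y : measurable E -> 0 < eta -> full E eta y ->
  layer_slice E eta y = 1%E.
Proof.
move=> mE e0 fy; rewrite -(integral_dvstep y e0); apply: ae_eq_integral => //.
- exact: measurable_layer_line.
- exact: measurable_dvstep_line.
- exists (xsection (@strip R n 0 eta `\` E) y); split.
  + by apply: measurable_xsection; apply: measurableD => //; exact: measurable_strip.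
  + exact: fy.
  + move=> t /=; apply: contra_notP => Ht _; congr EFin.
    have [Et|Et] := pselect (E (y, t)); first by rewrite indicE mem_set// mul1r.
    rewrite dvstep_out ?mulr0// => st; apply: Ht.
    by rewrite xsectionE.
Qed.

Lemma layer_slice_void E eta y : measurable E -> 0 < eta -> void E eta y ->
  layer_slice E eta y = 0%E.
Proof.
move=> mE e0 fy; rewrite -(integral0 lam setT); apply: ae_eq_integral => //.
- exact: measurable_layer_line.
- exists (xsection (@strip R n 0 eta `&` E) y); split.
  + by apply: measurable_xsection; apply: measurableI => //; exact: measurable_strip.
  + exact: fy.
  + move=> t /=; apply: contra_notP => Ht _; congr EFin.
    have [Et|Et] := pselect (E (y, t)); last by rewrite indicE memNset// mul0r.
    rewrite dvstep_out ?mulr0// => st; apply: Ht.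
    by rewrite xsectionE.
Qed.

(** Over a full point, which lies in the trace, the layer contributes 1; over a void point, which
    does not, it contributes 0. All other points are mixed, and there the contribution is at most
    1. *)
Lemma layer_tr E eta : measurable E -> (mu E < +oo)%E -> 0 < eta ->
  ((layer E eta)%:E <= leb R n (tr E) + leb R n (mixed E 0 eta))%E /\
  (leb R n (tr E) <= (layer E eta)%:E + leb R n (mixed E 0 eta))%E.
Proof.
move=> mE Eoo e0; have mt := measurable_tr mE; have mm := measurable_mixed 0 eta mE.
have mL := measurable_layer eta mE.
pose L : V -> \bar R := EFin \o (fun z => \1_E z * dvstep eta z).
have L0 z : (0 <= L z)%E.
  by rewrite lee_fin; case/andP: (layer_bound E e0 z).
have LE : (layer E eta)%:E = (\int[leb R n]_y layer_slice E eta y)%E.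
  rewrite -(fubini_tonelli1 L _ L0); last exact/measurable_EFinP.
  rewrite /layer /Rintegral fineK//.
  exact: (integrable_fin_num measurableT (integrable_layer mE Eoo e0)).
have mJ : measurable_fun setT (layer_slice E eta).
  by apply: measurable_fun_fubini_tonelli_F => //; exact/measurable_EFinP.
have ind B : measurable B -> leb R n B = (\int[leb R n]_y (\1_B y : R)%:E)%E.
  by move=> mB; rewrite integral_indic// setIT.
have mi B : measurable B -> measurable_fun setT (fun y : 'rV[R]_n => (\1_B y : R)%:E).
  by move=> mB; apply/measurable_EFinP; exact: measurable_indic.
have i0 B (y : 'rV[R]_n) : (0 <= (\1_B y : R)%:E)%E by rewrite lee_fin.
have in1 B (y : 'rV[R]_n) : B y -> (\1_B y : R)%:E = 1%E by move=> By; rewrite indicE mem_set.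
have in0 B (y : 'rV[R]_n) : ~ B y -> (\1_B y : R)%:E = 0%E by move=> By; rewrite indicE memNset.
have il B (y : 'rV[R]_n) : ((\1_B y : R)%:E <= 1)%E by rewrite lee_fin indicE lern1 leq_b1.
have J0 y := layer_slice_ge0 E y e0; have J1 y := layer_slice_le1 y mE e0.
rewrite LE (ind _ mt) (ind _ mm); split.
- rewrite -ge0_integralD//; try exact: mi.
  apply: ge0_le_integral => //; first by apply: emeasurable_funD; exact: mi.
  move=> y _; have [my|my] := pselect (mixed E 0 eta y).
    rewrite (in1 _ _ my); apply: (le_trans (J1 y)).
    by rewrite leeDr.
  have [fy|vy] := mixedE my.
    rewrite (in1 (tr E))//; last exact: full_tr fy.
    by apply: (le_trans (J1 y)); rewrite leeDl.
  by rewrite layer_slice_void// adde_ge0.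
- rewrite -ge0_integralD//; try exact: mi.
  apply: ge0_le_integral => //; try exact: mi; first by apply: emeasurable_funD => //; exact: mi.
  move=> y _; have [my|my] := pselect (mixed E 0 eta y).
    rewrite (in1 _ _ my); apply: (le_trans (il _ _)).
    by rewrite leeDr.
  have [fy|vy] := mixedE my.
    rewrite layer_slice_full//; apply: (le_trans (il _ _)).
    by rewrite leeDl.
  rewrite (in0 (tr E)); last exact: void_ntr vy.
  by rewrite adde_ge0.
Qed.

(** A nearly optimal test field vanishes below some height; under half that height [mixed_bound]
    leaves at most the defect of its flux. *)
Lemma mixed_small E d : BV_set E -> 0 < d ->
  exists2 a, 0 < a & forall eta, 0 < eta -> eta <= a -> (leb R n (mixed E 0 eta) <= d%:E)%E.
Proof.
move=> bE d0; have [P P0 EP] := BV_perimeter bE.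
have /BV_setP[mE EO _ _] := bE.
have [phi [tphi Hphi]] : exists phi, test_field phi /\ P - d < flux (\1_E) phi.
  apply: contrapT => /forallNP H.
  have : (perimeter E <= (P - d)%:E)%E.
    apply: perimeter_le => // phi tphi; rewrite lee_fin leNgt; apply/negP => Hphi.
    by apply: (H phi).
  by rewrite EP lee_fin; lra.
have [_ /compact_supportP[r [eta [eta0 [_ He]]]] _] := tphi.
exists (eta / 2); first by rewrite divr_gt0.
move=> eta' eta'0 le'; apply: (le_trans (@mixed_bound R n E eta' phi P mE EO EP eta'0 tphi _)).
  by move=> z zz; apply: He; lra.
by rewrite lee_fin; lra.
Qed.

Lemma tr_lty E : BV_set E -> (leb R n (tr E) < +oo)%E.
Proof.
move=> bE; have /BV_setP[mE EO Eoo _] := bE.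
have [a a0 Ha] := mixed_small bE ltr01.
have [_ H] := layer_tr mE Eoo a0.
apply: (le_lt_trans H); apply: (@le_lt_trans _ _ ((layer E a)%:E + 1%:E)%E).
  by apply: leeD => //; exact: Ha.
by rewrite -EFinD ltry.
Qed.

Definition trm E : R := fine (leb R n (tr E)).

Lemma trmE E : BV_set E -> leb R n (tr E) = (trm E)%:E.
Proof. by move=> bE; rewrite /trm fineK// ge0_fin_numE// tr_lty. Qed.

Lemma layer_cvg E d : BV_set E -> 0 < d ->
  exists2 a, 0 < a & forall eta, 0 < eta -> eta <= a -> `|layer E eta - trm E| <= d.
Proof.
move=> bE d0; have /BV_setP[mE EO Eoo _] := bE.
have [a a0 Ha] := mixed_small bE d0; exists a => // eta eta0 ea.
have [H1 H2] := layer_tr mE Eoo eta0; have Hm := Ha _ eta0 ea.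
rewrite (trmE bE) in H1 H2.
have {}H1 : ((layer E eta)%:E <= (trm E + d)%:E)%E.
  by apply: (le_trans H1); rewrite EFinD; apply: leeD.
have {}H2 : ((trm E)%:E <= (layer E eta + d)%:E)%E.
  by apply: (le_trans H2); rewrite EFinD; apply: leeD.
move: H1 H2; rewrite !lee_fin => H1 H2.
by rewrite ler_norml; apply/andP; split; lra.
Qed.

Lemma hcut_cvg z : hcut k.+1%:R z @[k --> \oo] --> (1 : R).
Proof.
apply: cvg_near_cst; pose S := \sum_(i < n) hcoord i z * hcoord i z.
near=> k; rewrite hcut1// ler_pdivlMr//.
apply: (@le_trans _ _ k%:R); last by rewrite ler_nat.
near: k; exact: nbhs_infty_ger.
Unshelve. all: by end_near.
Qed.

(** The field added to [phi] is [- s] times a difference of two vertical steps, which lives below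
    height [eta]. Its horizontal cutoff is removed by dominated convergence, [E] having finite
    volume. The sign of [s] will follow the direction of a monotone sequence. *)
Lemma flux_layer E (P : R) phi s eta eta' : BV_set E -> perimeter E = P%:E ->
  test_field phi -> (forall z, vcoord z < eta -> phi z = 0) -> `|s| <= 1 ->
  0 < eta -> 0 < eta' -> eta' <= eta / 2 ->
  flux (\1_E) phi <= P + s * (layer E eta' - layer E eta).
Proof.
move=> bE EP tphi phi0 s1 e0 e0' ee.
have /BV_setP[mE EO Eoo _] := bE.
have [Cphi Sphi _] := tphi.
have mI : measurable_fun setT (\1_E : V -> R) by exact: measurable_indic.
have I1 z : `|\1_E z : R| <= 1 by rewrite indicE; case: (_ \in _); rewrite ?normr1 ?normr0.
have iphi := integrable_flux mI I1 Cphi Sphi.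
pose sv r z := - s * (hcut r z * (vstep eta' z - vstep eta z)).
pose D r z := \1_E z * (- s * (hcut r z * (dvstep eta' z - dvstep eta z))).
have mD r : measurable_fun setT (D r).
  apply: measurable_funM => //; apply: measurable_funM => //; apply: measurable_funM.
    by apply: smooth_measurable; exact: smooth_hcut.
  by apply: measurable_funB; exact: measurable_dvstep.
pose C : R := 4 / eta' + 4 / eta.
have DC r z : `|D r z| <= C * \1_E z.
  have /andP[h0 h1] := hcut_ge0_le1 r z.
  have /andP[d0 d1] := dvstep_bound z e0; have /andP[d0' d1'] := dvstep_bound z e0'.
  rewrite /D indicE; case: (_ \in _); last by rewrite mul0r mulr0 normr0.
  rewrite mul1r mulr1.
  rewrite normrM normrN normrM (ger0_norm h0).
  have dd : `|dvstep eta' z - dvstep eta z| <= C.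
    by rewrite /C ler_norml; apply/andP; split; lra.
  rewrite -[X in _ <= X]mul1r; apply: ler_pM => //; first by rewrite mulr_ge0.
  by rewrite -[X in _ <= X]mul1r; apply: ler_pM.
have C0 : 0 <= C by rewrite addr_ge0// divr_ge0// ltW.
have idom : mu.-integrable setT (EFin \o (fun z => C * \1_E z)).
  by apply: integrable_scalel; exact: integrable_indic_lty.
have step r : 0 < r -> flux (\1_E) phi + \int[mu]_z D r z <= P.
  move=> r0.
  have ss : smooth (sv r).
    apply: smoothM; first exact: smooth_cst.
    by apply: smoothM; [exact: smooth_hcut|apply: smoothB; exact: smooth_vstep].
  have s1' z : `|sv r z| <= 1.
    have /andP[h0 h1] := hcut_ge0_le1 r z.
    have /andP[v0 v1] := vstep_ge0_le1 eta z; have /andP[v0' v1'] := vstep_ge0_le1 eta' z.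
    rewrite /sv normrM normrN normrM (ger0_norm h0).
    have dd : `|vstep eta' z - vstep eta z| <= 1 by rewrite ler_norml; apply/andP; split; lra.
    by rewrite mulr_ile1// ?mulr_ge0// mulr_ile1.
  have ee' : eta' <= eta by lra.
  have sv0 z : vstep eta' z - vstep eta z = 0 -> sv r z = 0 by move=> E0; rewrite /sv E0 !mulr0.
  have top z : eta <= vcoord z -> sv r z = 0.
    by move=> ze; apply: sv0; rewrite !vstep1 ?subrr//; exact: le_trans ze.
  have bot z : vcoord z < eta' / 2 -> sv r z = 0.
    by move=> ze; apply: sv0; rewrite !vstep0 ?subrr//; lra.
  have dis z : phi z = 0 \/ sv r z = 0.
    by have [ze|ze] := ltP (vcoord z) eta; [left; exact: phi0|right; exact: top].
  have sr z : Num.max (Num.max r 1) eta < `|z| -> sv r z = 0.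
    move=> zr.
    have [H|/existsNP[i /negP Hi]] := pselect (forall i, `|hcoord i z| < Num.max r 1); last first.
      by rewrite /sv (hcut0 (i := i) r0) ?mul0r ?mulr0// leNgt.
    have [ze|ze] := leP eta (vcoord z); first exact: top.
    have [zv|zv] := leP (vcoord z) 0.
      by apply: bot; apply: (le_lt_trans zv); rewrite divr_gt0.
    exfalso; move: zr; apply/negP; rewrite -leNgt; apply: norm_ambient_le.
    + by rewrite le_max le_max ler01 !orbT.
    + by move=> i; rewrite le_max ltW.
    + by rewrite gtr0_norm// le_max (ltW ze) orbT.
  have e20 : 0 < eta' / 2 by rewrite divr_gt0.
  have [tpsi divpsi] := add_verticalP tphi ss s1' dis e20 sr bot.
  have := flux_le_perimeter mE EO tpsi; rewrite EP lee_fin; apply: le_trans.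
  have Dsv z : 'D_vd (sv r) z = - s * (hcut r z * (dvstep eta' z - dvstep eta z)).
    have Hd := is_deriveB (is_derive_vstep eta' z) (is_derive_vstep eta z).
    have Hm := is_deriveM (is_derive_hcut r z) Hd.
    have Hs := is_deriveM (is_derive_cst (- s) z vd) Hm.
    have [_ E0] := Hs; rewrite [LHS]E0 /cst.
    by change (forall a b, a *: b = a * b :> R) with (forall a b : R, a *: (b : R^o) = a * b); rewrite !scaler0 !addr0.
  have iD : mu.-integrable setT (EFin \o D r).
    apply: (@integrable_bounded _ _ _ _ _ E C) => //.
      move=> z; apply: (le_trans (DC r z)).
      by rewrite indicE; case: (_ \in _); rewrite ?mulr1 ?mulr0.
    by move=> z Ez; rewrite /D indicE memNset// mul0r.
  rewrite /flux -(RintegralD measurableT iphi iD) le_eqVlt; apply/orP; left; apply/eqP.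
  by apply: eq_Rintegral => z _; rewrite divpsi Dsv [RHS]mulrDr.
have cv : \int[mu]_z D k.+1%:R z @[k --> \oo] --> \int[mu]_z (\1_E z * (- s * (1 * (dvstep eta' z - dvstep eta z)))).
  apply: (@Rintegral_bigcvg _ V R mu (fun k => D k.+1%:R) _ (fun z => C * \1_E z)) => //.
  - apply: measurable_funM => //; apply: measurable_funM => //; apply: measurable_funM => //.
    by apply: measurable_funB; exact: measurable_dvstep.
  - apply: nearW => z; apply: cvgM; first exact: cvg_cst.
    apply: cvgM; first exact: cvg_cst.
    by apply: cvgM; [exact: hcut_cvg|exact: cvg_cst].
have lim : flux (\1_E) phi + \int[mu]_z (\1_E z * (- s * (1 * (dvstep eta' z - dvstep eta z)))) <= P.
  rewrite -lerBrDl -(cvg_lim _ cv)//; apply: limr_le; first exact: cvgP cv.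
  by apply: nearW => k; rewrite lerBrDl; apply: step; rewrite ltr0n.
have i1 := integrable_layer mE Eoo e0; have i1' := integrable_layer mE Eoo e0'.
have LE : \int[mu]_z (\1_E z * (- s * (1 * (dvstep eta' z - dvstep eta z)))) =
    - s * (layer E eta' - layer E eta).
  rewrite /layer -(RintegralB measurableT i1' i1) -(RintegralZl (- s) measurableT (integrable_sub i1' i1)).
  by apply: eq_Rintegral => z _; ring.
by move: lim; rewrite LE; lra.
Qed.

(** The limit of [flux_layer] as [eta'] tends to 0. *)
Lemma flux_tr E (P : R) phi s eta : BV_set E -> perimeter E = P%:E ->
  test_field phi -> (forall z, vcoord z < eta -> phi z = 0) -> `|s| <= 1 -> 0 < eta ->
  flux (\1_E) phi <= P + s * (trm E - layer E eta).
Proof.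
move=> bE EP tphi phi0 s1 e0; apply/ler_addgt0Pr => d d0.
have [a a0 Ha] := layer_cvg bE d0.
pose eta' := Num.min a (eta / 2).
have e0' : 0 < eta' by rewrite lt_min a0 divr_gt0.
have ea : eta' <= a by rewrite ge_min lexx.
have ee : eta' <= eta / 2 by rewrite ge_min lexx orbT.
apply: (le_trans (flux_layer bE EP tphi phi0 s1 e0 e0' ee)).
rewrite -addrA lerD2l -lerBlDl -mulrBr.
have -> : layer E eta' - layer E eta - (trm E - layer E eta) = layer E eta' - trm E by ring.
apply: (le_trans (ler_norm _)); rewrite normrM -[X in _ <= X]mul1r.
by apply: ler_pM => //; exact: Ha.
Qed.

(** With [phi = 0] and [s = -1], the trace exceeds the layer by at most [P]. The layer itself
    vanishes as its thickness tends to infinity, because its density is at most [4 / eta] and [E]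
    has finite volume. *)
Lemma trm_le_perimeter E (P : R) : BV_set E -> perimeter E = P%:E -> trm E <= P.
Proof.
move=> bE EP; have /BV_setP[mE EO Eoo _] := bE.
pose M := fine (mu E); have M0 : 0 <= M by exact: fine_ge0.
apply/ler_addgt0Pr => d d0.
(* [M + 1] keeps the thickness positive when [E] is null; the layer is then at most
   [d * (M / (M + 1))]. *)
pose eta := 4 * (M + 1) / d; have e0 : 0 < eta by rewrite divr_gt0// mulr_gt0// ltr_wpDl.
have H : flux (\1_E) (fun=> 0) <= P + (-1) * (trm E - layer E eta).
  by apply: flux_tr => //; [exact: test_field0|rewrite normrN normr1].
have L : layer E eta <= d.
  apply: (@le_trans _ _ (\int[mu]_z (4 / eta * \1_E z))).
    have iI := integrable_indic_lty mE Eoo.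
    apply: (le_Rintegral measurableT (integrable_layer mE Eoo e0) (integrable_scalel _ iI)) => z _.
    have /andP[_ d4] := dvstep_bound z e0.
    by rewrite mulrC; apply: ler_wpM2r.
  rewrite (RintegralZl _ measurableT (integrable_indic_lty mE Eoo)) Rintegral_indic// -/M.
  rewrite /eta; have -> : 4 / (4 * (M + 1) / d) * M = d * (M / (M + 1)).
    have M1 : M + 1 != 0 by rewrite gt_eqF// ltr_wpDl.
    by field; rewrite M1 gt_eqF.
  by rewrite ger_pMr// ler_pdivrMr ?ltr_wpDl// mul1r lerDl.
move: H; rewrite flux0; lra.
Qed.

(** A point that violates this is mixed at every height, and mixed sets have arbitrarily small
    measure. *)
Lemma full_or_void E : BV_set E ->
  {ae leb R n, forall y, exists k, full E k.+1%:R^-1 y \/ void E k.+1%:R^-1 y}.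
Proof.
move=> bE; have /BV_setP[mE EO Eoo _] := bE.
have mM k := measurable_mixed 0 k.+1%:R^-1 mE.
exists (\bigcap_k mixed E 0 k.+1%:R^-1); split.
- exact: bigcap_measurable.
- apply/eqP; rewrite eq_le measure_ge0 andbT; apply/lee_addgt0Pr => d d0; rewrite add0e.
  have [a a0 Ha] := mixed_small bE d0; have [k ka] := exists_inv_lt a0.
  apply: (@le_trans _ _ (leb R n (mixed E 0 k.+1%:R^-1))); last first.
    by apply: Ha; [rewrite invr_gt0|exact: ltW].
  apply: le_measure; rewrite ?inE//; first exact: bigcap_measurable.
  by move=> y; apply.
- move=> y /=; apply: contra_notP => /existsNP[k /existsNP[_ Hk]]; exists k.
  exact: mixedE Hk.
Qed.

(** Below a common height the segment over almost every point is full or void for [E] and for [F],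
    and the segments of the intersection and of the union are then decided. *)
Lemma tr_setIU E F : BV_set E -> BV_set F ->
  {ae leb R n, forall y, (tr (E `&` F) y <-> tr E y /\ tr F y) /\
                         (tr (E `|` F) y <-> tr E y \/ tr F y)}.
Proof.
move=> bE bF; have /BV_setP[mE _ _ _] := bE; have /BV_setP[mF _ _ _] := bF.
apply: filterS2 (full_or_void bE) (full_or_void bF) => y [k Hk] [l Hl].
pose a : R := (maxn k l).+1%:R^-1.
have a0 : 0 < a by rewrite invr_gt0.
have le m : (m <= maxn k l)%N -> a <= m.+1%:R^-1.
  by move=> ml; rewrite lef_pV2 ?posrE// ler_nat ltnS.
have lk := le _ (leq_maxl k l); have ll := le _ (leq_maxr k l).
have {}Hk : full E a y \/ void E a y.
  by case: Hk => Hk; [left; exact: full_le Hk|right; exact: void_le Hk].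
have {}Hl : full F a y \/ void F a y.
  by case: Hl => Hl; [left; exact: full_le Hl|right; exact: void_le Hl].
have mI := measurableI _ _ mE mF; have mU := measurableU _ _ mE mF.
have mS := @measurable_strip R n 0 a.
split; split.
- by move=> H; split; apply: tr_mono H => // z [].
- move=> [tE tF]; case: Hk => [fE|vE]; last by case: (void_ntr mE a0 vE).
  case: Hl => [fF|vF]; last by case: (void_ntr mF a0 vF).
  apply: (full_tr mI a0); rewrite /full /= setDIr.
  by apply: slice_setU0 fE fF; exact: measurableD.
- move=> H; case: Hk => [fE|vE]; first by left; exact: full_tr fE.
  case: Hl => [fF|vF]; first by right; exact: full_tr fF.
  exfalso; apply: (void_ntr mU a0) H; rewrite /void /= setIUr.
  by apply: slice_setU0 vE vF; exact: measurableI.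
- by case=> H; apply: tr_mono H.
Qed.

End boundary_layer.

(** * Integrals off a null set, and the trace as an indicator *)

Section integral_null.
Context d (T : measurableType d) (R : realType).
Variable m : {measure set T -> \bar R}.
Import HBNNSimple.

(** The integral is a supremum over simple functions; cutting a simple function off [N] keeps its
    integral and puts it below [g]. In this way [f] and [g] can be arbitrary nonnegative
    functions. *)
Let ge0_integral_le_null (f g : T -> \bar R) (N : set T) : measurable N -> m N = 0%E ->
  (forall x, (0 <= f x)%E) -> (forall x, (0 <= g x)%E) ->
  (forall x, ~ N x -> f x = g x) -> (\int[m]_x f x <= \int[m]_x g x)%E.
Proof.
move=> mN N0 f0 g0 fg; rewrite !ge0_integralTE//.
apply: ge_ereal_sup => _ [h hf <-].
have mC := measurableC mN.
apply: ereal_sup_ubound; exists (proj_nnsfun h mC).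
  move=> x /=; rewrite mindicE; have [xN|xN] := boolP (x \in _).
    by rewrite mulr1 -fg; [exact: hf|exact/set_mem].
  by rewrite mulr0; exact: g0.
rewrite -!integralT_nnsfun.
rewrite [RHS](ge0_negligible_integral mN)//.
- rewrite setTD [RHS]integral_mkcond; apply: eq_integral => x _.
  rewrite /= /patch mindicE; case: ifPn; by rewrite ?mulr1 ?mulr0.
- exact/measurable_EFinP.
- by move=> x _; rewrite lee_fin.
Qed.

(* The trace of a set is only known almost everywhere, and the Borel
   sigma-algebra is not complete, so that f may fail to be measurable. *)
Lemma integral_eq_off_null (f g : T -> \bar R) (N : set T) : measurable N -> m N = 0%E ->
  (forall x, ~ N x -> f x = g x) -> (\int[m]_x f x = \int[m]_x g x)%E.
Proof.
move=> mN N0 fg; rewrite integralE [RHS]integralE.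
by congr (_ - _)%E; apply/eqP; rewrite eq_le; apply/andP; split;
  apply: (ge0_integral_le_null mN N0) => // x Nx; rewrite ?funeposE ?funenegE fg.
Qed.

End integral_null.

Section trace.
Variables (R : realType) (n : nat).
Local Notation V := (ambient R n).
Local Notation mu := (@volume R n).
Local Notation Om := (@Omega R n).
Local Notation vd := (vdir R n).
Local Notation lam := (@lebesgue_measure R).
Implicit Types (phi psi : V -> V) (z w v : V) (r eta a b : R) (E F : set V).

Lemma eucl_normE z : eucl_norm z =
  Num.sqrt (\sum_(i < n) hcoord i z ^+ 2 + vcoord z ^+ 2).
Proof. by []. Qed.

Lemma eucl_norm_continuous : continuous (@eucl_norm R n).
Proof.
move=> z; apply: (@cvg_comp _ _ _ (fun z : V => \sum_(i < n) hcoord i z ^+ 2 + vcoord z ^+ 2)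
  (@Num.sqrt R)); last exact: sqrt_continuous.
have /(_ z) : continuous (fun z : V => \sum_(i < n) (hcoord i z * hcoord i z) + vcoord z * vcoord z).
  have sm : smooth (fun z : V => \sum_(i < n) (hcoord i z * hcoord i z) + vcoord z * vcoord z).
    apply: smoothD; last by apply: smoothM; exact: smooth_vcoord.
    by apply: smooth_sum => i; apply: smoothM; exact: smooth_hcoord.
  exact: sm.1.
rewrite (_ : (fun z => _) = (fun z : V => \sum_(i < n) hcoord i z ^+ 2 + vcoord z ^+ 2)) //.
Qed.

Lemma hcoord_le_eucl i z : `|hcoord i z| <= eucl_norm z.
Proof.
rewrite eucl_normE -sqrtr_sqr ler_wsqrtr// (bigD1 i)//= -addrA lerDl addr_ge0 ?sqr_ge0//.
by apply: sumr_ge0 => j _; exact: sqr_ge0.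
Qed.

Lemma vcoord_le_eucl z : `|vcoord z| <= eucl_norm z.
Proof.
by rewrite eucl_normE -sqrtr_sqr ler_wsqrtr// lerDr sumr_ge0// => i _; exact: sqr_ge0.
Qed.

Lemma open_eucl_ball z r : open (eucl_ball z r).
Proof.
rewrite (_ : eucl_ball z r = (fun w => eucl_norm (w - z)) @^-1` `]-oo, r[%classic); last first.
  by apply/seteqP; split => w /=; rewrite /eucl_ball /= in_itv.
apply: open_comp; last exact: interval_open.
move=> w _; apply: (@cvg_comp _ _ _ (fun w => w - z) (@eucl_norm R n)); last exact: eucl_norm_continuous.
by apply: cvgB; [exact: cvg_id|exact: cvg_cst].
Qed.

Definition halfball (y : 'rV[R]_n) r : set V := Om `&` eucl_ball ((y, 0) : V) r.

Lemma measurable_Omega : measurable Om.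
Proof.
rewrite (_ : Om = @vcoord R n @^-1` `]0, +oo[%classic).
  apply: open_measurable_ambient; apply: open_comp; last exact: interval_open.
  by move=> z _; exact: vcoord_continuous.
by apply/seteqP; split => z; rewrite /Omega /= in_itv /= andbT.
Qed.

Lemma measurable_halfball y r : measurable (halfball y r).
Proof.
by apply: measurableI; [exact: measurable_Omega|apply: open_measurable_ambient; exact: open_eucl_ball].
Qed.

Lemma halfball_sub y r : 0 < r -> halfball y r `<=` ball ((y, 0) : V) r.
Proof.
move=> r0 z [_ zr]; rewrite -ball_normE /ball_/= distrC; apply: norm_ambient_lt => //.
  by move=> i; apply: le_lt_trans zr; exact: hcoord_le_eucl.
by apply: le_lt_trans zr; exact: vcoord_le_eucl.
Qed.

(** With [s = r / (n + 4)], a point of the cube is at squared distance at most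
    [n * s ^ 2 + 4 * s ^ 2 < r ^ 2] from [(y, 0)]. It only matters that half balls and cubes have
    comparable volumes. *)
Lemma halfball_sup y r : 0 < r ->
  ball ((y, r / n.+4%:R) : V) (r / n.+4%:R) `<=` halfball y r.
Proof.
move=> r0; set s := r / _; have s0 : 0 < s by rewrite divr_gt0.
move=> z /(ambient_ballP _ _ s0)[/= z1 z2].
have [t0 t1] : 0 < (z.2 : R) /\ (z.2 : R) < 2 * s.
  by move: z2; rewrite ltr_norml => /andP[? ?]; split; lra.
split; first exact: t0.
rewrite /eucl_ball /= eucl_normE -[ltRHS]gtr0_norm// -sqrtr_sqr ltr_sqrt; last by rewrite exprn_gt0.
have rE : r = n.+4%:R * s by rewrite /s mulrC divfK.
apply: (@le_lt_trans _ _ (n%:R * s ^+ 2 + 4 * s ^+ 2)); last first.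
  have r4 : r = (n%:R + 4) * s by rewrite -natrD addn4.
  have s2 : 0 < s ^+ 2 by rewrite exprn_gt0.
  have -> : r ^+ 2 = (n%:R + 4) ^+ 2 * s ^+ 2 by rewrite r4; ring.
  have -> : n%:R * s ^+ 2 + 4 * s ^+ 2 = (n%:R + 4) * s ^+ 2 by ring.
  rewrite ltr_pM2r//; have : (0 : R) <= n%:R by []; set N := n%:R; clearbody N; nra.
apply: lerD; last first.
  rewrite /vcoord /= subr0; have -> : 4 * s ^+ 2 = (2 * s) ^+ 2 by ring.
  by rewrite ler_sqr ?nnegrE; lra.
rewrite -[X in X%:R * _](card_ord n) -sum1_card natr_sum mulr_suml; apply: ler_sum => i _.
rewrite mul1r -real_normK ?num_real// ler_sqr ?nnegrE//; last exact: ltW.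
by rewrite /hcoord /= !mxE distrC; apply: ltW; exact: z1.
Qed.

Lemma halfball_fin y r : 0 < r -> (mu (halfball y r) < +oo)%E.
Proof.
move=> r0; apply: (@le_lt_trans _ _ (mu (ball ((y, 0) : V) r))); last exact: volume_ball_lty.
apply: le_measure; rewrite ?inE; [exact: measurable_halfball|exact: measurable_ambient_ball|exact: halfball_sub].
Qed.

Lemma halfball_gt0 y r : 0 < r -> 0 < fine (mu (halfball y r)).
Proof.
move=> r0; have s0 : 0 < r / n.+4%:R by rewrite divr_gt0.
rewrite fine_gt0// halfball_fin// andbT.
apply: (@lt_le_trans _ _ (mu (ball ((y, r / n.+4%:R) : V) (r / n.+4%:R)))).
  by rewrite volume_ball// lte_fin exprn_gt0// mulrn_wgt0.
apply: le_measure; rewrite ?inE; [exact: measurable_ambient_ball|exact: measurable_halfball|exact: halfball_sup].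
Qed.

(** [D] is the set where the indicator differs from the expected trace. Over [A] it is null below
    height [a], so in a half ball of radius less than [a] it lies, up to a null set, off the
    cylinder over [A], which has density one at [(y, 0)]. *)
Lemma half_mean (D : set V) (A : set 'rV[R]_n) y a d : measurable D -> measurable A ->
  0 < a -> 0 < d -> density_point (A `*` setT : set V) (y, 0) ->
  mu ((A `*` setT) `&` (strip 0 a `&` D)) = 0%E ->
  exists2 r0 : R, 0 < r0 & forall r, 0 < r < r0 ->
    fine (mu (D `&` halfball y r)) <= d * fine (mu (halfball y r)).
Proof.
move=> mD mA a0 d0 dp N0.
have mAT : measurable (A `*` setT : set V) by exact: measurableX.
(* The power of [n.+4] is the ratio of the volumes of the cube around the half ball and of the cube
   inside it. *)
pose d' := d / n.+4%:R ^+ n.+1.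
have d'0 : 0 < d' by rewrite divr_gt0// exprn_gt0.
have [r1 r10 H1] := dp _ d'0.
exists (Num.min r1 a); first by rewrite lt_min r10.
move=> r /andP[r0]; rewrite lt_min => /andP[rr1 ra].
have s0 : 0 < r / n.+4%:R by rewrite divr_gt0.
pose B1 : set V := ball ((y, 0) : V) r.
pose B2 : set V := ball ((y, r / n.+4%:R) : V) (r / n.+4%:R).
have mH := measurable_halfball y r.
have mB : measurable B1 by exact: measurable_ambient_ball.
have mS := @measurable_strip R n 0 a.
have mN : measurable ((A `*` setT) `&` (strip 0 a `&` D) : set V).
  by apply: measurableI => //; exact: measurableI.
have le1 : (mu (D `&` halfball y r) <= d'%:E * mu B1)%E.
  apply: (@le_trans _ _ (mu ((B1 `\` (A `*` setT)) `|` ((A `*` setT) `&` (strip 0 a `&` D))))).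
    apply: le_measure; rewrite ?inE; [exact: measurableI|by apply: measurableU => //; exact: measurableD|].
    move=> z [Dz hz]; have [Az|Az] := pselect ((A `*` setT) z); last by left; split => //; exact: halfball_sub hz.
    right; split => //; split => //; apply/andP; split; first exact: hz.1.
    apply: lt_trans ra; apply: le_lt_trans (hz.2).
    by apply: le_trans (vcoord_le_eucl _); rewrite /vcoord /= subr0 ler_norm.
  apply: (@le_trans _ _ (mu (B1 `\` (A `*` setT)) + mu ((A `*` setT) `&` (strip 0 a `&` D)))%E).
    by apply: measureU2 => //; exact: measurableD.
  by rewrite N0 adde0; apply: H1; rewrite r0.
have le2 : (d'%:E * mu B1 <= d%:E * mu (halfball y r))%E.
  rewrite /B1 volume_ball//.
  have -> : (d'%:E * ((r *+ 2) ^+ n.+1)%:E = d%:E * mu B2)%E.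
    rewrite /B2 volume_ball// -!EFinM; congr EFin; rewrite /d' -mulrnAl exprMn exprVn.
    by rewrite mulrCA mulrC mulrA.
  apply: lee_wpmul2l; first by rewrite lee_fin ltW.
  apply: le_measure; rewrite ?inE; [exact: measurable_ambient_ball|exact: measurable_halfball|exact: halfball_sup].
have := le_trans le1 le2.
have Hfin : mu (halfball y r) \is a fin_num by rewrite ge0_fin_numE// halfball_fin.
have Dfin : mu (D `&` halfball y r) \is a fin_num.
  rewrite ge0_fin_numE//; apply: le_lt_trans (halfball_fin y r0).
  by apply: le_measure; rewrite ?inE//; exact: measurableI.
by rewrite -{1}(fineK Hfin) -{1}(fineK Dfin) -EFinM lee_fin.
Qed.

Lemma integrable_bounded_on (f : V -> R) (D : set V) (M : R) : measurable D ->
  (mu D < +oo)%E -> measurable_fun setT f -> (forall z, `|f z| <= M) ->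
  mu.-integrable D (EFin \o f).
Proof.
move=> mD Doo mf fM; apply: measurable_bounded_integrable => //.
  exact: measurable_funTS.
exists M; split; first exact: num_real.
by move=> B MB z _ /=; exact: le_trans (fM z) (ltW MB).
Qed.

Definition half_cvg (u : V -> R) y (c : R) :=
  (\int[mu]_(z in halfball y r) `|u z - c|) / fine (mu (halfball y r))
      @[r --> 0^'+] --> (0 : R).

Lemma half_cvg_indic E (D : set V) (A : set 'rV[R]_n) y a c : measurable D -> measurable A ->
  0 < a -> density_point (A `*` setT : set V) (y, 0) ->
  mu ((A `*` setT) `&` (strip 0 a `&` D)) = 0%E ->
  (forall z, `|\1_E z - c| = \1_D z) -> half_cvg (\1_E) y c.
Proof.
move=> mD mA a0 dp N0 ED; apply/cvgrPdist_lt => e e0.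
have e20 : 0 < e / 2 by rewrite divr_gt0.
have [r0 r00 H] := half_mean mD mA a0 e20 dp N0.
near=> r.
have rr : 0 < r < r0.
  by apply/andP; split; near: r; [exact: nbhs_right_gt|exact: nbhs_right_lt].
have /andP[r_0 _] := rr; have h0 := halfball_gt0 y r_0.
have -> : \int[mu]_(z in halfball y r) `|\1_E z - c| = fine (mu (D `&` halfball y r)).
  rewrite (_ : (fun z => `|\1_E z - c|) = \1_D :> (V -> R)); last by apply/funext => z; exact: ED.
  by rewrite /Rintegral integral_indic//; exact: measurable_halfball.
rewrite sub0r normrN ger0_norm; last by rewrite divr_ge0// ?fine_ge0// ltW.
by rewrite ltr_pdivrMr//; apply: (le_lt_trans (H _ rr)); rewrite ltr_pM2r//; lra.
Unshelve. all: by end_near. Qed.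

(** The mean of the constant distance between [c] and [c'] over a half ball of positive volume is
    that distance, and it is at most the sum of the two means. *)
Lemma half_cvg_unique E y c c' : measurable E ->
  half_cvg (\1_E) y c -> half_cvg (\1_E) y c' -> c' = c.
Proof.
move=> mE H1 H2; apply/eqP; rewrite -subr_eq0 -normr_le0; apply/ler_addgt0Pr => e e0; rewrite add0r.
have e20 : 0 < e / 2 by rewrite divr_gt0.
move: (H1) (H2); rewrite /half_cvg => /cvgrPdist_lt/(_ _ e20) N1 /cvgrPdist_lt/(_ _ e20) N2.
near (0 : R)^'+ => r.
have r0 : 0 < r by near: r; exact: nbhs_right_gt.
have h0 := halfball_gt0 y r0.
have : `|0 - (\int[mu]_(z in halfball y r) `|\1_E z - c|) / fine (mu (halfball y r))| < e / 2 by near: r.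
have : `|0 - (\int[mu]_(z in halfball y r) `|\1_E z - c'|) / fine (mu (halfball y r))| < e / 2 by near: r.
rewrite !sub0r !normrN => /(le_lt_trans (ler_norm _)) L2 /(le_lt_trans (ler_norm _)) L1.
move: L1 L2; rewrite !ltr_pdivrMr// => L1 L2.
have mh := measurable_halfball y r.
have ii (c0 : R) : mu.-integrable (halfball y r) (EFin \o (fun z => `|\1_E z - c0|)).
  apply: (integrable_bounded_on (M := 1 + `|c0|) mh (halfball_fin y r0)).
    apply: measurableT_comp => //; apply: measurable_funB => //; exact: measurable_indic.
  move=> z; rewrite normr_id; apply: (le_trans (ler_normB _ _)); rewrite lerD2r.
  by rewrite indicE; case: (_ \in _); rewrite ?normr1 ?normr0.
have ic : mu.-integrable (halfball y r) (EFin \o (fun z => `|c' - c|)).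
  by apply: (integrable_bounded_on (M := `|c' - c|) mh (halfball_fin y r0)) => // z; rewrite normr_id.
have : \int[mu]_(z in halfball y r) `|c' - c| <=
    \int[mu]_(z in halfball y r) (`|\1_E z - c| + `|\1_E z - c'|).
  apply: (le_Rintegral mh ic (integrableD mh (ii c) (ii c'))) => z _.
  by rewrite -(normrN (\1_E z - c')) opprB addrC; apply: le_trans (ler_normD _ _); rewrite addrA subrK.
rewrite (RintegralD mh (ii c) (ii c')) Rintegral_cst//.
have : `|c' - c| * fine (mu (halfball y r)) < e * fine (mu (halfball y r)) -> `|c' - c| <= e.
  by rewrite ltr_pM2r// => /ltW.
move=> K L; apply: K; apply: (le_lt_trans L); lra.
Unshelve. all: by end_near. Qed.

Lemma trace_half E y c : measurable E -> half_cvg (\1_E) y c -> trace (\1_E : V -> R) y = c.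
Proof.
move=> mE H; apply: xget_unique => //= c' H'; exact: half_cvg_unique H H'.
Qed.

(** The cylinder is invariant under vertical translations. Lebesgue's theorem by itself says nothing
    about the points of the null hyperplane at height 0. *)
Lemma density_point_vertical (A : set 'rV[R]_n) y t : measurable A ->
  density_point (A `*` setT : set V) (y, t) -> density_point (A `*` setT : set V) (y, 0).
Proof.
move=> mA dp d d0; have [r0 r00 H] := dp d d0; exists r0; first exact: r00.
move=> r rr.
have mAT : measurable (A `*` setT : set V) by exact: measurableX.
have := H r rr; rewrite -(volume_shift ((0, t) : V)); last first.
  by apply: measurableD => //; exact: measurable_ambient_ball.
have /andP[r_0 _] := rr.
rewrite !volume_ball//; set S := preimage _ _.
rewrite (_ : S = ball ((y, 0) : V) r `\` (A `*` setT))//.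
have E0 z : (((y, t) : V) - (z + ((0, t) : V))) = ((y, 0) : V) - z.
  apply: ambient_eq => [i|]; first by rewrite /hcoord /= !mxE addr0.
  by rewrite /vcoord /=; ring.
have bE (c w : V) : ball c r w = (`|c - w| < r) :> Prop by rewrite -ball_normE.
have BE (z : V) : ball ((y, t) : V) r (z + ((0, t) : V)) = ball ((y, 0) : V) r z.
  by rewrite !bE E0.
have AE (z : V) : (A `*` setT) (z + ((0, t) : V)) = (A `*` setT) z.
  by rewrite /setX /= addr0.
have SE (z : V) : S z = (ball ((y, t) : V) r (z + ((0, t) : V)) /\ ~ (A `*` setT) (z + ((0, t) : V))).
  by [].
by apply/funext => z; rewrite SE BE AE.
Qed.

(** By Fubini the null set of bad points in space leaves a good height on the line over almost every
    [y]. *)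
Lemma density_ae (A : set 'rV[R]_n) : measurable A ->
  {ae leb R n, forall y, A y -> density_point (A `*` setT : set V) (y, 0)}.
Proof.
move=> mA; have mAT : measurable (A `*` setT : set V) by exact: measurableX.
have [N [mN N0 HN]] := lebesgue_density mAT.
have [Y [mY Y0 HY]] := slice_null mN N0.
exists (~` Y); split => //; first exact: measurableC.
move=> y /=; apply: contra_notP => /contrapT Yy Ay.
have [|t [_ Nt]] := @slice_pos_point R n setT N y measurableT mN _ (HY _ Yy).
  rewrite /slice (_ : xsection setT y = setT).
    apply: (@lt_le_trans _ _ (lam `[(0 : R), 1%R]%classic)).
      by rewrite lebesgue_measure_itv /= lte_fin ltr01 oppr0 adde0 lte_fin ltr01.
    by apply: le_measure; rewrite ?inE//; exact: measurable_itv.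
  by apply/seteqP; split => // t _; rewrite xsectionE.
apply: (@density_point_vertical A y t mA); apply: contrapT => H; apply: Nt; apply: HN.
by split.
Qed.

Lemma slice_set_null (D : set V) (A : set 'rV[R]_n) : measurable D -> measurable A ->
  (forall y, A y -> slice D y = 0%E) -> mu ((A `*` setT) `&` D) = 0%E.
Proof.
move=> mD mA H; have mAT : measurable (A `*` setT : set V) by exact: measurableX.
rewrite volume_slice; last exact: measurableI.
rewrite -(integral0 (leb R n) setT); apply: eq_integral => y _.
have [Ay|Ay] := pselect (A y).
  by apply: slice0_le (H _ Ay) => //; exact: measurableI.
rewrite /slice (_ : xsection _ y = set0) ?measure0//.
by apply/seteqP; split => // t; rewrite xsectionE /= => -[[/= ]].
Qed.

(** Almost every point is full or void at some height [k.+1%:R^-1], and the cylinder over the full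
    or void set containing it has density one there. Only countably many heights occur, so the
    exceptional sets remain null together. *)
Lemma trace_ae E : BV_set E ->
  {ae leb R n, forall y, trace (\1_E : V -> R) y = \1_(tr E) y}.
Proof.
move=> bE; have /BV_setP[mE _ _ _] := bE.
have k0 k : 0 < k.+1%:R^-1 :> R by rewrite invr_gt0.
have dF : {ae leb R n, forall y k, full E k.+1%:R^-1 y ->
    density_point (full E k.+1%:R^-1 `*` setT : set V) (y, 0)}.
  by apply/ae_foralln => k; apply: density_ae; exact: measurable_full.
have dV : {ae leb R n, forall y k, void E k.+1%:R^-1 y ->
    density_point (void E k.+1%:R^-1 `*` setT : set V) (y, 0)}.
  by apply/ae_foralln => k; apply: density_ae; exact: measurable_void.
have mS k := @measurable_strip R n 0 k.+1%:R^-1.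
apply: filterS3 dF dV (full_or_void bE) => y HF HV [k [fk|vk]].
- have -> : \1_(tr E) y = 1 :> R by rewrite indicE mem_set//; exact: full_tr fk.
  apply: trace_half => //.
  apply: (half_cvg_indic (measurableC mE) (measurable_full k.+1%:R^-1 mE) (k0 k) (HF _ fk)).
    apply: slice_set_null; [by apply: measurableI => //; exact: measurableC|exact: measurable_full|by []].
  move=> z; rewrite !indicE in_setC; case: (_ \in _); rewrite /= ?subrr ?normr0//.
  by rewrite sub0r normrN normr1.
- have -> : \1_(tr E) y = 0 :> R by rewrite indicE memNset//; exact: void_ntr vk.
  apply: trace_half => //.
  apply: (half_cvg_indic mE (measurable_void k.+1%:R^-1 mE) (k0 k) (HV _ vk)).
    apply: slice_set_null; [by apply: measurableI|exact: measurable_void|by []].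
  by move=> z; rewrite !indicE subr0; case: (_ \in _); rewrite ?normr0 ?normr1.
Qed.

Lemma integral_trace (beta : 'rV[R]_n -> R) E : BV_set E ->
  (\int[leb R n]_y (beta y * trace (\1_E : V -> R) y)%:E =
   \int[leb R n]_y (beta y * \1_(tr E) y)%:E)%E.
Proof.
move=> bE; have [N [mN N0 HN]] := trace_ae bE.
apply: (integral_eq_off_null mN N0) => y Ny; congr EFin; congr (_ * _).
by apply: contrapT => H; apply: Ny; apply: HN.
Qed.

End trace.

(** * Segments, distances to boundaries and the distance term *)

Section distances.
Variables (R : realType) (n : nat).
Local Notation V := (ambient R n).
Local Notation mu := (@volume R n).
Local Notation Om := (@Omega R n).
Implicit Types (z w v : V) (r t s : R) (E F : set V).

Lemma eucl_normZ t z : 0 <= t -> eucl_norm (t *: z) = t * eucl_norm z.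
Proof.
move=> t0; rewrite !eucl_normE.
have -> : \sum_(i < n) hcoord i (t *: z) ^+ 2 + vcoord (t *: z) ^+ 2 =
    t ^+ 2 * (\sum_(i < n) hcoord i z ^+ 2 + vcoord z ^+ 2).
  rewrite mulrDr mulr_sumr; congr (_ + _).
    by apply: eq_bigr => i _; rewrite /hcoord /= mxE exprMn.
  by rewrite /vcoord /= exprMn.
by rewrite sqrtrM ?sqr_ge0// sqrtr_sqr ger0_norm.
Qed.

Lemma eucl_normN z : eucl_norm (- z) = eucl_norm z.
Proof.
rewrite !eucl_normE; congr (Num.sqrt (_ + _)); last by rewrite /vcoord /= sqrrN.
by apply: eq_bigr => i _; rewrite /hcoord /= mxE sqrrN.
Qed.

Lemma eucl_norm_ge0 z : 0 <= eucl_norm z.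
Proof. exact: sqrtr_ge0. Qed.

Lemma norm_le_eucl z : `|z| <= eucl_norm z.
Proof.
apply: norm_ambient_le; first exact: eucl_norm_ge0.
  by move=> i; exact: hcoord_le_eucl.
exact: vcoord_le_eucl.
Qed.

Lemma eucl_le_norm z : eucl_norm z <= n.+1%:R * `|z|.
Proof.
have z0 : 0 <= n.+1%:R * `|z| by rewrite mulr_ge0.
rewrite eucl_normE -[leRHS](ger0_norm z0) -sqrtr_sqr ler_wsqrtr//.
apply: (@le_trans _ _ (n%:R * `|z| ^+ 2 + `|z| ^+ 2)).
  apply: lerD.
    rewrite -[X in X%:R * _](card_ord n) -sum1_card natr_sum mulr_suml; apply: ler_sum => i _.
    by rewrite mul1r -real_normK ?num_real// ler_sqr ?nnegrE// hcoord_le_norm.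
  by rewrite -real_normK ?num_real// ler_sqr ?nnegrE// vcoord_le_norm.
rewrite exprMn -[X in _ + X]mul1r -mulrDl natr1 ler_wpM2r ?sqr_ge0//.
by rewrite ler_eXnr// ler1n.
Qed.

Definition segment z w t : V := z + t *: (w - z).

Lemma continuous_segment z w : continuous (segment z w).
Proof.
move=> t; apply: cvgD; first exact: cvg_cst.
by apply: cvgZr_tmp; exact: cvg_id.
Qed.

Lemma segment_Omega z w t : Om z -> Om w -> 0 <= t <= 1 -> Om (segment z w t).
Proof.
rewrite /Omega /segment /= => z0 w0 /andP[t0 t1].
change (0 < (z.2 : R) + t * (w.2 - z.2)).
by nra.
Qed.

(** The infimum of the hitting parameters is attained because [C] is closed; its minimality is what
    places the hitting point on a boundary. *)
Lemma first_hit (C : set V) z w : closed C -> C w ->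
  exists t, [/\ 0 <= t <= 1, C (segment z w t) &
    forall s, 0 <= s < t -> ~ C (segment z w s)].
Proof.
move=> cC Cw.
pose T : set R := [set t | 0 <= t <= 1 /\ C (segment z w t)].
have w1 : segment z w 1 = w by rewrite /segment scale1r addrC subrK.
have T1 : T 1 by split; [rewrite ler01 lexx|rewrite w1].
have lbT : lbound T 0 by move=> t [/andP[]].
have hT : has_inf T by split; [exists 1|exists 0].
have t0 : 0 <= inf T by apply: lb_le_inf => //; exists 1.
have t1 : inf T <= 1 by apply: ge_inf => //; exists 0.
exists (inf T); split; first by rewrite t0.
  apply: cC => B /(continuous_segment) [e /= e0 He].
  have [t [/andP[t_0 t_1] Ct] te] := inf_adherent e0 hT.
  exists (segment z w t); split => //; apply: He; rewrite /ball_ /=.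
  have : inf T <= t by apply: ge_inf; [exists 0|split => //; rewrite t_0].
  by move=> it; rewrite distrC ger0_norm ?subr_ge0//; lra.
move=> s /andP[s0 sT] Cs; have s1 : s <= 1 by rewrite (le_trans (ltW sT)).
move: sT; apply/negP; rewrite -leNgt; apply: ge_inf; first by exists 0.
by split => //; rewrite s0.
Qed.

Lemma segment_before z w t (B : set V) : 0 < t -> nbhs (segment z w t) B ->
  exists s, 0 <= s < t /\ B (segment z w s).
Proof.
move=> t0 /(continuous_segment) [e /= e0 He].
pose m := Num.min e t; have m0 : 0 < m by rewrite lt_min e0.
have me : m <= e by rewrite ge_min lexx.
have mt : m <= t by rewrite ge_min lexx orbT.
exists (t - m / 2); split; first by apply/andP; split; lra.
apply: He; rewrite /ball_ /= opprB addrC subrK ger0_norm; lra.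
Qed.

Lemma segment_left z w t : 0 <= t -> eucl_norm (z - segment z w t) = t * eucl_norm (z - w).
Proof.
move=> t0; rewrite /segment opprD addrA subrr sub0r -scalerN opprB.
exact: eucl_normZ.
Qed.

Lemma segment_right z w t : t <= 1 -> eucl_norm (segment z w t - w) = (1 - t) * eucl_norm (z - w).
Proof.
move=> t1; rewrite -eucl_normZ ?subr_ge0//; congr eucl_norm.
rewrite /segment scalerBl scale1r -addrA addrCA -[w - z]opprB scalerN.
by rewrite addrC.
Qed.

Lemma set_dist_le (A B : set V) z w : A z -> B w -> (set_dist A B <= (eucl_norm (z - w))%:E)%E.
Proof. by move=> Az Bw; apply: ereal_inf_lbound; exists (z, w). Qed.

Lemma boundary_dist_le E z w : rel_boundary E w -> (boundary_dist E z <= (eucl_norm (z - w))%:E)%E.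
Proof. by move=> Ew; apply: ereal_inf_lbound; exists w. Qed.

Lemma boundary_dist_ge0 E z : (0 <= boundary_dist E z)%E.
Proof. by apply: le_ereal_inf_tmp => _ [w _ <-]; rewrite lee_fin eucl_norm_ge0. Qed.

Lemma boundary_dist_inside E F z : E `<=` Om -> E `<=` F -> E z ->
  (boundary_dist E z + set_dist (rel_boundary E) (rel_boundary F) <= boundary_dist F z)%E.
Proof.
move=> EO EF Ez; apply: le_ereal_inf_tmp => _ [w [Ow [cw iw]] <-].
have cI : closed (~` interior E) by apply: open_closedC; exact: open_interior.
have iEw : (~` interior E) w by move=> iE; apply: iw; exact: interiorS iE.
(* The first exit from the interior of [E]: earlier points are interior, so the exit point is in the
   closure of [E], and convexity keeps it in the half space. *)
have [t [t01 Ct Hs]] := @first_hit _ z w cI iEw.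
have /andP[t0 t1] := t01.
have bx : rel_boundary E (segment z w t).
  split; first by apply: segment_Omega => //; exact: EO.
  split => //.
  move: t0; rewrite le_eqVlt => /predU1P[<-|t0].
    by rewrite /segment scale0r addr0; exact: subset_closure.
  move=> B /(segment_before t0)[s [sr Bs]]; exists (segment z w s); split => //.
  by apply: interior_subset; apply: contrapT; exact: Hs.
(* The lengths of the two pieces of the segment add up; the first piece reaches the boundary of [E],
   the second joins the two boundaries. *)
have -> : eucl_norm (z - w) = eucl_norm (z - segment z w t) + eucl_norm (segment z w t - w).
  by rewrite segment_left// segment_right//; ring.
rewrite EFinD; apply: leeD; first exact: boundary_dist_le.
by apply: set_dist_le => //; split.
Qed.

Lemma boundary_dist_outside E F z : F `<=` Om -> E `<=` F -> Om z -> ~ F z ->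
  (boundary_dist F z + set_dist (rel_boundary E) (rel_boundary F) <= boundary_dist E z)%E.
Proof.
move=> FO EF Oz Fz; apply: le_ereal_inf_tmp => _ [w [Ow [cw iw]] <-].
have cFw : closure F w by exact: closureS cw.
(* The first entry into the closure of [F]: were the entry point interior to [F], earlier points, or
   [z] itself, would already be in [F]. *)
have [t [t01 Ct Hs]] := @first_hit _ z w (@closed_closure _ F) cFw.
have /andP[t0 t1] := t01.
have bx : rel_boundary F (segment z w t).
  split; first exact: segment_Omega.
  split => // iF.
  move: t0; rewrite le_eqVlt => /predU1P[t0|t0].
    by apply: Fz; apply: interior_subset; move: iF; rewrite -t0 /segment scale0r addr0.
  have [s [sr Fs]] := segment_before t0 iF.
  by apply: (Hs _ sr); exact: subset_closure.
have -> : eucl_norm (z - w) = eucl_norm (z - segment z w t) + eucl_norm (segment z w t - w).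
  by rewrite segment_left// segment_right//; ring.
rewrite EFinD; apply: leeD; first exact: boundary_dist_le.
by rewrite -eucl_normN opprB; apply: set_dist_le => //; split.
Qed.

(** The triangle inequality is used for the sup norm: the factor [n.+1] is the price of comparing it
    with the Euclidean norm, and the factor 2 splits a sum of two distances. *)
Lemma boundary_dist_add E F z (d : R) : 0 <= d ->
  (d%:E <= set_dist (rel_boundary E) (rel_boundary F))%E ->
  ((d / (n.+1%:R * 2))%:E <= boundary_dist E z + boundary_dist F z)%E.
Proof.
move=> d0 Hd; set e := d / _.
have e0 : 0 <= e by rewrite divr_ge0.
have [H|H] := leP e%:E (boundary_dist E z).
  by apply: (le_trans H); rewrite leeDl// boundary_dist_ge0.
apply: (@le_trans _ _ (boundary_dist F z)); last by rewrite leeDr// boundary_dist_ge0.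
have [_ [w1 b1 <-] H1] := ereal_inf_lt H.
apply: le_ereal_inf_tmp => _ [w2 b2 <-]; rewrite lee_fin; rewrite lte_fin in H1.
have := le_trans Hd (set_dist_le b1 b2); rewrite lee_fin => H2.
have H3 := eucl_le_norm (w1 - w2).
have H4 : `|w1 - w2| <= eucl_norm (z - w1) + eucl_norm (z - w2).
  apply: (@le_trans _ _ (`|z - w1| + `|z - w2|)); last by apply: lerD; exact: norm_le_eucl.
  by rewrite -[`|z - w1|]normrN opprB; apply: le_trans (ler_normD _ _); rewrite addrA subrK.
have dE : d = n.+1%:R * (2 * e) by rewrite /e mulrA mulrC divfK.
have : n.+1%:R * (2 * e) <= n.+1%:R * (eucl_norm (z - w1) + eucl_norm (z - w2)).
  rewrite -dE; apply: (le_trans H2); apply: (le_trans H3); exact: ler_wpM2l.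
rewrite ler_pM2l//; lra.
Qed.

(** A strict sublevel set is a union of Euclidean balls centred on the boundary, hence open. *)
Lemma measurable_boundary_dist E : measurable_fun setT (boundary_dist E).
Proof.
apply: (measurability _ (ErealGenInftyO.measurableE R)) => _ [_ [x ->] <-].
rewrite setTI (_ : _ @^-1` _ = \bigcup_(w in rel_boundary E) eucl_ball w x).
  by apply: open_measurable_ambient; apply: bigcup_open => w _; exact: open_eucl_ball.
apply/seteqP; split => z /=.
  rewrite in_itv /= => /ereal_inf_lt[_ [w bw <-]]; rewrite lte_fin => zw.
  by exists w.
move=> [w bw zw]; rewrite in_itv /=; apply: (le_lt_trans (boundary_dist_le z bw)).
by rewrite lte_fin.
Qed.

Lemma boundary_dist_far E M z : E `<=` [set z | `|z| <= M] -> M + 1 <= `|z| ->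
  (1 <= boundary_dist E z)%E.
Proof.
move=> EM Mz; apply: le_ereal_inf_tmp => _ [w [Ow [cw _]] <-].
have wM : `|w| <= M.
  rewrite leNgt; apply/negP => Mw.
  have Mw0 : 0 < `|w| - M by rewrite subr_gt0.
  have [x [Ex]] := cw _ (nbhsx_ballx w _ Mw0).
  rewrite -ball_normE /ball_ /= => wx.
  by have := EM _ Ex; have := lerB_dist w x; rewrite /=; lra.
rewrite lee_fin; apply: le_trans (norm_le_eucl _).
by have := lerB_dist z w; lra.
Qed.

(** A null set does not change proportions in balls, so density one passes from [E] to [F]. The
    distance terms involve topological boundaries, for which inclusion at every point is
    required. *)
Lemma density_one_subset E F : measurable E -> measurable F -> ae_subset E F ->
  density_one E = E -> density_one F = F -> E `<=` F.
Proof.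
move=> mE mF EF0 dE dF z; rewrite -{1}dE -dF /density_one /= => H.
have mB r := open_measurable_ambient (@open_eucl_ball R n z r).
apply: (squeeze_cvgr _ H (@cvg_cst _ (1 : R) _ _ _)).
near=> r.
have r0 : 0 < r by near: r; exact: nbhs_right_gt.
have Bfin : (mu (eucl_ball z r) < +oo)%E.
  apply: (@le_lt_trans _ _ (mu (ball z r))); last exact: volume_ball_lty.
  apply: le_measure; rewrite ?inE; [exact: mB|exact: measurable_ambient_ball|].
  move=> w; rewrite -ball_normE /ball_ /= distrC; exact: le_lt_trans (norm_le_eucl _).
have mEB := measurableI _ _ mE (mB r); have mFB := measurableI _ _ mF (mB r).
have fin A : measurable A -> mu (A `&` eucl_ball z r) \is a fin_num.
  move=> mA; rewrite ge0_fin_numE//; apply: le_lt_trans Bfin.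
  by apply: le_measure; rewrite ?inE//; exact: measurableI.
have B0 : 0 <= fine (mu (eucl_ball z r)) by exact: fine_ge0.
apply/andP; split.
  apply: ler_wpM2r; first by rewrite invr_ge0.
  apply: fine_le; [exact: fin|exact: fin|].
  apply: (@le_trans _ _ (mu ((F `&` eucl_ball z r) `|` (E `\` F)))).
    apply: le_measure; rewrite ?inE//; first by apply: measurableU => //; exact: measurableD.
    move=> w [Ew Bw]; have [Fw|Fw] := pselect (F w); [by left|by right].
  apply: (@le_trans _ _ (mu (F `&` eucl_ball z r) + mu (E `\` F))%E).
    by apply: measureU2 => //; exact: measurableD.
  by rewrite EF0 adde0.
have [/eqP ->|Bn] := boolP (fine (mu (eucl_ball z r)) == 0); first by rewrite invr0 mulr0 ler01.
rewrite ler_pdivrMr ?lt_neqAle ?B0 1?eq_sym ?Bn// mul1r.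
apply: fine_le; [exact: fin|by rewrite ge0_fin_numE|].
by apply: le_measure; rewrite ?inE.
Unshelve. all: by end_near. Qed.

Definition dsym E0 E : \bar R :=
  (\int[mu]_(z in (E `\` E0) `|` (E0 `\` E)) boundary_dist E0 z)%E.

(** The integrand of the distance term extended by 0 to the whole space, so that the terms of
    different sets can be compared pointwise. *)
Definition dfun E0 E z : \bar R :=
  if (z \in E) == (z \in E0) then 0%E else boundary_dist E0 z.

Lemma dsymE E0 E : dsym E0 E = (\int[mu]_z dfun E0 E z)%E.
Proof.
rewrite /dsym integral_mkcond; apply: eq_integral => z _.
rewrite patchE /dfun in_setU !in_setD.
by case: (z \in E); case: (z \in E0).
Qed.

Lemma dfun_ge0 E0 E z : (0 <= dfun E0 E z)%E.
Proof. by rewrite /dfun; case: ifP => // _; exact: boundary_dist_ge0. Qed.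

Lemma measurable_dfun E0 E : measurable E0 -> measurable E -> measurable_fun setT (dfun E0 E).
Proof.
move=> mE0 mE.
have mD : measurable ((E `\` E0) `|` (E0 `\` E)) by apply: measurableU; exact: measurableD.
rewrite (_ : dfun E0 E = boundary_dist E0 \_ ((E `\` E0) `|` (E0 `\` E))).
  by apply/(measurable_restrictT _ mD); apply: measurable_funTS; exact: measurable_boundary_dist.
apply/funext => z; rewrite patchE /dfun in_setU !in_setD.
by case: (z \in E); case: (z \in E0).
Qed.

(** The inequality holds pointwise, with equality off [E] minus [F]. On [E] minus [F] it is
    [boundary_dist_inside] at points of [E0], [boundary_dist_outside] off [F0], and
    [boundary_dist_add] in between. The volume term is the gain from a positive distance [d] between
    the boundaries, and [d = 0] gives plain submodularity. *)
Lemma dsym_submodular E0 F0 E F (d : R) : measurable E0 -> measurable F0 ->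
  measurable E -> measurable F -> F0 `<=` Om -> E `<=` Om -> F `<=` Om -> E0 `<=` F0 ->
  0 <= d -> (d%:E <= set_dist (rel_boundary E0) (rel_boundary F0))%E ->
  (dsym E0 (E `&` F) + dsym F0 (E `|` F) + (d / (n.+1%:R * 2))%:E * mu (E `\` F)
    <= dsym E0 E + dsym F0 F)%E.
Proof.
move=> mE0 mF0 mE mF FO0 EO FO EF0 d0 Hd.
set e := d / _; have e0 : 0 <= e by rewrite divr_ge0.
have ed : e <= d.
  rewrite /e ler_pdivrMr ?mulr_gt0// ler_peMr//.
  by rewrite -natrM ler1n muln_gt0.
have mI := measurableI _ _ mE mF; have mU := measurableU _ _ mE mF.
have mD := measurableD mE mF.
rewrite !dsymE -(setIT (E `\` F)) -integral_indic//.
rewrite -ge0_integralZl//; last first.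
  by apply/measurable_EFinP; exact: measurable_indic.
have md1 := measurable_dfun mE0 mI; have md2 := measurable_dfun mF0 mU.
have md3 := measurable_dfun mE0 mE; have md4 := measurable_dfun mF0 mF.
have g0 := dfun_ge0.
have mind : measurable_fun setT (fun z => (e%:E * (\1_(E `\` F) z : R)%:E)%E).
  by apply: measurable_funeM; apply/measurable_EFinP; exact: measurable_indic.
have i0 z : (0 <= e%:E * (\1_(E `\` F) z : R)%:E)%E by rewrite mule_ge0// lee_fin.
rewrite -!ge0_integralD//; try (by move=> z _; rewrite adde_ge0); try exact: emeasurable_funD.
apply: ge0_le_integral => //.
- by move=> z _; rewrite !adde_ge0.
- by apply: emeasurable_funD => //; exact: emeasurable_funD.
- exact: emeasurable_funD.
move=> z _.
have sub0 : z \in E0 -> z \in F0 by rewrite !inE; exact: EF0.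
rewrite /dfun in_setI in_setU indicE in_setD.
have [zE|zE] := boolP (z \in E); have [zF|zF] := boolP (z \in F);
  rewrite /= ?mule0 ?adde0//.
have Oz : Om z by apply: EO; exact/set_mem.
have [zE0|zE0] := boolP (z \in E0).
  rewrite sub0//= mule1 add0e adde0.
  have := boundary_dist_inside (subset_trans EF0 FO0) EF0 (set_mem zE0).
  apply: le_trans; apply: leeD => //; apply: le_trans Hd; by rewrite lee_fin.
have [zF0|zF0] := boolP (z \in F0); rewrite /= mule1 ?add0e ?adde0.
  exact: boundary_dist_add.
have nF0 : ~ F0 z by move: zF0; rewrite notin_setE.
have := boundary_dist_outside FO0 EF0 Oz nF0.
apply: le_trans; apply: leeD => //; apply: le_trans Hd; by rewrite lee_fin.
Qed.

End distances.

(** * The capillary functional: coercivity, submodularity, semicontinuity *)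

Section energy.
Variables (R : realType) (n : nat).
Local Notation V := (ambient R n).
Local Notation mu := (@volume R n).
Local Notation Om := (@Omega R n).
Implicit Types (z w v : V) (r t s : R) (E F G : set V) (beta : 'rV[R]_n -> R).

Definition per E : R := fine (perimeter E).

Lemma perE E : BV_set E -> perimeter E = (per E)%:E.
Proof. by move=> /BV_perimeter[p _ Ep]; rewrite /per Ep. Qed.

Definition bint beta E : R := \int[leb R n]_y (beta y * \1_(tr E) y).

Definition cap beta E : R := per E - bint beta E.

(** The bounds are required at every point: the boundary data will have been changed on a null
    set. *)
Definition admissible beta (k : R) :=
  measurable_fun setT beta /\ forall y, -1 <= beta y <= 1 - 2 * k.

Lemma integrable_tr E : BV_set E ->
  (leb R n).-integrable setT (EFin \o (\1_(tr E) : 'rV[R]_n -> R)).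
Proof.
move=> bE; have /BV_setP[mE _ _ _] := bE.
by apply: integrable_indic_lty; [exact: measurable_tr|exact: tr_lty].
Qed.

Lemma integrable_beta beta k (A : set 'rV[R]_n) : admissible beta k -> 0 <= k ->
  measurable A -> (leb R n A < +oo)%E ->
  (leb R n).-integrable setT (EFin \o (fun y => beta y * \1_A y)).
Proof.
move=> [mb bk] k0 mA Aoo; apply: (@integrable_bounded _ _ _ _ _ A 1) => //.
- by apply: measurable_funM => //; exact: measurable_indic.
- move=> y; have /andP[b1 b2] := bk y; rewrite indicE.
  case: (_ \in _); rewrite ?mulr1 ?mulr0 ?normr0// ler_norml; apply/andP; split; lra.
- by move=> y Ay; rewrite indicE memNset// mulr0.
Qed.

Lemma trm_int E : BV_set E -> \int[leb R n]_y (\1_(tr E) y : R) = trm E.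
Proof. by move=> bE; have /BV_setP[mE _ _ _] := bE; rewrite /Rintegral integral_indic ?setIT//; exact: measurable_tr. Qed.

Lemma capillaryE beta k E : admissible beta k -> 0 <= k -> BV_set E ->
  capillary beta E = (cap beta E)%:E.
Proof.
move=> ab k0 bE; have /BV_setP[mE _ _ _] := bE.
rewrite /capillary (perE bE) integral_trace// /cap EFinB; congr (_ - _)%E.
rewrite /bint /Rintegral fineK//; apply: (integrable_fin_num measurableT).
by apply: (integrable_beta ab k0); [exact: measurable_tr|exact: tr_lty].
Qed.

(** The trace has measure at most the perimeter, so [beta <= 1 - 2 * k] leaves at least the share
    [2 * k] of the perimeter. *)
Lemma cap_coercive beta k E : admissible beta k -> 0 <= k -> k <= 1 / 2 -> BV_set E ->
  2 * k * per E <= cap beta E.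
Proof.
move=> ab k0 k1 bE; have /BV_setP[mE _ _ _] := bE.
have ib := integrable_beta ab k0 (measurable_tr mE) (tr_lty bE).
have := trm_le_perimeter bE (perE bE).
suff : bint beta E <= (1 - 2 * k) * trm E.
  rewrite /cap => H1 H2; have : (1 - 2 * k) * trm E <= (1 - 2 * k) * per E.
    by apply: ler_wpM2l => //; lra.
  lra.
rewrite -(trm_int bE) -(RintegralZl _ measurableT (integrable_tr bE)).
apply: (le_Rintegral measurableT ib (integrable_scalel _ (integrable_tr bE))) => y _.
by have [_ /(_ y)/andP[_ b2]] := ab; apply: ler_wpM2r.
Qed.

Lemma cap_ge0 beta k E : admissible beta k -> 0 <= k -> k <= 1 / 2 -> BV_set E ->
  0 <= cap beta E.
Proof.
move=> ab k0 k1 bE; apply: le_trans (cap_coercive ab k0 k1 bE).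
by rewrite !mulr_ge0//; have [p p0] := BV_perimeter bE; rewrite (perE bE) => -[->].
Qed.

(** For the trace terms, a point in the trace of [E] but not of [F] is moved from [beta1] to
    [beta2], which does not decrease the sum of the integrals; at other points nothing changes. *)
Lemma cap_submodular beta1 beta2 k E F : admissible beta1 k -> admissible beta2 k -> 0 <= k ->
  (forall y, beta1 y <= beta2 y) -> BV_set E -> BV_set F ->
  [/\ BV_set (E `&` F), BV_set (E `|` F) &
  cap beta1 (E `&` F) + cap beta2 (E `|` F) <= cap beta1 E + cap beta2 F].
Proof.
move=> a1 a2 k0 b12 bE bF; have [bI bU pIU] := perimeter_submodular bE bF.
split => //; have /BV_setP[mE _ _ _] := bE; have /BV_setP[mF _ _ _] := bF.
have /BV_setP[mI _ _ _] := bI; have /BV_setP[mU _ _ _] := bU.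
have iI := integrable_beta a1 k0 (measurable_tr mI) (tr_lty bI).
have iU := integrable_beta a2 k0 (measurable_tr mU) (tr_lty bU).
have iE := integrable_beta a1 k0 (measurable_tr mE) (tr_lty bE).
have iF := integrable_beta a2 k0 (measurable_tr mF) (tr_lty bF).
suff : bint beta1 E + bint beta2 F <= bint beta1 (E `&` F) + bint beta2 (E `|` F).
  move: pIU; rewrite (perE bE) (perE bF) (perE bI) (perE bU) -!EFinD lee_fin /cap => pIU H.
  by rewrite addrACA [leRHS]addrACA -!opprD; apply: lerD; rewrite ?lerN2.
rewrite /bint -(RintegralD measurableT iE iF) -(RintegralD measurableT iI iU).
have [N [mN N0 HN]] := tr_setIU bE bF.
have iA := integrable_add iE iF; have iB := integrable_add iI iU.
(* The integrals are compared through an inequality at every point, so both integrands are set to 0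
   on the exceptional set. *)
pose off (f : 'rV[R]_n -> R) y : R := f y * \1_(~` N) y.
have offE (f : 'rV[R]_n -> R) : \int[leb R n]_y f y = \int[leb R n]_y off f y.
  rewrite /Rintegral; congr fine; apply: (integral_eq_off_null mN N0) => y Ny.
  by rewrite /off indicE mem_set ?mulr1.
have ioff (f : 'rV[R]_n -> R) : (leb R n).-integrable setT (EFin \o f) ->
    (leb R n).-integrable setT (EFin \o off f).
  move=> if_; apply: (le_integrable measurableT _ _ if_).
    apply/measurable_EFinP; apply: measurable_funM; last exact/measurable_indic/measurableC.
    by apply/measurable_EFinP; exact: measurable_int if_.
  move=> y _; rewrite /= lee_fin /off normrM ler_piMr// indicE.
  by case: (_ \in _); rewrite ?normr1 ?normr0.
rewrite offE [leRHS]offE; apply: (le_Rintegral measurableT (ioff _ iA) (ioff _ iB)) => y _.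
rewrite /off; have [Ny|Ny] := pselect (N y).
  have -> : \1_(~` N) y = 0 :> R by rewrite indicE memNset// => nN; exact: nN.
  by rewrite !mulr0.
have -> : \1_(~` N) y = 1 :> R by rewrite indicE mem_set.
rewrite !mulr1.
have [HI HU] : (tr (E `&` F) y <-> tr E y /\ tr F y) /\ (tr (E `|` F) y <-> tr E y \/ tr F y).
  by apply: contrapT => H; apply: Ny; apply: HN.
have b := b12 y.
rewrite !indicE.
have -> : (y \in tr (E `&` F)) = (y \in tr E) && (y \in tr F).
  by apply/idP/andP; rewrite !inE => /HI.
have -> : (y \in tr (E `|` F)) = (y \in tr E) || (y \in tr F).
  by apply/idP/orP; rewrite !inE => /HU.
by case: (y \in tr E); case: (y \in tr F); rewrite /= ?mulr1 ?mulr0 ?addr0 ?add0r.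
Qed.

(* Monotone convergence of sets, in either direction according to the sign s. *)
Definition monotone_to (s : R) (E_ : nat -> set V) E :=
  [/\ forall z, exists k0, forall k, (k0 <= k)%N -> (E_ k z <-> E z),
      exists2 G, measurable G /\ (mu G < +oo)%E & forall k, E_ k `<=` G &
      (s = 1 /\ forall k, E_ k `<=` E) \/ (s = -1 /\ forall k, E `<=` E_ k)].

Section limit.
Variables (s : R) (E_ : nat -> set V) (E : set V).
Hypothesis bE_ : forall k, BV_set (E_ k).
Hypothesis ME : monotone_to s E_ E.

Let mE_ k : measurable (E_ k). Proof. by have /BV_setP[] := bE_ k. Qed.

Let indic_eventually z : exists k0, forall k, (k0 <= k)%N -> (\1_(E_ k) z = \1_E z :> R).
Proof.
have [/(_ z)[k0 H] _ _] := ME; exists k0 => k kk.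
rewrite !indicE; congr (_%:R); congr nat_of_bool.
by apply/idP/idP; rewrite !inE => /(H k kk).
Qed.

Let cvg_indic z : \1_(E_ k) z @[k --> \oo] --> (\1_E z : R).
Proof.
have [k0 H] := indic_eventually z; apply: cvg_near_cst.
by exists k0 => // k /= kk; apply: H.
Qed.

Lemma measurable_limit : measurable E.
Proof.
have [cv _ _] := ME.
rewrite (_ : E = \bigcup_k0 \bigcap_k E_ (k0 + k)%N).
  by apply: bigcupT_measurable => k0; exact: bigcapT_measurable.
apply/seteqP; split => z.
  by have [k0 H] := cv z; exists k0 => // k _; apply/H => //; rewrite leq_addr.
have [k0 H] := cv z; move=> [k1 _ Hz].
by apply/(H (k1 + k0)%N); [rewrite leq_addl|exact: Hz].
Qed.

Lemma limit_Omega : E `<=` Om.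
Proof.
move=> z Ez; have [/(_ z)[k0 H] _ _] := ME.
by have /BV_setP[_ EO _ _] := bE_ k0; apply: EO; apply/(H k0).
Qed.

Lemma limit_lty : (mu E < +oo)%E.
Proof.
have [cv [G [mG Goo] EG] _] := ME.
apply: le_lt_trans Goo; apply: le_measure; rewrite ?inE//; first exact: measurable_limit.
by move=> z Ez; have [k0 H] := cv z; apply: (EG k0); apply/(H k0).
Qed.

Lemma cvg_weight (g : V -> R) (C : R) : measurable_fun setT g -> (forall z, `|g z| <= C) ->
  \int[mu]_z (\1_(E_ k) z * g z) @[k --> \oo] --> \int[mu]_z (\1_E z * g z).
Proof.
move=> mg gC; have [_ [G [mG Goo] EG] _] := ME.
apply: (@Rintegral_bigcvg _ V R mu _ _ (fun z => C * \1_G z)).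
- by move=> k; apply: measurable_funM => //; exact: measurable_indic.
- by apply: measurable_funM => //; apply: measurable_indic; exact: measurable_limit.
- by apply: nearW => z; apply: cvgM; [exact: cvg_indic|exact: cvg_cst].
- by apply: integrable_scalel; exact: integrable_indic_lty.
- move=> k z; have C0 : 0 <= C by exact: le_trans (gC z).
  rewrite !indicE; have [zE|zE] := boolP (z \in E_ k); last first.
    by rewrite mul0r normr0 mulr_ge0.
  by rewrite (mem_set (EG k z (set_mem zE))) mul1r mulr1.
Qed.

Lemma cvg_flux phi : test_field phi ->
  flux (\1_(E_ k)) phi @[k --> \oo] --> flux (\1_E) phi.
Proof.
move=> [Cphi Sphi _]; have [r [C [C0 fC _]]] := divergence_bound Cphi Sphi.
apply: cvg_weight fC; apply: continuous_measurable_ambient; exact: continuous_divergence.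
Qed.

Lemma BV_limit (C : R) : (forall k, per (E_ k) <= C) -> BV_set E.
Proof.
move=> HC; apply/BV_setP; split; [exact: measurable_limit|exact: limit_Omega|exact: limit_lty|].
apply: (@le_lt_trans _ _ C%:E); last exact: ltry.
apply: perimeter_le; [exact: measurable_limit|exact: limit_Omega|move=> phi tphi].
rewrite lee_fin -(cvg_lim _ (cvg_flux tphi))//; apply: limr_le; first exact: cvgP (cvg_flux tphi).
apply: nearW => k; apply: le_trans (HC k).
have /BV_setP[mE EO _ _] := bE_ k.
by have := flux_le_perimeter mE EO tphi; rewrite (perE (bE_ k)) lee_fin.
Qed.

(** Perimeter may be lost at the boundary when the traces do not converge. By [flux_tr] the loss is
    governed by the layer term, in which the trace of [E_ j] cancels against the change of the
    [beta] integral. Four errors of [e / 4] remain: the choice of [phi], the layer of [E] against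
    its trace, and the convergence of fluxes and of layers. *)
Lemma cap_lsc beta k e : BV_set E -> admissible beta k -> 0 <= k -> 0 < e ->
  \forall j \near \oo, cap beta E <= cap beta (E_ j) + e.
Proof.
move=> bE ab k0 e0.
have d0 : 0 < e / 4 by rewrite divr_gt0.
set d := e / 4 in d0 *.
have /BV_setP[mE EO Eoo _] := bE.
have [phi [tphi Hphi]] : exists phi, test_field phi /\ per E - d < flux (\1_E) phi.
  apply: contrapT => /forallNP H.
  have : (perimeter E <= (per E - d)%:E)%E.
    apply: perimeter_le => // phi tphi; rewrite lee_fin leNgt; apply/negP => Hphi.
    by apply: (H phi).
  by rewrite (perE bE) lee_fin; lra.
have [_ /compact_supportP[r [eta0 [eta00 [_ He]]]] _] := tphi.
have [a a0 Ha] := layer_cvg bE d0.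
pose eta := Num.min a eta0.
have e_0 : 0 < eta by rewrite lt_min a0.
have ea : eta <= a by rewrite ge_min lexx.
have ee : eta <= eta0 by rewrite ge_min lexx orbT.
have phi0 z : vcoord z < eta -> phi z = 0 by move=> ze; apply: He; exact: lt_le_trans ee.
have La := Ha _ e_0 ea.
have cL : layer (E_ j) eta @[j --> \oo] --> layer E eta.
  apply: (cvg_weight (C := 4 / eta)); first exact: measurable_dvstep.
  by move=> z; have /andP[? ?] := dvstep_bound z e_0; rewrite ger0_norm.
have NL := (cvgrPdist_le _ _).1 cL _ d0.
have NF := (cvgrPdist_le _ _).1 (cvg_flux tphi) _ d0.
near=> j.
have L1 : `|layer E eta - layer (E_ j) eta| <= d by near: j; exact: NL.
have F1 : `|flux (\1_E) phi - flux (\1_(E_ j)) phi| <= d by near: j; exact: NF.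
have bj := bE_ j.
have ibE := integrable_beta ab k0 (measurable_tr mE) (tr_lty bE).
have ibj := integrable_beta ab k0 (measurable_tr (mE_ j)) (tr_lty bj).
have [_ _ dir] := ME.
have s1 : `|s| <= 1 by case: dir => -[-> _]; rewrite ?normrN normr1.
have Fj := flux_tr bj (perE bj) tphi phi0 s1 e_0.
(* For [s = 1] the trace of [E_ j] is contained in that of [E], and the inequality comes from
   [-1 <= beta]; for [s = -1] the inclusion is reversed and it comes from [beta <= 1]. *)
have B : bint beta (E_ j) <= bint beta E + s * (trm E - trm (E_ j)).
  have it := integrable_scalel s (integrable_sub (integrable_tr bE) (integrable_tr bj)).
  rewrite -(trm_int bE) -(trm_int bj) -(RintegralB measurableT (integrable_tr bE) (integrable_tr bj)).
  rewrite -(RintegralZl s measurableT (integrable_sub (integrable_tr bE) (integrable_tr bj))).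
  rewrite -(RintegralD measurableT ibE it).
  apply: (le_Rintegral measurableT ibj (integrable_add ibE it)) => y _.
  have [_ /(_ y)/andP[b1 b2]] := ab.
  rewrite !indicE; case: dir => -[-> sub]; [have tsub := tr_mono (mE_ j) mE (sub j)|have tsub := tr_mono mE (mE_ j) (sub j)].
    have : y \in tr (E_ j) -> y \in tr E by rewrite !inE; exact: tsub.
    by case: (y \in tr E); case: (y \in tr (E_ j)) => H; rewrite /= ?mulr1n ?mulr0n; try (by have := H isT); lra.
  have : y \in tr E -> y \in tr (E_ j) by rewrite !inE; exact: tsub.
  by case: (y \in tr E); case: (y \in tr (E_ j)) => H; rewrite /= ?mulr1n ?mulr0n; try (by have := H isT); lra.
have S1 : s * (trm E - layer (E_ j) eta) <= d + d.
  apply: (le_trans (ler_norm _)); rewrite normrM -[leRHS]mul1r.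
  apply: ler_pM => //; move: L1 La; rewrite !ler_norml => /andP[? ?] /andP[? ?].
  by apply/andP; split; lra.
move: F1; rewrite ler_norml => /andP[F1 F2].
have -> : e = d + d + d + d by rewrite /d; field.
rewrite /cap; move: Fj S1 B; rewrite !mulrBr; lra.
Unshelve. all: by end_near. Qed.

End limit.

End energy.

Section ereal_tools.
Variable R : realType.
Implicit Types (x y : \bar R).

(** Cancels [x] from a bound on the sum before its finiteness is known; the lower bound is supplied
    by an infimum or a minimum of the energy. *)
Lemma lee_cancel x y (a b : R) : (a%:E <= x)%E -> (x + y <= (a + b)%:E)%E -> (y <= b%:E)%E.
Proof.
by case: x => [x| |]; case: y => [y| |] //=; rewrite ?leNye// -EFinD !lee_fin => H1 H2; lra.
Qed.

Lemma lee_energy (c1 c2 c3 c4 l : R) (x1 x2 x3 x4 : \bar R) y : 0 <= l ->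
  (0 <= x1)%E -> (0 <= x2)%E -> (0 <= x3)%E -> (0 <= x4)%E -> (0 <= y)%E ->
  c1 + c2 <= c3 + c4 -> (x1 + x2 + y <= x3 + x4)%E ->
  ((c1%:E + l%:E * x1) + (c2%:E + l%:E * x2) + l%:E * y <=
   (c3%:E + l%:E * x3) + (c4%:E + l%:E * x4))%E.
Proof.
move=> l0 p1 p2 p3 p4 py Hc Hx.
rewrite addeACA [leRHS]addeACA -[leLHS]addeA -(ge0_muleDr _ p1 p2) -(ge0_muleDr _ p3 p4).
rewrite -(ge0_muleDr _ (adde_ge0 p1 p2) py).
by apply: leeD; [rewrite -!EFinD lee_fin|apply: lee_wpmul2l; rewrite ?lee_fin].
Qed.

End ereal_tools.

Lemma measure_setD_null d (T : measurableType d) (R : realType)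
  (m : {measure set T -> \bar R}) (A B : set T) (a b : R) : measurable A ->
  measurable B -> B `<=` A -> m A = a%:E -> m B = b%:E -> a <= b -> m (A `\` B) = 0%E.
Proof.
move=> mA mB BA Aa Bb ab; rewrite measureD//; last by rewrite [X in (X < _)%E]Aa ltry.
rewrite setIidr// [X in (X - _)%E]Aa [X in (_ - X)%E]Bb -EFinB; congr EFin.
apply/eqP; rewrite subr_eq0 eq_le ab -lee_fin -Aa -Bb /=.
by apply: le_measure; rewrite ?inE.
Qed.

(** * Existence of extremal minimizers of one energy *)

Section problem.
Variables (R : realType) (n : nat).
Local Notation V := (ambient R n).
Local Notation mu := (@volume R n).
Local Notation Om := (@Omega R n).
Implicit Types (z w v : V) (r t s : R) (E F G : set V) (beta : 'rV[R]_n -> R).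

Definition energy beta E0 (l : R) E : \bar R :=
  ((cap beta E)%:E + l%:E * dsym E0 E)%E.

Lemma dsym_ge0 E0 E : (0 <= dsym E0 E)%E.
Proof. by rewrite dsymE; apply: integral_ge0 => z _; exact: dfun_ge0. Qed.

Lemma ATWE beta k E0 l E : admissible beta k -> 0 <= k -> BV_set E ->
  ATW beta E0 l E = energy beta E0 l E.
Proof. by move=> ab k0 bE; rewrite /ATW (capillaryE ab k0 bE). Qed.

Lemma energy_submodular beta1 beta2 k E0 F0 l E F (d : R) :
  admissible beta1 k -> admissible beta2 k -> 0 <= k ->
  (forall y, beta1 y <= beta2 y) -> BV_set E0 -> BV_set F0 -> E0 `<=` F0 -> 0 <= l ->
  0 <= d -> (d%:E <= set_dist (rel_boundary E0) (rel_boundary F0))%E ->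
  BV_set E -> BV_set F ->
  (energy beta1 E0 l (E `&` F) + energy beta2 F0 l (E `|` F)
     + l%:E * ((d / (n.+1%:R * 2))%:E * mu (E `\` F))
   <= energy beta1 E0 l E + energy beta2 F0 l F)%E.
Proof.
move=> a1 a2 k0 b12 bE0 bF0 EF0 l0 d0 Hd bE bF.
have [bI bU capIU] := cap_submodular a1 a2 k0 b12 bE bF.
have /BV_setP[mE EO _ _] := bE; have /BV_setP[mF FO _ _] := bF.
have /BV_setP[mE0 EO0 _ _] := bE0; have /BV_setP[mF0 FO0 _ _] := bF0.
have H := dsym_submodular mE0 mF0 mE mF FO0 EO FO EF0 d0 Hd.
apply: lee_energy => //; try exact: dsym_ge0.
by apply: mule_ge0; [rewrite lee_fin divr_ge0|exact: measure_ge0].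
Qed.

Section one_problem.
Variables (beta : 'rV[R]_n -> R) (E0 : set V) (k l M : R).
Hypotheses (ab : admissible beta k) (k0 : 0 < k) (k1 : k <= 1 / 2) (l1 : 1 <= l).
Hypotheses (bE0 : BV_set E0) (E0M : E0 `<=` [set z | `|z| <= M]).

Local Notation en := (energy beta E0 l).

Let k0' : 0 <= k := ltW k0.
Let l0 : 0 <= l := le_trans ler01 l1.

Let mE0 : measurable E0. Proof. by have /BV_setP[] := bE0. Qed.

Lemma cap_le_energy E : ((cap beta E)%:E <= en E)%E.
Proof. by rewrite leeDl// mule_ge0 ?lee_fin// dsym_ge0. Qed.

Lemma dsym_le_energy E : BV_set E -> (dsym E0 E <= en E)%E.
Proof.
move=> bE; apply: (@le_trans _ _ (l%:E * dsym E0 E)%E).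
  by rewrite -[leLHS]mul1e lee_wpmul2r ?dsym_ge0 ?lee_fin.
by rewrite leeDr// lee_fin (cap_ge0 ab k0' k1 bE).
Qed.

Lemma energy_ge0 E : BV_set E -> (0 <= en E)%E.
Proof. by move=> bE; apply: le_trans (dsym_le_energy bE); exact: dsym_ge0. Qed.

Let far : set V := ball (0 : V) (M + 1).
Let K : R := fine (mu far).

(** Points outside the cube [far] are outside [E0] and at distance at least 1 from its boundary, so
    the volume of [E] there is at most the distance term, and [1 <= l] puts that term under the
    energy. *)
Lemma volume_le_energy E : BV_set E -> (mu E <= K%:E + en E)%E.
Proof.
move=> bE; have /BV_setP[mE _ _ _] := bE.
have mB : measurable far by exact: measurable_ambient_ball.
have farN z : ~ far z -> M + 1 <= `|z|.
  by rewrite /far -ball_normE /ball_ /= sub0r normrN => /negP; rewrite -leNgt.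
have -> : (K%:E = mu far)%E by rewrite /K fineK// ge0_fin_numE// volume_ball_lty.
apply: (@le_trans _ _ (mu far + mu (E `\` far))%E).
  apply: (@le_trans _ _ (mu (far `|` (E `\` far)))).
    apply: le_measure; rewrite ?inE//; first by apply: measurableU => //; exact: measurableD.
    by move=> z Ez; have [Bz|Bz] := pselect (far z); [left|right].
  by apply: measureU2 => //; exact: measurableD.
apply: leeD => //; apply: le_trans (dsym_le_energy bE).
have mD : measurable (E `\` far) by exact: measurableD.
rewrite dsymE -(setIT (E `\` far)) -integral_indic//.
apply: ge0_le_integral => //.
- by apply/measurable_EFinP; exact: measurable_indic.
- exact: measurable_dfun.
move=> z _; rewrite indicE in_setD; have [zE|zE] := boolP (z \in E); last by rewrite dfun_ge0.
have [zB|zB] := boolP (z \in far); first by rewrite dfun_ge0.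
have {}zB : M + 1 <= `|z| by apply: farN; move: zB; rewrite notin_setE.
rewrite /dfun zE memNset; first exact: boundary_dist_far zB.
move=> /E0M /= zM; lra.
Qed.

(** Eventual membership makes the integrands at each point eventually equal to that of the limit,
    even where the distance is infinite. *)
Lemma dsym_fatou (E_ : nat -> set V) E : (forall j, measurable (E_ j)) -> measurable E ->
  (forall z, exists j0, forall j, (j0 <= j)%N -> (E_ j z <-> E z)) ->
  (dsym E0 E <= limn_einf (fun j => dsym E0 (E_ j)))%E.
Proof.
move=> mE_ mE cv; rewrite dsymE.
have -> : (fun j => dsym E0 (E_ j)) = (fun j => (\int[mu]_z dfun E0 (E_ j) z)%E).
  by apply/funext => j; rewrite dsymE.
have md j : measurable_fun setT (dfun E0 (E_ j)) by exact: measurable_dfun.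
apply: le_trans (fatou mu measurableT md (fun j z _ => dfun_ge0 _ _ _)).
rewrite le_eqVlt; apply/orP; left; apply/eqP; apply: eq_integral => z _.
have [j0 H] := cv z; apply/esym.
have cvz : dfun E0 (E_ j) z @[j --> \oo] --> dfun E0 E z.
  apply: cvg_near_cst; exists j0 => // j /= jj; rewrite /dfun.
  suff -> : (z \in E_ j) = (z \in E) by [].
  by apply/idP/idP; rewrite !inE => /(H j jj).
by have [] := cvg_limn_einf_sup cvz.
Qed.

Lemma energy_lsc s (E_ : nat -> set V) E (c : R) : (forall j, BV_set (E_ j)) ->
  monotone_to s E_ E -> (forall j, (en (E_ j) <= c%:E)%E) -> BV_set E /\ (en E <= c%:E)%E.
Proof.
move=> bE_ ME Hc.
have capc j : cap beta (E_ j) <= c.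
  by rewrite -lee_fin; apply: le_trans (Hc j); exact: cap_le_energy.
have bE : BV_set E.
  apply: (BV_limit bE_ ME (C := c / (2 * k))) => j.
  rewrite ler_pdivlMr ?mulr_gt0// mulrC; apply: le_trans (capc j).
  exact: cap_coercive.
split => //; apply/lee_addgt0Pr => e e0.
have [j0 _ Hj] := cap_lsc bE_ ME bE ab k0' e0.
have [cv _ _] := ME; have /BV_setP[mE _ _ _] := bE.
have lp : 0 < l by exact: lt_le_trans l1.
(* Semicontinuity of the capillary part turns the bound on the energy into one on the distance term
   alone, with [cap beta E] in place of [cap beta (E_ j)]; Fatou's lemma then applies to this
   term. *)
have D j : (dsym E0 (E_ (j + j0)%N) <= ((c + e - cap beta E) / l)%:E)%E.
  have H := Hc (j + j0)%N; have /= C := Hj (j + j0)%N (leq_addl _ _).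
  move: H; rewrite /energy; have := dsym_ge0 E0 (E_ (j + j0)%N).
  case: (dsym E0 _) => [x| |] //=; last by rewrite gt0_muley ?lte_fin.
  by rewrite -!EFinM -EFinD !lee_fin ler_pdivlMr// => x0 H; lra.
have mE_ j : measurable (E_ j) by have /BV_setP[] := bE_ j.
have := @dsym_fatou (fun j => E_ (j + j0)%N) E (fun j => mE_ _) mE _.
have cv' z : exists j1, forall j, (j1 <= j)%N -> (E_ (j + j0)%N z <-> E z).
  by have [j1 H] := cv z; exists j1 => j jj; apply: H; exact: leq_trans jj (leq_addr _ _).
move=> /(_ cv') L.
have {}L : (dsym E0 E <= ((c + e - cap beta E) / l)%:E)%E.
  apply: (le_trans L).
  have [<- _] := cvg_limn_einf_sup (@cvg_cst _ (((c + e - cap beta E) / l)%:E : \bar R) _ \oo _).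
  exact: le_limn_einf.
rewrite /energy; apply: (@le_trans _ _ ((cap beta E)%:E + l%:E * ((c + e - cap beta E) / l)%:E)%E).
  by apply: leeD => //; apply: lee_wpmul2l; rewrite ?lee_fin.
by rewrite -EFinM -EFinD -EFinD lee_fin mulrC divfK ?gt_eqF//; lra.
Qed.

Lemma energy_bigcup (E_ : nat -> set V) (c : R) : (forall j, BV_set (E_ j)) ->
  (forall i j, (i <= j)%N -> E_ i `<=` E_ j) -> (forall j, (en (E_ j) <= c%:E)%E) ->
  BV_set (\bigcup_j E_ j) /\ (en (\bigcup_j E_ j) <= c%:E)%E.
Proof.
move=> bE_ nd Hc; have mE_ j : measurable (E_ j) by have /BV_setP[] := bE_ j.
have mU : measurable (\bigcup_j E_ j) by exact: bigcupT_measurable.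
apply: (@energy_lsc 1 E_) => //; split.
- move=> z; have [[j0 _ Ez]|nz] := pselect ((\bigcup_j E_ j) z).
    by exists j0 => j jj; split => [Ejz|_]; [by exists j|exact: nd jj _ Ez].
  by exists 0%N => j _; split => [Ejz|//]; exists j.
- exists (\bigcup_j E_ j); last by move=> j; exact: bigcup_sup.
  (* The union serves as the dominating set of finite volume: the volumes increase and stay below
     [K + c]. *)
  split => //; apply: (@le_lt_trans _ _ (K + c)%:E); last exact: ltry.
  have nd' : {homo E_ : i j / (i <= j)%N >-> (i <= j)%O} by move=> i j ij; apply/subsetPset; exact: nd.
  have cm := nondecreasing_cvg_mu mE_ mU nd'.
  rewrite -(cvg_lim _ (cm _ mu))//; apply: lime_le; first exact: cvgP (cm _ _).
  apply: nearW => j /=; apply: (le_trans (volume_le_energy (bE_ j))).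
  by rewrite EFinD; apply: leeD.
- by left; split => // j; exact: bigcup_sup.
Qed.

Lemma energy_bigcap (E_ : nat -> set V) (c : R) : (forall j, BV_set (E_ j)) ->
  (forall i j, (i <= j)%N -> E_ j `<=` E_ i) -> (forall j, (en (E_ j) <= c%:E)%E) ->
  BV_set (\bigcap_j E_ j) /\ (en (\bigcap_j E_ j) <= c%:E)%E.
Proof.
move=> bE_ nd Hc; apply: (@energy_lsc (-1) E_) => //; split.
- move=> z; have [Ez|/existsNP[j0 /existsNP[_ nE]]] := pselect ((\bigcap_j E_ j) z).
    by exists 0%N => j _; split => // _; exact: Ez.
  exists j0 => j jj; split => [Ez|Ez]; last exact: Ez.
  by exfalso; apply: nE; exact: nd jj _ Ez.
- exists (E_ 0%N); last by move=> j; exact: nd.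
  by have /BV_setP[] := bE_ 0%N.
- by right; split => // j; exact: bigcap_inf.
Qed.

(** The energy may be infinite; collecting the real upper bounds of its values makes the infimum a
    real number. The set is nonempty because [E0] itself has no distance term. *)
Let attained := [set c : R | exists2 E, BV_set E & (en E <= c%:E)%E].

Lemma energy_initial : (en E0 = (cap beta E0)%:E)%E.
Proof.
rewrite /energy /dsym setDv setU0 integral_set0 mule0 adde0 //.
Qed.

Let has_inf_attained : has_inf attained.
Proof.
split; first by exists (cap beta E0); exists E0 => //; rewrite energy_initial.
by exists 0 => c [E bE]; move=> /(le_trans (energy_ge0 bE)); rewrite lee_fin.
Qed.

Let m : R := inf attained.

Let m_le E : BV_set E -> (m%:E <= en E)%E.
Proof.
move=> bE; have := energy_ge0 bE; case eE : (en E) => [c| |] // _; last exact: leey.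
rewrite lee_fin; apply: ge_inf; first exact: has_inf_attained.2.
by exists E => //; rewrite eE.
Qed.

Let m_approx e : 0 < e -> exists2 E, BV_set E & (en E <= (m + e)%:E)%E.
Proof.
move=> e0; have [c [E bE Ec] cm] := inf_adherent e0 has_inf_attained.
by exists E => //; apply: (le_trans Ec); rewrite lee_fin ltW.
Qed.

(** Defects above the infimum add up: the energies of intersection and union sum to at most
    [2 * m + a + b], and each of them is at least [m]. *)
Let energy_lattice E F (a b : R) : BV_set E -> BV_set F ->
  (en E <= (m + a)%:E)%E -> (en F <= (m + b)%:E)%E ->
  [/\ BV_set (E `&` F), BV_set (E `|` F), (en (E `&` F) <= (m + (a + b))%:E)%E &
      (en (E `|` F) <= (m + (a + b))%:E)%E].
Proof.
move=> bE bF Ea Fb.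
have [bI bU _] := cap_submodular ab ab k0' (fun y => lexx _) bE bF.
have sd0 : (0%:E <= set_dist (rel_boundary E0) (rel_boundary E0))%E.
  by apply: le_ereal_inf_tmp => _ [p _ <-]; rewrite lee_fin eucl_norm_ge0.
have := energy_submodular ab ab k0' (fun y => lexx _) bE0 bE0 (@subset_refl _ E0) l0 (lexx 0) sd0 bE bF.
rewrite mul0r mul0e mule0 adde0 => H.
have {}H : (en (E `&` F) + en (E `|` F) <= (m + (m + (a + b)))%:E)%E.
  apply: (le_trans H); apply: (le_trans (leeD Ea Fb)); rewrite -EFinD lee_fin; lra.
split => //; last exact: lee_cancel (m_le bI) H.
by apply: (lee_cancel (m_le bU)); rewrite addeC.
Qed.

Let isMin E := BV_set E /\ (en E <= m%:E)%E.

Let isMinP E : isMin E <-> BV_set E /\ forall G, BV_set G -> (en E <= en G)%E.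
Proof.
split=> [[bE Em]|[bE H]]; (split; first exact: bE).
  by move=> G bG; apply: (le_trans Em); exact: m_le.
apply/lee_addgt0Pr => e e0; have [G bG Gm] := m_approx e0.
by apply: (le_trans (H _ bG)); rewrite -EFinD.
Qed.

Let isMin_setIU E F : isMin E -> isMin F -> isMin (E `&` F) /\ isMin (E `|` F).
Proof.
move=> [bE Em] [bF Fm].
have := @energy_lattice E F 0 0 bE bF; rewrite !addr0 => /(_ Em Fm)[bI bU I U].
by split; split; [exact: bI|exact: I|exact: bU|exact: U].
Qed.

Let exists_isMin : exists E, isMin E.
Proof.
pose g j : R := 2 ^- j.
have g0 j : 0 < g j by rewrite /g invr_gt0 exprn_gt0.
have gS j : g j.+1 = g j / 2 by rewrite /g exprSr invfM.
have [E_ HE] : {E_ : nat -> set V & forall j, BV_set (E_ j) /\ (en (E_ j) <= (m + g j)%:E)%E}.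
  apply: (@choice _ _ (fun j E => BV_set E /\ (en E <= (m + g j)%:E)%E)) => j.
  by have [E bE HE] := m_approx (g0 j); exists E.
(* [U i j] is the union of the sets [E_] with indices from [i] to [i + j]. Its defect is at most the
   sum of the [g] over these indices, that is [2 * g i - g (i + j)], and so stays below [2 * g i]
   for all [j]. *)
pose U := fix U i j := if j is j'.+1 then U i j' `|` E_ (i + j)%N else E_ i.
have US i j : U i j.+1 = U i j `|` E_ (i + j.+1)%N by [].
have HU i j : BV_set (U i j) /\ (en (U i j) <= (m + (2 * g i - g (i + j)%N))%:E)%E.
  elim: j => [|j [bU IH]].
    have [bE HEi] := HE i; split => //; rewrite addn0; apply: (le_trans HEi).
    by rewrite lee_fin; lra.
  have [bE HEi] := HE (i + j.+1)%N.
  have [_ bUU _ H] := energy_lattice bU bE IH HEi.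
  rewrite US; split => //; apply: (le_trans H); rewrite lee_fin.
  by have := gS (i + j)%N; rewrite addnS; lra.
have Umono i a b : (a <= b)%N -> U i a `<=` U i b.
  move=> /subnK <-; elim: (b - a)%N => [|d IH]; first by rewrite add0n.
  by rewrite addSn US; apply: subset_trans IH _; exact: subsetUl.
have Ushift i j : U i.+1 j `<=` U i j.+1.
  elim: j => [|j IH]; first by rewrite US addn1; exact: subsetUr.
  by rewrite US [X in _ `<=` X]US addSnnS; exact: setSU.
pose W i := \bigcup_j U i j.
have HW i : BV_set (W i) /\ (en (W i) <= (m + 2 * g i)%:E)%E.
  apply: energy_bigcup; [by move=> j; have [] := HU i j|by move=> a b ab'; exact: Umono|].
  by move=> j; apply: (le_trans (HU i j).2); rewrite lee_fin; have := g0 (i + j)%N; lra.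
have WS i : W i.+1 `<=` W i by move=> z [j _ Uz]; exists j.+1 => //; exact: Ushift.
have Wmono a b : (a <= b)%N -> W b `<=` W a.
  move=> /subnK <-; elim: (b - a)%N => [|d IH]; first by rewrite add0n.
  by rewrite addSn; exact: subset_trans (WS _) IH.
have gmono a b : (a <= b)%N -> g b <= g a.
  move=> /subnK <-; elim: (b - a)%N => [|d IH]; first by rewrite add0n.
  by rewrite addSn gS; have := g0 (d + a)%N; lra.
(* Dropping the first [i] terms does not change a decreasing intersection, so its defect is at most
   [2 * g i] for every [i]. *)
have HL i : BV_set (\bigcap_j W j) /\ (en (\bigcap_j W j) <= (m + 2 * g i)%:E)%E.
  have -> : \bigcap_j W j = \bigcap_j W (i + j)%N.
    apply/seteqP; split => z Hz j _; first exact: Hz.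
    by apply: (Wmono _ (i + j)%N); [exact: leq_addl|exact: Hz].
  apply: energy_bigcap; [by move=> j; have [] := HW (i + j)%N| |].
    by move=> a b ab'; apply: Wmono; rewrite leq_add2l.
  move=> j; apply: (le_trans (HW (i + j)%N).2); rewrite lee_fin.
  by have := gmono _ _ (leq_addr j i); lra.
exists (\bigcap_j W j); split; first by have [] := HL 0%N.
apply/lee_addgt0Pr => e e0.
have [i ie] : exists i, 2 * g i <= e.
  have [i Hi] := exists_inv_lt (divr_gt0 e0 (ltr0n _ 2)).
  exists i.+1; have : g i.+1 <= i.+1%:R^-1.
    by rewrite /g lef_pV2 ?posrE ?exprn_gt0// -natrX ler_nat ltnW// ltn_expl.
  move=> /le_lt_trans/(_ Hi); rewrite ltr_pdivlMr// mulrC; exact: ltW.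
by apply: (le_trans (HL i).2); rewrite -EFinD lee_fin; lra.
Qed.

Let vol E : R := fine (mu E).

Let isMin_vol E : isMin E -> mu E = (vol E)%:E /\ 0 <= vol E <= K + m.
Proof.
move=> [bE Em]; have /BV_setP[mE _ Eoo _] := bE.
have EV : mu E = (vol E)%:E by rewrite /vol fineK// ge0_fin_numE.
split => //; rewrite /vol fine_ge0//= -lee_fin -EV EFinD.
by apply: (le_trans (volume_le_energy bE)); apply: leeD.
Qed.

(** Finite unions of minimizers with volumes approaching the supremum increase to a minimizer of
    maximal volume. Adding another minimizer cannot raise that volume, so the part added is null. *)
Let maximal_isMin : exists2 F, isMin F & forall E, isMin E -> mu (E `\` F) = 0%E.
Proof.
pose S := [set v | exists2 E, isMin E & v = vol E].
have hS : has_sup S.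
  have [E mE] := exists_isMin; split; first by exists (vol E); exists E.
  by exists (K + m) => _ [F mF ->]; have [_ /andP[]] := isMin_vol mF.
have [E_ HE] : {E_ : nat -> set V & forall j, isMin (E_ j) /\ sup S - j.+1%:R^-1 < vol (E_ j)}.
  apply: (@choice _ _ (fun j E => isMin E /\ sup S - j.+1%:R^-1 < vol E)) => j.
  have j0 : 0 < j.+1%:R^-1 :> R by rewrite invr_gt0.
  by have [_ [E mE ->] HE] := sup_adherent j0 hS; exists E.
pose U := fix U j := if j is j'.+1 then U j' `|` E_ j else E_ 0%N.
have HU j : isMin (U j).
  elim: j => [|j IH] /=; first by have [] := HE 0%N.
  by have [] := isMin_setIU IH (HE j.+1).1.
have Umono a b : (a <= b)%N -> U a `<=` U b.
  move=> /subnK <-; elim: (b - a)%N => [|d IH]; first by rewrite add0n.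
  by rewrite addSn /=; apply: subset_trans IH _; exact: subsetUl.
have mF : isMin (\bigcup_j U j).
  apply: energy_bigcup; [by move=> j; have [] := HU j|exact: Umono|by move=> j; have [] := HU j].
exists (\bigcup_j U j) => // E mE.
have [_ mEU] := isMin_setIU mE mF.
have supF : sup S <= vol (\bigcup_j U j).
  apply/ler_addgt0Pr => e e0; have [j je] := exists_inv_lt e0.
  have EjU : E_ j `<=` \bigcup_j U j.
    by apply: subset_trans (bigcup_sup (P := setT) (i := j) I); case: j {je} => [|j] /=; [exact: subset_refl|exact: subsetUr].
  have : vol (E_ j) <= vol (\bigcup_j U j).
    have [V1 _] := isMin_vol (HE j).1; have [V2 _] := isMin_vol mF.
    rewrite -lee_fin -V1 -V2; apply: le_measure; rewrite ?inE//.
      by have [/BV_setP[]] := (HE j).1.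
    by have [/BV_setP[]] := mF.
  by have [_] := HE j; move: je; set x := (_%:R^-1); move: x => x; lra.
have volEU : vol (E `|` \bigcup_j U j) <= sup S.
  by apply: sup_upper_bound => //; exists (E `|` \bigcup_j U j).
have [V1 _] := isMin_vol mEU; have [V2 _] := isMin_vol mF.
have mmE : measurable E by have [/BV_setP[]] := mE.
have mmF : measurable (\bigcup_j U j) by have [/BV_setP[]] := mF.
have -> : E `\` \bigcup_j U j = (E `|` \bigcup_j U j) `\` \bigcup_j U j.
  by rewrite setDUl setDv setU0.
have mmU := measurableU _ _ mmE mmF.
apply: (measure_setD_null mmU mmF _ V1 V2); first exact: subsetUr.
exact: le_trans volEU supF.
Qed.

Let minimal_isMin : exists2 F, isMin F & forall E, isMin E -> mu (F `\` E) = 0%E.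
Proof.
pose S := [set v | exists2 E, isMin E & v = vol E].
have hS : has_inf S.
  have [E mE] := exists_isMin; split; first by exists (vol E); exists E.
  by exists 0 => _ [F mF ->]; have [_ /andP[]] := isMin_vol mF.
have [E_ HE] : {E_ : nat -> set V & forall j, isMin (E_ j) /\ vol (E_ j) < inf S + j.+1%:R^-1}.
  apply: (@choice _ _ (fun j E => isMin E /\ vol E < inf S + j.+1%:R^-1)) => j.
  have j0 : 0 < j.+1%:R^-1 :> R by rewrite invr_gt0.
  by have [_ [E mE ->] HE] := inf_adherent j0 hS; exists E.
pose U := fix U j := if j is j'.+1 then U j' `&` E_ j else E_ 0%N.
have HU j : isMin (U j).
  elim: j => [|j IH] /=; first by have [] := HE 0%N.
  by have [] := isMin_setIU IH (HE j.+1).1.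
have Umono a b : (a <= b)%N -> U b `<=` U a.
  move=> /subnK <-; elim: (b - a)%N => [|d IH]; first by rewrite add0n.
  by rewrite addSn /=; apply: subset_trans IH; exact: subIsetl.
have mF : isMin (\bigcap_j U j).
  apply: energy_bigcap; [by move=> j; have [] := HU j|exact: Umono|by move=> j; have [] := HU j].
exists (\bigcap_j U j) => // E mE.
have [mEI _] := isMin_setIU mF mE.
have infF : vol (\bigcap_j U j) <= inf S.
  apply/ler_addgt0Pr => e e0; have [j je] := exists_inv_lt e0.
  have EjU : \bigcap_j U j `<=` E_ j.
    by apply: subset_trans (bigcap_inf (P := setT) (i := j) I) _; case: j {je} => [|j] /=; [exact: subset_refl|exact: subIsetr].
  have : vol (\bigcap_j U j) <= vol (E_ j).
    have [V1 _] := isMin_vol (HE j).1; have [V2 _] := isMin_vol mF.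
    rewrite -lee_fin -V1 -V2; apply: le_measure; rewrite ?inE//.
      by have [/BV_setP[]] := mF.
    by have [/BV_setP[]] := (HE j).1.
  by have [_] := HE j; move: je; set x := (_%:R^-1); move: x => x; lra.
have volEI : inf S <= vol (\bigcap_j U j `&` E).
  by apply: ge_inf; [exact: hS.2|exists (\bigcap_j U j `&` E)].
have [V1 _] := isMin_vol mEI; have [V2 _] := isMin_vol mF.
have mmE : measurable E by have [/BV_setP[]] := mE.
have mmF : measurable (\bigcap_j U j) by have [/BV_setP[]] := mF.
have -> : \bigcap_j U j `\` E = \bigcap_j U j `\` (\bigcap_j U j `&` E).
  by rewrite setDIr setDv set0U.
have mmI := measurableI _ _ mmF mmE.
apply: (measure_setD_null mmF mmI _ V2 V1); first exact: subIsetl.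
exact: le_trans infF volEI.
Qed.

Let minimizerE E : minimizer beta E0 l E <-> isMin E.
Proof.
rewrite isMinP; split => -[bE H]; (split; first exact: bE) => G bG; have := H G bG;
  by rewrite (ATWE _ _ ab k0' bE) (ATWE _ _ ab k0' bG).
Qed.

Lemma maximal_minimizer : exists2 F, minimizer beta E0 l F &
  forall E, minimizer beta E0 l E -> mu (E `\` F) = 0%E.
Proof.
have [F mF H] := maximal_isMin; exists F; first exact/minimizerE.
by move=> E /minimizerE; exact: H.
Qed.

Lemma minimal_minimizer : exists2 F, minimizer beta E0 l F &
  forall E, minimizer beta E0 l E -> mu (F `\` E) = 0%E.
Proof.
have [F mF H] := minimal_isMin; exists F; first exact/minimizerE.
by move=> E /minimizerE; exact: H.
Qed.

Lemma minimizer_energyP E : minimizer beta E0 l E <->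
  BV_set E /\ forall G, BV_set G -> (en E <= en G)%E.
Proof. by rewrite minimizerE isMinP. Qed.

Lemma minimizer_energy_fin E : minimizer beta E0 l E -> exists c : R, en E = c%:E.
Proof.
move=> /minimizerE[bE]; have := energy_ge0 bE.
by case: (en E) => [c| |] // _ _; exists c.
Qed.

End one_problem.

End problem.

(** * Changing the boundary data on a null set *)

Section null_modification.
Variables (R : realType) (n : nat).
Local Notation V := (ambient R n).
Local Notation mu := (@volume R n).
Implicit Types (E F : set V) (beta : 'rV[R]_n -> R) (N : set 'rV[R]_n).

(** The value -1 on [N] meets the bounds of [admissible], and it preserves the order of two
    functions changed on the same [N]. *)
Definition off_null beta N y : R := beta y * \1_(~` N) y - \1_N y.

Lemma off_nullE beta N y : ~ N y -> off_null beta N y = beta y.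
Proof. by move=> Ny; rewrite /off_null !indicE in_setC (memNset Ny) mulr1 subr0. Qed.

Lemma off_null_in beta N y : N y -> off_null beta N y = -1.
Proof.
by move=> Ny; rewrite /off_null !indicE in_setC (mem_set Ny) mulr0 sub0r.
Qed.

Lemma minimizer_off_null beta N E0 l E : measurable N -> leb R n N = 0%E ->
  minimizer (off_null beta N) E0 l E <-> minimizer beta E0 l E.
Proof.
move=> mN N0; have AE G : ATW (off_null beta N) E0 l G = ATW beta E0 l G.
  rewrite /ATW /capillary; congr (_ - _ + _)%E.
  by apply: (integral_eq_off_null mN N0) => y Ny; rewrite off_nullE.
by split; move=> [bE H]; split => // G bG; have := H G bG; rewrite !AE.
Qed.

Lemma admissible_off_null beta N (k : R) : measurable N -> measurable_fun setT beta ->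
  k <= 1 / 2 -> (forall y, ~ N y -> -1 <= beta y <= 1 - 2 * k) ->
  admissible (off_null beta N) k.
Proof.
move=> mN mb k1 H; split.
  apply: measurable_funB; last exact: measurable_indic.
  by apply: measurable_funM => //; apply: measurable_indic; exact: measurableC.
move=> y; have [Ny|Ny] := pselect (N y); last by rewrite off_nullE//; exact: H.
by rewrite off_null_in//; apply/andP; split; lra.
Qed.

End null_modification.

(** * Comparison of the minimizers of the two energies *)

Section comparison.
Variables (R : realType) (n : nat).
Local Notation V := (ambient R n).
Local Notation mu := (@volume R n).
Variables (E0 F0 : set V) (beta1 beta2 : 'rV[R]_n -> R) (k l M : R).
Hypotheses (a1 : admissible beta1 k) (a2 : admissible beta2 k).
Hypotheses (k0 : 0 < k) (k1 : k <= 1 / 2) (l1 : 1 <= l) (b12 : forall y, beta1 y <= beta2 y).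
Hypotheses (bE0 : BV_set E0) (bF0 : BV_set F0) (EF0 : E0 `<=` F0).
Hypotheses (E0M : E0 `<=` [set z | `|z| <= M]) (F0M : F0 `<=` [set z | `|z| <= M]).

Let l0 : 0 <= l := le_trans ler01 l1.

(** The energies of [E] and [F] are finite and minimal, so submodularity forces intersection and
    union to have the same minimal energies and leaves no positive surplus. *)
Let compare E F (d : R) : 0 <= d ->
  (d%:E <= set_dist (rel_boundary E0) (rel_boundary F0))%E ->
  minimizer beta1 E0 l E -> minimizer beta2 F0 l F ->
  [/\ minimizer beta1 E0 l (E `&` F), minimizer beta2 F0 l (E `|` F) &
    (l%:E * ((d / (n.+1%:R * 2))%:E * mu (E `\` F)) <= 0)%E].
Proof.
move=> d0 Hd mE mF.
have [cE eE] := minimizer_energy_fin a1 k0 k1 l1 bE0 mE.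
have [cF eF] := minimizer_energy_fin a2 k0 k1 l1 bF0 mF.
have /(minimizer_energyP a1 k0 k1 l1 bE0)[bE HE] := mE.
have /(minimizer_energyP a2 k0 k1 l1 bF0)[bF HF] := mF.
have [bI bU _] := cap_submodular a1 a2 (ltW k0) b12 bE bF.
have := energy_submodular a1 a2 (ltW k0) b12 bE0 bF0 EF0 l0 d0 Hd bE bF.
have := HE _ bI; have := HF _ bU; rewrite eE eF -EFinD.
set x := energy beta1 E0 l (E `&` F); set y := energy beta2 F0 l (E `|` F).
set w := (_ * _)%E => Hy Hx Hs.
have w0 : (0 <= w)%E.
  by rewrite mule_ge0 ?lee_fin// mule_ge0// lee_fin divr_ge0.
have xy : (x + y <= (cE + cF)%:E)%E by apply: le_trans Hs; rewrite leeDl.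
split.
- apply/(minimizer_energyP a1 k0 k1 l1 bE0); split; first exact: bI.
  have yx : (y + x <= (cF + cE)%:E)%E by rewrite addeC [(cF + cE)%R]addrC.
  have xE := lee_cancel Hy yx.
  by move=> G bG; apply: le_trans (HE _ bG); rewrite eE.
- apply/(minimizer_energyP a2 k0 k1 l1 bF0); split; first exact: bU.
  have yF := lee_cancel Hx xy.
  by move=> G bG; apply: le_trans (HF _ bG); rewrite eF.
- apply: (@lee_cancel R (x + y)%E w (cE + cF) 0); last by rewrite addr0.
  by rewrite EFinD; exact: leeD.
Qed.

Let dist0 : (0%:E <= set_dist (rel_boundary E0) (rel_boundary F0))%E.
Proof. by apply: le_ereal_inf_tmp => _ [p _ <-]; rewrite lee_fin eucl_norm_ge0. Qed.

Lemma comparison_maximal : exists2 F, minimizer beta2 F0 l F &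
  forall E, minimizer beta1 E0 l E -> ae_subset E F.
Proof.
have [F mF H] := maximal_minimizer a2 k0 k1 l1 bF0 F0M; exists F => // E mE.
have [_ /H mEF _] := compare (lexx 0) dist0 mE mF.
by move: mEF; rewrite setDUl setDv setU0.
Qed.

Lemma comparison_minimal : exists2 E, minimizer beta1 E0 l E &
  forall F, minimizer beta2 F0 l F -> ae_subset E F.
Proof.
have [E mE H] := minimal_minimizer a1 k0 k1 l1 bE0 E0M; exists E => // F mF.
have [/H mEF _ _] := compare (lexx 0) dist0 mE mF.
by move: mEF; rewrite setDIr setDv set0U.
Qed.

Lemma comparison_all E F : (0 < set_dist (rel_boundary E0) (rel_boundary F0))%E ->
  minimizer beta1 E0 l E -> minimizer beta2 F0 l F -> ae_subset E F.
Proof.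
move=> sd0 mE mF.
(* An infinite distance means that one of the boundaries is empty, and then any positive [d]
   serves. *)
have [d d0 Hd] : exists2 d : R, 0 < d & (d%:E <= set_dist (rel_boundary E0) (rel_boundary F0))%E.
  move: sd0; case: set_dist => [d| |] //; first by rewrite lte_fin => d0; exists d.
  by exists 1; [exact: ltr01|exact: leey].
have [_ _] := compare (ltW d0) Hd mE mF.
have e0 : 0 < d / (n.+1%:R * 2) by rewrite divr_gt0// mulr_gt0.
have lp : 0 < l by exact: lt_le_trans l1.
rewrite pmule_rle0 ?lte_fin// pmule_rle0 ?lte_fin// => H.
by apply/eqP; rewrite eq_le H measure_ge0.
Qed.

End comparison.

Unset Implicit Arguments.

Theorem theorem6p1 (R : realType) (n : nat) (hn : (1 <= n)%N)
    (E0 F0 : set (ambient R n)) (beta1 beta2 : 'rV[R]_n -> R) (kappa lambda : R) :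
  BV_set E0 -> density_one E0 = E0 -> E0 !=set0 -> bounded_set E0 ->
  BV_set F0 -> density_one F0 = F0 -> F0 !=set0 -> bounded_set F0 ->
  beta1 \in Lfun (leb R n) +oo%E -> beta2 \in Lfun (leb R n) +oo%E ->
  0 < kappa -> kappa <= 1 / 2 ->
  (\forall y \ae leb R n, -1 <= beta1 y <= 1 - 2 * kappa) ->
  (\forall y \ae leb R n, -1 <= beta2 y <= 1 - 2 * kappa) ->
  1 <= lambda ->
  ae_subset E0 F0 ->
  (\forall y \ae leb R n, beta1 y <= beta2 y) ->
  [/\ exists Fstar, minimizer beta2 F0 lambda Fstar /\
        forall E, minimizer beta1 E0 lambda E -> ae_subset E Fstar,
      exists Estar, minimizer beta1 E0 lambda Estar /\
        forall F, minimizer beta2 F0 lambda F -> ae_subset Estar F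
    & (0 < set_dist (rel_boundary E0) (rel_boundary F0))%E ->
      forall E F, minimizer beta1 E0 lambda E -> minimizer beta2 F0 lambda F ->
        ae_subset E F].
Proof.
move=> bE0 dE0 _ [ME [_ HE]] bF0 dF0 _ [MF [_ HF]] L1 L2 k0 k1 B1 B2 l1 EF0 B12.
have mb1 : measurable_fun setT beta1 by move: L1; rewrite inE => /andP[/set_mem].
have mb2 : measurable_fun setT beta2 by move: L2; rewrite inE => /andP[/set_mem].
have /BV_setP[mE0 _ _ _] := bE0; have /BV_setP[mF0 _ _ _] := bF0.
have sub := density_one_subset mE0 mF0 EF0 dE0 dF0.
(* [bounded_set] provides a bound by every number strictly above [ME], hence the [+ 1]. *)
have E0M : E0 `<=` [set z | `|z| <= ME + 1] by move=> z; apply: HE; rewrite ltrDl.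
have F0M : F0 `<=` [set z | `|z| <= MF + 1] by move=> z; apply: HF; rewrite ltrDl.
(* One null set gathers the three almost everywhere hypotheses; both functions are replaced by -1 on
   it. *)
have [N [mN N0 HN]] : (leb R n).-negligible (~` [set y |
    [/\ -1 <= beta1 y <= 1 - 2 * kappa, -1 <= beta2 y <= 1 - 2 * kappa & beta1 y <= beta2 y]]).
  by apply: filterS3 B1 B2 B12 => y.
have {}HN y : ~ N y -> [/\ -1 <= beta1 y <= 1 - 2 * kappa,
    -1 <= beta2 y <= 1 - 2 * kappa & beta1 y <= beta2 y].
  by move=> Ny; apply: contrapT => H; apply: Ny; apply: HN.
have a1 : admissible (off_null beta1 N) kappa.
  by apply: admissible_off_null => // y /HN[].
have a2 : admissible (off_null beta2 N) kappa.
  by apply: admissible_off_null => // y /HN[].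
have b12 y : off_null beta1 N y <= off_null beta2 N y.
  have [Ny|Ny] := pselect (N y); first by rewrite !off_null_in.
  by rewrite !off_nullE//; have [] := HN _ Ny.
have m1 E := minimizer_off_null beta1 E0 lambda E mN N0.
have m2 F := minimizer_off_null beta2 F0 lambda F mN N0.
split.
- have [F mF H] := comparison_maximal a1 a2 k0 k1 l1 b12 bE0 bF0 sub F0M.
  by exists F; split; [exact/m2|move=> E /m1; exact: H].
- have [E mE H] := comparison_minimal a1 a2 k0 k1 l1 b12 bE0 bF0 sub E0M.
  by exists E; split; [exact/m1|move=> F /m2; exact: H].
- move=> sd E F /m1 mE /m2 mF.
  exact: (comparison_all a1 a2 k0 k1 l1 b12 bE0 bF0 sub sd mE mF).
Qed.
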